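(* In the setting described in the context, let $S\subset\Omega$, $\Sigma\subset\widehat\Omega$ be a pair of measurable subsets with $0<\mu_{2m}(S)<\infty$ and $0<\widehat\mu_{2\widehat m}(\Sigma)<\infty$. Then there exists a constant $C(S,\Sigma)$ such that for every $f\in L^2(\Omega,\mu)$, $$\|f\|^2_{L^2(\Omega,\mu)}\le C(S,\Sigma)\Big(\|f\|^2_{L^2(S^c,\mu)}+\|\mathcal T(f)\|^2_{L^2(\Sigma^c,\widehat\mu)}\Big),$$ where $S^c=\Omega\setminus S$ and $\Sigma^c=\widehat\Omega\setminus\Sigma$.
   Context: Let $\Omega,\widehat\Omega\subset\mathbb R^d$ be convex cones ($\lambda x$ stays in the cone for $x$ in the cone and $\lambda>0$) with non-empty interior, endowed with Borel measures $\mu,\widehat\mu$, absolutely continuous with respect to Lebesgue measure, with polar decompositions $d\mu(r\zeta)=r^{2a-1}\,dr\,Q(\zeta)\,d\sigma(\zeta)$ and $d\widehat\mu(r\zeta)=r^{2\widehat a-1}\,dr\,\widehat Q(\zeta)\,d\sigma(\zeta)$, where $\sigma$ is the surface measure on the unit sphere $\mathbb S^{d-1}$, $Q,\widehat Q\in L^1(\mathbb S^{d-1},d\sigma)$ are nonnegative and not identically zero, and $\widehat a=a>0$. Let $\mathcal K:\Omega\times\widehat\Omega\to\mathbb C$ be a kernel that is continuous, polynomially bounded: $|\mathcal K(x,\xi)|\le c_{\mathcal T}(1+|x|)^m(1+|\xi|)^{\widehat m}$ (with $m,\widehat m\ge0$), and homogeneous: $\mathcal K(\lambda x,\xi)=\mathcal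 K(x,\lambda\xi)$ for $\lambda>0$. Define the integral operator $$\mathcal T(f)(\xi)=\int_\Omega f(x)\mathcal K(x,\xi)\,d\mu(x),\qquad \xi\in\widehat\Omega,$$ on $\mathcal S(\Omega)$ (Schwartz functions on $\Omega$). For $\rho\ge0$ put $d\mu_\rho(x)=(1+|x|)^\rho d\mu(x)$, $d\widehat\mu_\rho(\xi)=(1+|\xi|)^\rho d\widehat\mu(\xi)$; the same integral defines $\mathcal T(f)$ for $f\in L^1(\Omega,\mu_m)$. Assume: (Inversion Formula) if $f\in L^1(\Omega,\mu_m)$ and $\mathcal T(f)\in L^1(\widehat\Omega,\widehat\mu_{\widehat m})$, then $f$ is (a.e. equal to) a continuous function with $\sup_x |f(x)|/(1+|x|)^m<\infty$ and $f(x)=\int_{\widehat\Omega}\mathcal T(f)(\xi)\overline{\mathcal K(x,\xi)}\,d\widehat\mu(\xi)$ for $x\in\Omega$; (Plancherel) $\|\mathcal T(f)\|_{L^2(\widehat\Omega,\widehat\mu)}=\|f\|_{L^2(\Omega,\mu)}$ for $f\in\mathcal S(\Omega)$, and $\mathcal T$ extends uniquely to a unitary operator from $L^2(\Omega,\mu)$ onto $L^2(\widehat\Omega,\widehat\mu)$, still denoted $\mathcal T$. *)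

(* Defs.v *)
From HB Require Import structures.
From mathcomp Require Import all_boot all_order all_algebra.
From mathcomp Require Import all_classical all_reals all_analysis.
From mathcomp Require Import measurable_realfun complex.

Set Implicit Arguments.
Unset Strict Implicit.
Unset Printing Implicit Defensive.

Import Order.TTheory GRing.Theory Num.Theory.
Import numFieldTopology.Exports numFieldNormedType.Exports.
Import ComplexField.

Local Open Scope classical_set_scope.
Local Open Scope ring_scope.

(* 'rV[R]_d carries its Borel sigma-algebra. *)
HB.instance Definition _ (R : realType) (d : nat) :=
  Measurable.copy 'rV[R]_d (g_sigma_algebraType (@open 'rV[R]_d)).

Section measurable_rV.
Context {R : realType} {d : nat}.

Lemma open_measurable_rV (U : set 'rV[R]_d) : open U -> measurable U.
Proof. exact: sub_sigma_algebra. Qed.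

Lemma continuous_measurable_rV (f : 'rV[R]_d -> R) :
  continuous f -> measurable_fun setT f.
Proof.
move=> cf; apply: (measurability _ (RGenOpens.measurableE R)).
move=> _ [_ [a [b ->]] <-]; rewrite setTI; apply: open_measurable_rV.
by move/continuousP : cf; apply; exact: interval_open.
Qed.

Lemma measurable_coord (i : 'I_d) :
  measurable_fun setT (fun x : 'rV[R]_d => x ord0 i).
Proof. by apply: continuous_measurable_rV; exact: coord_continuous. Qed.

Lemma open_rV_box (U : set 'rV[R]_d) : open U ->
  U = \bigcup_(qk in [set qk : 'rV[rat]_d * nat |
        (forall x : 'rV[R]_d,
           (forall i, ball (ratr (qk.1 ord0 i) : R) qk.2.+1%:R^-1 (x ord0 i)) ->
           U x)])
      [set x | forall i, ball (ratr (qk.1 ord0 i) : R) qk.2.+1%:R^-1 (x ord0 i)].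
Proof.
move=> oU; apply/seteqP; split => [x Ux|x [qk /= h /h//]].
have /nbhs_ballP[e /= e0 xeU] : nbhs x U by apply: open_nbhs_nbhs.
have [k ke] : exists k : nat, k.+1%:R^-1 < e / 2.
  have e20 : 0 < e / 2 by rewrite divr_gt0.
  by have [k _ /(_ k (leqnn k))] := near_infty_natSinv_lt (PosNum e20); exists k.
have k0 : 0 < k.+1%:R^-1 :> R by rewrite invr_gt0.
have /choice[q qx] : forall i : 'I_d, exists q : rat,
    ball (ratr q : R) k.+1%:R^-1 (x ord0 i).
  move=> i; have : x ord0 i - k.+1%:R^-1 < x ord0 i + k.+1%:R^-1.
    by rewrite ltrBlDr -addrA ltrDl addr_gt0.
  move=> /rat_in_itvoo[q]; rewrite in_itv/= => /andP[q1 q2]; exists q.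
  rewrite /ball/= ltr_norml; apply/andP; split.
    by rewrite ltrBrDl.
  by rewrite ltrBlDl.
exists (\row_i q i, k) => /=; last by move=> i; rewrite mxE.
move=> y qy; apply: xeU; split => // i j; rewrite ord1.
rewrite (splitr e); apply: (@ball_triangle _ _ (ratr (q j) : R)).
  by apply: ball_sym; apply: le_ball (qx j); exact: ltW.
have := qy j; rewrite mxE; apply: le_ball; exact: ltW.
Qed.

Lemma measurable_fun_rV d' (T : measurableType d') (f : T -> 'rV[R]_d) :
  (forall i, measurable_fun setT (fun t => f t ord0 i)) -> measurable_fun setT f.
Proof.
move=> mf; apply: (measurability (@open 'rV[R]_d)) => //.
move=> _ [U oU <-]; rewrite setTI (open_rV_box oU) preimage_bigcup.
rewrite bigcup_mkcond; apply: countable_bigcupT_measurable => // -[q k] /=.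
case: ifPn => // _.
rewrite (_ : _ @^-1` _ = \bigcap_(i in [set: 'I_d])
    (fun t => f t ord0 i) @^-1` ball (ratr (q ord0 i) : R) k.+1%:R^-1); last first.
  by apply/seteqP; split => [t /= h i _|t /= h i]; exact: h.
apply: fin_bigcap_measurable => // i _; rewrite -[X in measurable X]setTI.
by apply: mf => //; apply: open_measurable; exact: ball_open.
Qed.

End measurable_rV.

Section euclidean.
Context {R : realType} {d : nat}.

(* The library's norm on 'rV[R]_d is the sup norm. *)
Definition enorm (x : 'rV[R]_d) : R := Num.sqrt (\sum_i x ord0 i ^+ 2).

Lemma enorm_ge0 x : 0 <= enorm x. Proof. exact: sqrtr_ge0. Qed.

Lemma measurable_enorm : measurable_fun setT enorm.
Proof.
apply: (@measurableT_comp _ _ _ _ _ _ (@Num.sqrt R)).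
  by apply: continuous_measurable_fun; exact: sqrt_continuous.
apply: measurable_sum => i; apply: measurable_funX; exact: measurable_coord.
Qed.

Definition direction (x : 'rV[R]_d) : 'rV[R]_d := (enorm x)^-1 *: x.

Lemma measurable_direction : measurable_fun setT direction.
Proof.
apply: measurable_fun_rV => i; under eq_fun do rewrite /direction mxE.
apply: measurable_funM; last exact: measurable_coord.
under eq_fun do rewrite -powR_inv1 ?enorm_ge0//.
apply: (@measurableT_comp _ _ _ _ _ _ (fun r : R => r `^ -1)).
  exact: measurable_powR.
exact: measurable_enorm.
Qed.

Definition unit_sphere : set 'rV[R]_d := [set x | enorm x = 1].

Definition punctured_ball : set 'rV[R]_d := [set x | 0 < enorm x <= 1].

Lemma measurable_punctured_ball : measurable punctured_ball.
Proof.
rewrite (_ : punctured_ball = enorm @^-1` `]0, 1]%classic).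
  rewrite -[X in measurable X]setTI; exact: measurable_enorm.
by apply/seteqP; split => x /=; rewrite in_itv.
Qed.

End euclidean.

Section lebesgue_rV.
Context {R : realType}.

Definition cons_rV n (p : R * 'rV[R]_n) : 'rV[R]_n.+1 :=
  \row_i (if unlift ord0 i is Some j then p.2 ord0 j else p.1).

Definition uncons_rV n (x : 'rV[R]_n.+1) : R * 'rV[R]_n :=
  (x ord0 ord0, \row_j x ord0 (lift ord0 j)).

Lemma cons_rVK n : cancel (@cons_rV n) (@uncons_rV n).
Proof.
move=> [a x]; congr (_, _); first by rewrite mxE unlift_none.
by apply/rowP => j; rewrite !mxE liftK.
Qed.

Lemma measurable_cons_rV n : measurable_fun setT (@cons_rV n).
Proof.
apply: measurable_fun_rV => i; under eq_fun do rewrite mxE.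
case: unliftP => [j _|_]; last exact: measurable_fst.
apply: (@measurableT_comp _ _ _ _ _ _ (fun x : 'rV[R]_n => x ord0 j)) => //.
exact: measurable_coord.
Qed.

Lemma measurable_uncons_rV n : measurable_fun setT (@uncons_rV n).
Proof.
apply/measurable_fun_pair; first exact: measurable_coord.
apply: measurable_fun_rV => i; under eq_fun do rewrite mxE.
exact: measurable_coord.
Qed.

Section step.
Variables (n : nat) (nu : {sigma_finite_measure set 'rV[R]_n -> \bar R}).

Definition lebesgue_step : set 'rV[R]_n.+1 -> \bar R :=
  pushforward (@lebesgue_measure R \x nu)%E (@cons_rV n).

Let step0 : lebesgue_step set0 = 0%E.
Proof. by rewrite /lebesgue_step /pushforward preimage_set0 measure0. Qed.

Let step_ge0 A : (0 <= lebesgue_step A)%E.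
Proof. exact: (measure_ge0 (@lebesgue_measure R \x nu)%E). Qed.

Let step_sigma_additive : semi_sigma_additive lebesgue_step.
Proof.
pose m := measure_function_pushforward__canonical__measure_function_Measure
  (@lebesgue_measure R \x nu)%E (@measurable_cons_rV n).
exact: (@measure_semi_sigma_additive _ _ _ m).
Qed.

HB.instance Definition _ := isMeasure.Build _ _ _ lebesgue_step
  step0 step_ge0 step_sigma_additive.

Let step_sigma_finite : sigma_finite setT lebesgue_step.
Proof.
have /sigma_finiteP[F [TF ndF Foo]] := sigma_finiteT (@lebesgue_measure R).
have /sigma_finiteP[G [TG ndG Goo]] := sigma_finiteT nu.
exists (fun k => @uncons_rV n @^-1` (F k `*` G k)).
  rewrite -preimage_bigcup; apply/esym; rewrite -subTset => x _ /=.
  have [i _ Fi] : (\bigcup_i F i) (uncons_rV x).1 by rewrite -TF.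
  have [j _ Gj] : (\bigcup_i G i) (uncons_rV x).2 by rewrite -TG.
  exists (maxn i j) => //; split.
  - by move: Fi; exact/subsetPset/ndF/leq_maxl.
  - by move: Gj; exact/subsetPset/ndG/leq_maxr.
move=> k; have [mF Fk] := Foo k; have [mG Gk] := Goo k; split.
  rewrite -[X in measurable X]setTI; apply: measurable_uncons_rV => //.
  exact: measurableX.
rewrite /lebesgue_step /pushforward.
rewrite (_ : _ @^-1` _ = F k `*` G k); last first.
  by rewrite -comp_preimage (_ : _ \o _ = id)//; apply/funext; exact: cons_rVK.
by rewrite product_measure1E// lte_mul_pinfty// ge0_fin_numE.
Qed.

HB.instance Definition _ :=
  Measure_isSigmaFinite.Build _ _ _ lebesgue_step step_sigma_finite.

End step.

Fixpoint lebesgue_rV (n : nat) : {sigma_finite_measure set 'rV[R]_n -> \bar R} :=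
  if n is m.+1 then lebesgue_step (lebesgue_rV m) else \d_(0 : 'rV[R]_0).

End lebesgue_rV.

Section surface_measure.
Context {R : realType} (d : nat).
Local Open Scope ereal_scope.

(* Integration in polar coordinates gives the unit ball part of the cone over
   A the Lebesgue measure sigma(A) / d, which is used here to define sigma; the
   measure lives on 'rV[R]_d and is concentrated on the unit sphere. *)
Definition surface_measure (A : set 'rV[R]_d) : \bar R :=
  d%:R%:E * lebesgue_rV d (direction @^-1` A `&` punctured_ball).

Let cone_measure : {measure set 'rV[R]_d -> \bar R} :=
  measure_function_pushforward__canonical__measure_function_Measure
    (mrestr (lebesgue_rV d) measurable_punctured_ball) measurable_direction.

Let surfaceE : surface_measure = mscale (d%:R%:nng)%R cone_measure.
Proof. by []. Qed.

Let surface0 : surface_measure set0 = 0.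
Proof. by rewrite surfaceE measure0. Qed.

Let surface_ge0 A : 0 <= surface_measure A.
Proof. by rewrite surfaceE measure_ge0. Qed.

Let surface_sigma_additive : semi_sigma_additive surface_measure.
Proof. by rewrite surfaceE; exact: measure_semi_sigma_additive. Qed.

HB.instance Definition _ := isMeasure.Build _ _ _ surface_measure
  surface0 surface_ge0 surface_sigma_additive.

End surface_measure.
Arguments surface_measure {R d}.

Record convexCone (R : realType) (d : nat) := ConvexCone {
  cone_set : set 'rV[R]_d ;
  cone_dilate : forall (l : R) x, 0 < l -> cone_set x -> cone_set (l *: x) ;
  cone_convex : convex_set cone_set ;
  cone_interior : cone_set° !=set0 }.

(* The points of a cone form a type with the subspace topology and the
   corresponding Borel sigma-algebra; the cone itself need not be a Borel set. *)
Definition cone_point (R : realType) (d : nat) (Om : convexCone R d) : Type :=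
  set_type (cone_set Om).
Coercion cone_point : convexCone >-> Sortclass.

Section cone_point.
Context {R : realType} {d : nat} (Om : convexCone R d).

HB.instance Definition _ :=
  Topological.copy (cone_point Om) (set_type (cone_set Om)).

Let cone_nonempty : cone_set Om !=set0.
Proof. by have [x /interior_subset] := cone_interior Om; exists x. Qed.

HB.instance Definition _ := isPointed.Build (cone_point Om)
  (exist _ (projT1 (cid cone_nonempty)) (mem_set (projT2 (cid cone_nonempty)))).

HB.instance Definition _ := Measurable.copy (cone_point Om)
  (g_sigma_algebraType (@open (cone_point Om))).

Definition cone_val (x : Om) : 'rV[R]_d := set_val x.

Definition dilate (l : {posnum R}) (x : Om) : Om :=
  exist _ (l%:num *: cone_val x)
    (mem_set (cone_dilate (gt0 l) (set_valP x))).

Lemma continuous_cone_val : continuous cone_val.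
Proof. exact: initial_continuous. Qed.

Lemma measurable_cone_val : measurable_fun setT cone_val.
Proof.
apply: (measurability (@open 'rV[R]_d)) => //.
move=> _ [U oU <-]; rewrite setTI; apply: sub_sigma_algebra.
by move/continuousP : continuous_cone_val; apply.
Qed.

End cone_point.

Section cone_measures.
Context {R : realType} {d : nat} {Om : convexCone R d}.
Variable mu : {measure set Om -> \bar R}.
Local Open Scope ereal_scope.

Definition polar_density (Q : 'rV[R]_d -> R) : Prop :=
  [/\ forall z, unit_sphere z -> (0 <= Q z)%R,
      surface_measure.-integrable unit_sphere (EFin \o Q) &
      ~ {ae surface_measure, forall z, unit_sphere z -> Q z = 0%R}].

(* [mu] extended by zero to 'rV[R]_d is
   r ^ (2 a - 1) dr (x) Q(zeta) dsigma(zeta) in polar coordinates; in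
   particular Q vanishes almost everywhere off the cone. *)
Definition polar_decomposition (a : R) (Q : 'rV[R]_d -> R) : Prop :=
  forall A : set 'rV[R]_d, measurable A ->
    mu (@cone_val _ _ Om @^-1` A) =
    \int[surface_measure]_(z in unit_sphere)
      ((Q z)%:E * \int[lebesgue_measure]_(r in `]0%R, +oo[)
                    (\1_A (r *: z) * r `^ (2 * a - 1))%:E).

Definition weighted (rho : R) (A : set Om) : \bar R :=
  \int[mu]_(x in A) ((1 + enorm (cone_val x)) `^ rho)%:E.

Section weighted.
Variable rho : R.

Let weighted0 : weighted rho set0 = 0.
Proof. exact: integral_set0. Qed.

Let weighted_ge0 A : 0 <= weighted rho A.
Proof. by apply: integral_ge0 => x _; rewrite lee_fin powR_ge0. Qed.

Let weighted_sigma_additive : semi_sigma_additive (weighted rho).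
Proof.
move=> F mF tF mUF; rewrite /weighted ge0_integral_bigcup//.
- by apply: is_cvg_nneseries => n _ _; exact: weighted_ge0.
- apply/measurable_EFinP/measurable_funTS.
  apply: (@measurableT_comp _ _ _ _ _ _ (fun r : R => (r `^ rho)%R)).
    exact: measurable_powR.
  apply: measurable_funD => //.
  apply: measurableT_comp; first exact: measurable_enorm.
  exact: measurable_cone_val.
- by move=> x _; rewrite lee_fin powR_ge0.
Qed.

HB.instance Definition _ := isMeasure.Build _ _ _ (weighted rho)
  weighted0 weighted_ge0 weighted_sigma_additive.

End weighted.
End cone_measures.

Section complex_integration.
Context {R : realType} {dT} {T : measurableType dT}.
Variable mu : {measure set T -> \bar R}.

Definition cmeasurable (f : T -> R[i]) : Prop :=
  measurable_fun setT (fun x => complex.Re (f x)) /\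
  measurable_fun setT (fun x => complex.Im (f x)).

Definition cintegral (f : T -> R[i]) : R[i] :=
  (Rintegral mu setT (fun x => complex.Re (f x)) +i*
   Rintegral mu setT (fun x => complex.Im (f x)))%C.

Definition inL1 (f : T -> R[i]) : Prop :=
  mu.-integrable setT (fun x => (complex.Re (f x))%:E) /\
  mu.-integrable setT (fun x => (complex.Im (f x))%:E).

Definition sqnormL2 (A : set T) (f : T -> R[i]) : \bar R :=
  (\int[mu]_(x in A) ((Normc.normc (f x)) ^+ 2)%:E)%E.

Definition inL2 (f : T -> R[i]) : Prop :=
  cmeasurable f /\ (sqnormL2 setT f < +oo)%E.

Definition innerL2 (f g : T -> R[i]) : R[i] :=
  cintegral (fun x => f x * conjc (g x)).

Definition ae_equal (f g : T -> R[i]) : Prop := {ae mu, forall x, f x = g x}.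

End complex_integration.

(* Operators between L2 spaces act on square-integrable functions and are
   considered up to equality almost everywhere. *)
Record unitaryL2 (R : realType) (d1 d2 : measure_display)
    (T1 : measurableType d1) (T2 : measurableType d2)
    (mu : {measure set T1 -> \bar R}) (nu : {measure set T2 -> \bar R})
    (U : (T1 -> R[i]) -> (T2 -> R[i])) : Prop := UnitaryL2 {
  unitary_inL2 : forall f, inL2 mu f -> inL2 nu (U f) ;
  unitary_ae : forall f g, inL2 mu f -> inL2 mu g ->
    ae_equal mu f g -> ae_equal nu (U f) (U g) ;
  unitary_linear : forall (c : R[i]) f g, inL2 mu f -> inL2 mu g ->
    ae_equal nu (U (fun x => c * f x + g x)) (fun y => c * U f y + U g y) ;
  unitary_inner : forall f g, inL2 mu f -> inL2 mu g ->
    innerL2 nu (U f) (U g) = innerL2 mu f g ;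
  unitary_onto : forall g, inL2 nu g ->
    exists2 f, inL2 mu f & ae_equal nu (U f) g }.

Section schwartz.
Context {R : realType} {d : nat}.

Definition iter_partial (s : seq 'I_d) (g : 'rV[R]_d -> R) : 'rV[R]_d -> R :=
  foldr (fun i h x => 'D_(delta_mx ord0 i) h x) g s.

Definition schwartz (g : 'rV[R]_d -> R) : Prop :=
  (forall s x, differentiable (iter_partial s g) x) /\
  (forall s (k : nat), exists C : R, forall x,
     (1 + enorm x) ^+ k * `|iter_partial s g x| <= C).

(* Schwartz functions on a cone are the restrictions of the Schwartz functions
   on the whole space. *)
Definition schwartz_on (Om : convexCone R d) (f : Om -> R[i]) : Prop :=
  exists g h : 'rV[R]_d -> R, [/\ schwartz g, schwartz h &
    forall x : Om, f x = (g (cone_val x) +i* h (cone_val x))%C].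

End schwartz.

Section transform.
Context {R : realType} {d : nat} {Om Omh : convexCone R d}.
Variables (mu : {measure set Om -> \bar R}) (muh : {measure set Omh -> \bar R}).
Variables (m mh : R) (K : Om -> Omh -> R[i]).

Definition continuous_kernel : Prop :=
  continuous ((fun p => K p.1 p.2) : Om * Omh -> (R[i] : numFieldType)).

Definition polynomially_bounded_kernel : Prop :=
  exists c : R, forall x xi,
    Normc.normc (K x xi) <=
      c * (1 + enorm (cone_val x)) `^ m * (1 + enorm (cone_val xi)) `^ mh.

Definition homogeneous_kernel : Prop :=
  forall (l : {posnum R}) x xi, K (dilate l x) xi = K x (dilate l xi).

Definition transform (f : Om -> R[i]) (xi : Omh) : R[i] :=
  cintegral mu (fun x => f x * K x xi).

Definition inversion_formula : Prop :=
  forall f : Om -> R[i],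
    inL1 (weighted mu m) f -> inL1 (weighted muh mh) (transform f) ->
    exists g : Om -> R[i],
      [/\ ae_equal mu f g,
          continuous (g : Om -> (R[i] : numFieldType)),
          exists C : R, forall x,
            Normc.normc (g x) <= C * (1 + enorm (cone_val x)) `^ m &
          forall x, g x =
            cintegral muh (fun xi => transform f xi * conjc (K x xi))].

Definition unitary_extension (U : (Om -> R[i]) -> (Omh -> R[i])) : Prop :=
  unitaryL2 mu muh U /\
  (forall f, schwartz_on f -> ae_equal muh (U f) (transform f)).

Definition plancherel (U : (Om -> R[i]) -> (Omh -> R[i])) : Prop :=
  [/\ forall f, schwartz_on f ->
        sqnormL2 muh setT (transform f) = sqnormL2 mu setT f,
      unitary_extension U &
      forall V, unitary_extension V ->
        forall f, inL2 mu f -> ae_equal muh (V f) (U f)].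

End transform.

(* Main.v *)
(* Suppose the inequality fails. Then there are unit vectors f_n whose norm
   off S and whose transform's norm off Sigma tend to 0. If g_n is the
   restriction of T f_n to Sigma, then T^-1 g_n is given by the kernel:
   T^-1 g_n (x) = <g_n, kappa_x> with kappa_x = 1_Sigma K(x, .) square
   integrable (this is Fubini's theorem against Schwartz functions, which are
   dense by the uniqueness of the extension of T). Along a subsequence these
   values converge for every x, and |kappa_x|^2 is integrable on S, so by
   dominated convergence f_n converges to a unit vector phi that vanishes off S
   and whose transform vanishes off Sigma.

   No such phi exists. For e_1, ..., e_n orthonormal, vanishing off A with
   transforms vanishing off B, Bessel's inequality for kappa_x gives
   n <= 2 c^2 mu_2m(A) muh_2mh(B). On the other hand homogeneity of K makes
   phi(t .) concentrated on the dilated pair (A / t, t B); for t < 1 the set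
   A / t has larger measure than A, so a function concentrated there is new,
   while mu_2m(A / t \ A) and muh_2mh(t B \ B) are as small as desired for t
   near 1. Iterating gives arbitrarily many orthonormal functions on a pair of
   sets with bounded measures. *)

Require Import Defs.
From HB Require Import structures.
From mathcomp Require Import all_boot all_order all_algebra.
From mathcomp Require Import all_classical all_reals all_analysis.
From mathcomp Require Import measurable_realfun complex.
From mathcomp Require Import ring lra.

Set Implicit Arguments.
Unset Strict Implicit.
Unset Printing Implicit Defensive.

Import Order.TTheory GRing.Theory Num.Theory.
Import numFieldTopology.Exports numFieldNormedType.Exports.

Local Open Scope classical_set_scope.
Local Open Scope ring_scope.

(** * Real inner product spaces *)

(** That a function concentrated on the larger pair is new is the delicate point: after the first
    step, a dilate of phi may well be carried by the set already reached. The induction therefore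
    carries no particular function but the property [spanned]: no part of A of positive measure is
    annihilated by all concentrated functions. It holds at the start once S is shrunk to the set
    where phi is nonzero, it passes to A united with its dilate, and by measure alone it then
    provides some function that does not vanish off A.

    Hilbert space geometry is done with [rip], the real part of the complex inner product. A complex
    value <g, kappa_x> is recovered by testing against both kappa_x and i kappa_x, and this doubling
    is the 2 in 2 c^2 mu_2m(A) muh_2mh(B).

    The limit phi is written down explicitly, as 1_S times the pointwise limit of kernel values;
    that it lies in L2 comes from the same domination as the convergence. *)

Section inner_product.
Context {R : realType} {V : lmodType R}.
Variables (P : V -> Prop) (ip : V -> V -> R).
Hypothesis P0 : P 0.
Hypothesis PZD : forall c f g, P f -> P g -> P (c *: f + g).
Hypothesis ipC : forall f g, P f -> P g -> ip f g = ip g f.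
Hypothesis ipZD : forall c f g h, P f -> P g -> P h ->
  ip (c *: f + g) h = c * ip f h + ip g h.
Hypothesis ip_ge0 : forall f, P f -> 0 <= ip f f.

Lemma inner_predD f g : P f -> P g -> P (f + g).
Proof. by move=> Pf Pg; rewrite -[f]scale1r; exact: PZD. Qed.

Lemma inner_predZ c f : P f -> P (c *: f).
Proof. by move=> Pf; rewrite -[_ *: _]addr0; exact: PZD. Qed.

Lemma inner_predB f g : P f -> P g -> P (f - g).
Proof.
by move=> Pf Pg; rewrite addrC -scaleN1r; exact: PZD.
Qed.

Lemma inner_pred_sum n (c : nat -> R) (e : nat -> V) :
  (forall i, (i < n)%N -> P (e i)) -> P (\sum_(i < n) c i *: e i).
Proof.
move=> Pe; elim/big_ind : _ => // [|i _]; first exact: inner_predD.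
by apply: inner_predZ; exact: Pe.
Qed.

Lemma innerDl f g h : P f -> P g -> P h -> ip (f + g) h = ip f h + ip g h.
Proof. by move=> Pf Pg Ph; rewrite -[f]scale1r ipZD// mul1r scale1r. Qed.

Lemma inner0l h : P h -> ip 0 h = 0.
Proof.
by move=> Ph; have := innerDl P0 P0 Ph; rewrite addr0 => /eqP; rewrite -subr_eq subrr => /eqP.
Qed.

Lemma innerZl c f h : P f -> P h -> ip (c *: f) h = c * ip f h.
Proof. by move=> Pf Ph; rewrite -[_ *: _]addr0 ipZD// inner0l// addr0. Qed.

Lemma innerBl f g h : P f -> P g -> P h -> ip (f - g) h = ip f h - ip g h.
Proof. by move=> Pf Pg Ph; rewrite addrC -scaleN1r ipZD// mulN1r addrC. Qed.

Lemma innerDr f g h : P f -> P g -> P h -> ip h (f + g) = ip h f + ip h g.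
Proof.
by move=> Pf Pg Ph; rewrite ipC ?innerDl//; [congr (_ + _); exact: ipC|exact: inner_predD].
Qed.

Lemma innerBr f g h : P f -> P g -> P h -> ip h (f - g) = ip h f - ip h g.
Proof.
move=> Pf Pg Ph; rewrite ipC ?innerBl//; last exact: inner_predB.
by rewrite (ipC Pf)// (ipC Pg).
Qed.

Lemma innerZr c f h : P f -> P h -> ip h (c *: f) = c * ip h f.
Proof.
by move=> Pf Ph; rewrite ipC ?innerZl//; [rewrite ipC|exact: inner_predZ].
Qed.

Lemma inner_suml n (c : nat -> R) (e : nat -> V) h :
  (forall i, (i < n)%N -> P (e i)) -> P h ->
  ip (\sum_(i < n) c i *: e i) h = \sum_(i < n) c i * ip (e i) h.
Proof.
move=> + Ph; elim: n => [|n IH] Pe; first by rewrite !big_ord0 inner0l.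
have Pe' i : (i < n)%N -> P (e i) by move=> /ltnW /Pe.
rewrite !big_ord_recr/= innerDl ?IH ?innerZl//; do ?exact: Pe.
  exact: inner_pred_sum.
by apply: inner_predZ; exact: Pe.
Qed.

Lemma inner_sqrD f g : P f -> P g ->
  ip (f + g) (f + g) = ip f f + 2 * ip f g + ip g g.
Proof.
move=> Pf Pg; rewrite innerDl ?innerDr//; last exact: inner_predD.
by rewrite (ipC Pg Pf); ring.
Qed.

Lemma inner_sqrB f g : P f -> P g ->
  ip (f - g) (f - g) = ip f f - 2 * ip f g + ip g g.
Proof.
move=> Pf Pg; rewrite innerBl ?innerBr//; last exact: inner_predB.
by rewrite (ipC Pg Pf); ring.
Qed.

(** The parallelogram identity with <f - g, f - g> >= 0 dropped; it serves as the triangle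
    inequality for squared norms. *)
Lemma inner_sqrD_le f g : P f -> P g ->
  ip (f + g) (f + g) <= 2 * ip f f + 2 * ip g g.
Proof.
move=> Pf Pg; have := ip_ge0 (inner_predB Pf Pg).
by rewrite inner_sqrB// inner_sqrD//; lra.
Qed.

Lemma inner_cauchy f g : P f -> P g -> ip f g ^+ 2 <= ip f f * ip g g.
Proof.
move=> Pf Pg.
have H t : 0 <= ip f f - 2 * (t * ip f g) + t ^+ 2 * ip g g.
  have := ip_ge0 (inner_predB Pf (inner_predZ t Pg)).
  rewrite inner_sqrB ?innerZl ?innerZr//; try exact: inner_predZ.
  by rewrite mulrA -expr2.
have [g0|g0] := eqVneq (ip g g) 0.
  rewrite g0 mulr0 leNgt; apply/negP => fg.
  have f0 := ip_ge0 Pf.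
  (* The form is only semidefinite: for <g, g> = 0 this t makes t <f, g> equal to <f, f> + 1, which
     contradicts [H]. *)
  have := H ((ip f f + 1) * ip f g / ip f g ^+ 2).
  rewrite g0 mulr0 addr0 (_ : _ / _ * _ = ip f f + 1); last by field; rewrite -sqrf_eq0 gt_eqF.
  by lra.
have gg : 0 < ip g g by rewrite lt_neqAle eq_sym g0 ip_ge0.
have := H (ip f g / ip g g).
rewrite (_ : _ + _ = ip f f - ip f g ^+ 2 / ip g g); last by field.
by rewrite subr_ge0 ler_pdivrMr.
Qed.

Lemma inner_bessel n (e : nat -> V) f : P f ->
  (forall i, (i < n)%N -> P (e i)) ->
  (forall i j, (i < n)%N -> (j < n)%N -> ip (e i) (e j) = (i == j)%:R) ->
  \sum_(i < n) ip f (e i) ^+ 2 <= ip f f.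
Proof.
move=> Pf Pe oe; pose s := \sum_(i < n) ip f (e i) *: e i.
have Ps : P s by exact: (@inner_pred_sum n (fun i => ip f (e i)) e).
have sf : ip s f = \sum_(i < n) ip f (e i) ^+ 2.
  rewrite (@inner_suml n (fun i => ip f (e i)) e)//; apply: eq_bigr => i _.
  by rewrite (ipC _ Pf) ?expr2//; exact: Pe.
have ss : ip s s = ip s f.
  rewrite {1}/s (@inner_suml n (fun i => ip f (e i)) e)// sf; apply: eq_bigr => i _.
  rewrite expr2; congr (_ * _); rewrite ipC//; last exact: Pe.
  rewrite (@inner_suml n (fun i => ip f (e i)) e)//; last exact: Pe.
  rewrite (bigD1 i)//= oe// eqxx mulr1 big1 ?addr0// => j /negbTE ji.
  by rewrite oe// -(inj_eq val_inj) in ji *; rewrite ji mulr0.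
have := ip_ge0 (inner_predB Pf Ps).
by rewrite inner_sqrB// (ipC Pf Ps) ss sf; lra.
Qed.

(** * Weak compactness of bounded sequences *)

Section weak_compactness.
Variables (G : nat -> V) (M : R).
Hypothesis PG : forall n, P (G n).
Hypothesis GM : forall n, ip (G n) (G n) <= M.

Inductive inner_span : V -> Prop :=
| inner_span0 : inner_span 0
| inner_spanZD c j s : inner_span s -> inner_span (c *: G j + s).

Lemma inner_span_pred s : inner_span s -> P s.
Proof. by elim=> // c j {}s _ Ps; exact: PZD. Qed.

(** An ultrafilter finer than the tails has limits for all the bounded sequences <G n, G j> at once,
    in place of a diagonal extraction. The index [u k] is then picked in the finite intersection of
    the conditions for j <= k. It need not increase: [k <= u k] suffices to go to infinity. *)
Lemma inner_subsequence : exists u : nat -> nat,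
  (forall k, (k <= u k)%N) /\
  forall j, cvgn (fun k => ip (G (u k)) (G j)).
Proof.
have [F [FU oF]] := @ultraFilterLemma _ (\oo : set_system nat) _.
have M0 : 0 <= M by apply: le_trans (GM 0); exact: ip_ge0.
have FP := @ultra_proper _ _ FU.
have bd n j : `|ip (G n) (G j)| <= M.
  rewrite -ler_sqr ?nnegrE// real_normK ?num_real//.
  by apply: le_trans (inner_cauchy _ _) _ => //; rewrite expr2 ler_pM ?ip_ge0.
have /choice[L HL] : forall j, exists L : R, forall e, 0 < e ->
    F [set n | `|ip (G n) (G j) - L| < e].
  move=> j; have := @segment_compact R (- M) M.
  move=> /(_ ((fun n => ip (G n) (G j)) @ F) _)[|L [_ cL]].
    rewrite /fmap/=; apply: filterS filterT => n _ /=.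
    by rewrite in_itv/= -ler_norml.
  exists L => e e0.
  have [//|Fc] := @in_ultra_setVsetC _ _ [set n | `|ip (G n) (G j) - L| < e] FU.
  have h1 : ((fun n => ip (G n) (G j)) @ F) (~` ball L e).
    rewrite /fmap/=; apply: (@filterS _ F _ _ _ _ Fc) => n /=; apply: contra_not.
    by rewrite /ball/= distrC.
  by have [y []] := cL _ _ h1 (nbhsx_ballx L e e0).
have /choice[u Hu] : forall k, exists n, (k <= n)%N /\
    forall j, (j <= k)%N -> `|ip (G n) (G j) - L j| < k.+1%:R^-1.
  move=> k.
  have Fk : F [set n | (k <= n)%N] by apply: oF; exact: nbhs_infty_ge.
  have Fj l : F [set n | forall j, (j < l)%N -> `|ip (G n) (G j) - L j| < k.+1%:R^-1].
    elim: l => [|l IH]; first by apply: filterS filterT => n _ j.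
    apply: filterS2 IH (HL l k.+1%:R^-1 _) => [n /= h hl j|]; last by rewrite invr_gt0.
    by rewrite ltnS leq_eqVlt => /predU1P[->//|]; exact: h.
  by have [n [/= kn h]] := filter_ex (filterI Fk (Fj k.+1)); exists n; split.
exists u; split=> [k|j]; first by case: (Hu k).
apply: (@cvgP _ _ (L j)); apply/cvgrPdist_lt => e e0.
near=> k; rewrite distrC; apply: lt_trans (_ : k.+1%:R^-1 < e).
  by apply: (Hu k).2; near: k; exact: nbhs_infty_ge.
by near: k; exact: (near_infty_natSinv_lt (PosNum e0)).
Unshelve. all: by end_near. Qed.

(* An almost minimizer s of |k - s| over the span makes k - s almost
   orthogonal to the span, so no projection, hence no completeness, is
   needed. *)
Lemma inner_almost_projection k (e : R) : P k -> 0 < e ->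
  exists2 s, inner_span s & forall n, `|ip (G n) (k - s)| <= e.
Proof.
move=> Pk e0; pose E := [set ip (k - s) (k - s) | s in inner_span].
have E0 : E !=set0 by exists (ip (k - 0) (k - 0)), 0 => //; exact: inner_span0.
have Elb : has_lbound E.
  exists 0 => _ [s Ss <-]; apply: ip_ge0; apply: inner_predB => //.
  exact: inner_span_pred.
have M0 : 0 <= M by apply: le_trans (GM 0); exact: ip_ge0.
(* Chosen so that the optimal shift t = b / (M + 1) in [H] gives b^2 / (M + 1) <= d, that is |b| <=
   e; the summand 1 keeps the denominator positive. *)
pose d := e ^+ 2 / (M + 1).
have d0 : 0 < d by rewrite divr_gt0 ?exprn_gt0//; lra.
have [_ [s Ss <-] sd] := inf_adherent d0 (conj E0 Elb).
exists s => // n; have Ps := inner_span_pred Ss.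
have Pks := inner_predB Pk Ps.
set b := ip (G n) (k - s).
have H t : 2 * t * b <= d + t ^+ 2 * (M + 1).
  have : inf E <= ip (k - (t *: G n + s)) (k - (t *: G n + s)).
    by apply: ge_inf => //; exists (t *: G n + s) => //; exact: inner_spanZD.
  rewrite (_ : k - _ = (k - s) - t *: G n); last by rewrite opprD addrA addrAC.
  rewrite inner_sqrB ?innerZr ?innerZl//; try exact: inner_predZ.
  rewrite ipC// -/b => H.
  have : t * (t * ip (G n) (G n)) <= t ^+ 2 * (M + 1).
    by rewrite mulrA -expr2 ler_wpM2l ?sqr_ge0//; have := GM n; lra.
  by lra.
rewrite -ler_sqr ?nnegrE ?(ltW e0)// real_normK ?num_real//.
have := H (b / (M + 1)).
have M1 : 0 < M + 1 by lra.
rewrite (_ : _ * b = 2 * (b ^+ 2 / (M + 1))); last by field; rewrite gt_eqF.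
rewrite [X in d + X](_ : _ = b ^+ 2 / (M + 1)); last by field; rewrite gt_eqF.
by rewrite -(@ler_pM2r _ (M + 1)^-1) ?invr_gt0// -/d; lra.
Qed.

(** Convergence against each [G j] extends linearly to their span. For general [k], an almost
    projection s makes <G n, k> and <G n, s> differ by at most e / 4 for every n, so the sequence of
    scalars is Cauchy. *)
Lemma inner_weak_compactness : exists u : nat -> nat,
  (forall k, (k <= u k)%N) /\
  forall k, P k -> cvgn (fun i => ip (G (u i)) k).
Proof.
have [u [uk uc]] := inner_subsequence; exists u; split => // k Pk.
have cs s : inner_span s -> cvgn (fun i => ip (G (u i)) s).
  elim=> [|c j {}s Ss cs].
    rewrite (_ : (fun _ => _) = cst 0); first exact: is_cvg_cst.
    by apply/funext => i; rewrite ipC ?inner0l.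
  rewrite (_ : (fun _ => _) = (fun i => c * ip (G (u i)) (G j) + ip (G (u i)) s)).
    by apply: is_cvgD => //; apply: is_cvgMr; exact: uc.
  apply/funext => i; rewrite innerDr ?innerZr//; last exact: inner_span_pred.
  exact: inner_predZ.
apply: cauchy_cvg; apply/cauchy_exP => e e0.
have e4 : 0 < e / 4 by lra.
have [s Ss hs] := inner_almost_projection Pk e4.
have /cvgrPdist_lt/(_ _ e4) cx := cs s Ss.
exists (limn (fun i => ip (G (u i)) s)); rewrite /fmap/=; near=> i.
have h1 : `|limn (fun i => ip (G (u i)) s) - ip (G (u i)) s| < e / 4.
  by near: i; exact: cx.
rewrite /ball/=; set x := limn _ in h1 *.
have Ps := inner_span_pred Ss.
have := hs (u i); rewrite innerBr// => h2.
rewrite (_ : x - _ = (x - ip (G (u i)) s) - (ip (G (u i)) k - ip (G (u i)) s)); last by ring.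
by apply: le_lt_trans (ler_normB _ _) _; lra.
Unshelve. all: by end_near. Qed.

End weak_compactness.
End inner_product.

(** * Square-integrable complex functions *)

Section complex_dot.
Context {R : realType}.
Implicit Types z w : R[i].

(** The real part of z times the conjugate of w, that is, the inner product of the real plane. *)
Definition cdot z w : R := complex.Re z * complex.Re w + complex.Im z * complex.Im w.

Lemma cReD z w : complex.Re (z + w) = complex.Re z + complex.Re w.
Proof. by case: z w => [? ?] []. Qed.

Lemma cImD z w : complex.Im (z + w) = complex.Im z + complex.Im w.
Proof. by case: z w => [? ?] []. Qed.

Lemma cReN z : complex.Re (- z) = - complex.Re z.
Proof. by case: z. Qed.

Lemma cImN z : complex.Im (- z) = - complex.Im z.
Proof. by case: z. Qed.

Lemma cReM z w : complex.Re (z * w) =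
  complex.Re z * complex.Re w - complex.Im z * complex.Im w.
Proof. by case: z w => [? ?] []. Qed.

Lemma cImM z w : complex.Im (z * w) =
  complex.Re z * complex.Im w + complex.Im z * complex.Re w.
Proof. by case: z w => [? ?] []. Qed.

Lemma cReZ (c : R) (z : Rcomplex R) : complex.Re (c *: z) = c * complex.Re z.
Proof. by case: z. Qed.

Lemma cImZ (c : R) (z : Rcomplex R) : complex.Im (c *: z) = c * complex.Im z.
Proof. by case: z. Qed.

Lemma cReJ z : complex.Re (conjc z) = complex.Re z.
Proof. by case: z. Qed.

Lemma cImJ z : complex.Im (conjc z) = - complex.Im z.
Proof. by case: z. Qed.

Definition ReImE := (cReD, cImD, cReN, cImN, cReM, cImM, cReJ, cImJ).

Lemma complex_ext z w : complex.Re z = complex.Re w ->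
  complex.Im z = complex.Im w -> z = w.
Proof. by case: z w => [? ?] [] /= ? ? -> ->. Qed.

Lemma sqr_normcE z : Normc.normc z ^+ 2 = cdot z z.
Proof.
case: z => a b; rewrite /cdot /= sqr_sqrtr ?expr2 -?expr2 ?addr_ge0 ?sqr_ge0//.
Qed.

Lemma normc_ge0 z : 0 <= Normc.normc z.
Proof. by case: z => a b; exact: sqrtr_ge0. Qed.

Lemma cdot_ge0 z : 0 <= cdot z z.
Proof. by rewrite -sqr_normcE sqr_ge0. Qed.

Lemma cdot_eq0 z : cdot z z = 0 -> z = 0.
Proof.
rewrite -sqr_normcE => /eqP; rewrite sqrf_eq0 => /eqP; exact: Normc.eq0_normc.
Qed.

Lemma cdotC z w : cdot z w = cdot w z.
Proof. by rewrite /cdot; ring. Qed.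

Lemma cdot_le z w : `|cdot z w| <= cdot z z + cdot w w.
Proof.
rewrite /cdot; set a := complex.Re z; set b := complex.Im z.
set c := complex.Re w; set e := complex.Im w.
have := sqr_ge0 (a - c); have := sqr_ge0 (a + c).
have := sqr_ge0 (b - e); have := sqr_ge0 (b + e).
have := sqr_ge0 a; have := sqr_ge0 b; have := sqr_ge0 c; have := sqr_ge0 e.
by rewrite ler_norml; move=> ? ? ? ? ? ? ? ?; apply/andP; split; nra.
Qed.

Lemma normc_ReIm z : Normc.normc z <= `|complex.Re z| + `|complex.Im z|.
Proof.
rewrite -ler_sqr ?nnegrE ?normc_ge0 ?addr_ge0// sqr_normcE /cdot sqrrD.
rewrite !real_normK ?num_real// !expr2.
have : 0 <= `|complex.Re z| * `|complex.Im z| by rewrite mulr_ge0.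
by lra.
Qed.

Lemma normc_Re z : `|complex.Re z| <= Normc.normc z.
Proof.
rewrite -ler_sqr ?nnegrE ?normc_ge0// sqr_normcE /cdot real_normK ?num_real//.
by rewrite -!expr2 lerDl sqr_ge0.
Qed.

Lemma normc_Im z : `|complex.Im z| <= Normc.normc z.
Proof.
rewrite -ler_sqr ?nnegrE ?normc_ge0// sqr_normcE /cdot real_normK ?num_real//.
by rewrite -!expr2 lerDr sqr_ge0.
Qed.

End complex_dot.

Section L2.
Context {R : realType} {dT} {T : measurableType dT}.
Variable mu : {measure set T -> \bar R}.
Local Notation F := (T -> Rcomplex R).
Implicit Types f g h : F.

(** The real part of [innerL2]. Being real and symmetric it fits the abstract section above, where
    functions are typed in [Rcomplex R] to carry the action of real scalars. *)
Definition rip (f g : T -> R[i]) : R := Rintegral mu setT (fun x => cdot (f x) (g x)).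

Lemma measurable_cdot (f g : T -> R[i]) : cmeasurable f -> cmeasurable g ->
  measurable_fun setT (fun x => cdot (f x) (g x)).
Proof.
by move=> [f1 f2] [g1 g2]; apply: measurable_funD; exact: measurable_funM.
Qed.

Lemma sqnormL2E A (f : T -> R[i]) :
  sqnormL2 mu A f = (\int[mu]_(x in A) (cdot (f x) (f x))%:E)%E.
Proof. by apply: eq_integral => x _; rewrite sqr_normcE. Qed.

Lemma inL2_integrable (f g : T -> R[i]) : inL2 mu f -> inL2 mu g ->
  mu.-integrable setT (fun x => (cdot (f x) (g x))%:E).
Proof.
have I h : inL2 mu h -> mu.-integrable setT (fun x => (cdot (h x) (h x))%:E).
  move=> [mh]; rewrite sqnormL2E => hoo; apply/integrableP; split.
    by apply/measurable_EFinP; exact: measurable_cdot.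
  by under eq_integral do rewrite gee0_abs ?lee_fin ?cdot_ge0//.
move=> Hf Hg.
apply: (le_integrable measurableT _ _ (integrableD measurableT (I _ Hf) (I _ Hg))) => //=.
  by apply/measurable_EFinP; apply: measurable_cdot; [case: Hf|case: Hg].
move=> x _; rewrite lee_fin [leRHS]ger0_norm; first exact: cdot_le.
by rewrite addr_ge0 ?cdot_ge0.
Qed.

Lemma cmeasurable_ZD c f g : cmeasurable f -> cmeasurable g ->
  cmeasurable (c *: f + g).
Proof.
move=> [f1 f2] [g1 g2]; split.
  rewrite (_ : (fun _ => _) = (fun x => c * complex.Re (f x) + complex.Re (g x))).
    by apply: measurable_funD; [exact: measurable_funM|].
  by apply/funext => x; rewrite -cReZ -cReD.
rewrite (_ : (fun _ => _) = (fun x => c * complex.Im (f x) + complex.Im (g x))).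
  by apply: measurable_funD; [exact: measurable_funM|].
by apply/funext => x; rewrite -cImZ -cImD.
Qed.

Lemma cdotZD c z1 z2 w :
  cdot ((c *: (z1 : Rcomplex R) + z2) : Rcomplex R) w = c * cdot z1 w + cdot z2 w :> R.
Proof. by rewrite /cdot cReD cImD; case: z1 => a b /=; ring. Qed.

Lemma inL2_0 : inL2 mu (0 : F).
Proof.
split; first by split; exact: measurable_cst.
rewrite sqnormL2E; under eq_integral do rewrite /cdot /= mulr0 addr0.
by rewrite integral0.
Qed.

Lemma inL2_ZD c f g : inL2 mu f -> inL2 mu g -> inL2 mu (c *: f + g).
Proof.
move=> Hf Hg; have Hm := cmeasurable_ZD c Hf.1 Hg.1; split => //.
rewrite sqnormL2E.
have I : mu.-integrable setT
    (fun x => ((2 * c ^+ 2)%:E * (cdot (f x) (f x))%:E + 2%:E * (cdot (g x) (g x))%:E)%E).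
  by apply: integrableD => //; apply: integrableZl => //; exact: inL2_integrable.
have /integrableP[_] : mu.-integrable setT
    (fun x => (cdot ((c *: f + g) x) ((c *: f + g) x))%:E).
  apply: (le_integrable measurableT _ _ I) => //.
    by apply/measurable_EFinP; exact: (measurable_cdot Hm Hm).
  move=> x _; rewrite -!EFinM -EFinD lee_fin !ger0_norm ?cdot_ge0//; last first.
    by rewrite addr_ge0// mulr_ge0 ?cdot_ge0// mulr_ge0 ?sqr_ge0.
  have E w : cdot ((c *: f + g) x) w = c * cdot (f x) w + cdot (g x) w by exact: cdotZD.
  rewrite E !(cdotC _ ((c *: f + g) x)) !E /cdot.
  have := sqr_ge0 (c * complex.Re (f x) - complex.Re (g x)).
  by have := sqr_ge0 (c * complex.Im (f x) - complex.Im (g x)); nra.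
by under eq_integral do rewrite gee0_abs ?lee_fin ?cdot_ge0//.
Qed.

Lemma ripC f g : inL2 mu f -> inL2 mu g -> rip f g = rip g f.
Proof. by move=> _ _; apply: eq_Rintegral => x _; exact: cdotC. Qed.

Lemma ripZD c f g h : inL2 mu f -> inL2 mu g -> inL2 mu h ->
  rip (c *: f + g) h = c * rip f h + rip g h.
Proof.
move=> Hf Hg Hh; rewrite /rip -RintegralZl//; last exact: inL2_integrable.
rewrite -RintegralD//; first last.
- exact: inL2_integrable.
- have := integrableZl measurableT c (inL2_integrable Hf Hh).
  by apply: eq_integrable => // x _; rewrite EFinM.
by apply: eq_Rintegral => x _; rewrite cdotZD.
Qed.

Lemma rip_ge0 f : inL2 mu f -> 0 <= rip f f.
Proof. by move=> _; apply: Rintegral_ge0 => x _; exact: cdot_ge0. Qed.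

Lemma inL2_sqnorm (f : T -> R[i]) : inL2 mu f -> sqnormL2 mu setT f = (rip f f)%:E.
Proof.
move=> Hf; rewrite sqnormL2E /rip /Rintegral fineK//.
exact: (integrable_fin_num measurableT (inL2_integrable Hf Hf)).
Qed.

Lemma rip_eq0 (f : T -> R[i]) : inL2 mu f -> rip f f = 0 -> ae_equal mu f (fun=> 0).
Proof.
move=> Hf f0.
have f1 : (\int[mu]_x `|(cdot (f x) (f x))%:E| = 0)%E.
  have <- : sqnormL2 mu setT f = 0%E by rewrite inL2_sqnorm// f0.
  by rewrite sqnormL2E; apply: eq_integral => x _; rewrite gee0_abs ?lee_fin ?cdot_ge0.
have mf : measurable_fun setT (fun x => (cdot (f x) (f x))%:E).
  by apply/measurable_EFinP; apply: measurable_cdot; case: Hf.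
have := (ae_eq_integral_abs mu measurableT mf).1 f1.
by apply: filterS => x /(_ I)[] /cdot_eq0.
Qed.

Lemma eq_rip (f f' g g' : T -> R[i]) : inL2 mu f -> inL2 mu f' -> inL2 mu g ->
  inL2 mu g' -> ae_equal mu f f' -> ae_equal mu g g' -> rip f g = rip f' g'.
Proof.
move=> Hf Hf' Hg Hg' ff' gg'; rewrite /rip /Rintegral; congr fine.
apply: ae_eq_integral => //.
- by apply/measurable_EFinP; apply: measurable_cdot; [case: Hf|case: Hg].
- by apply/measurable_EFinP; apply: measurable_cdot; [case: Hf'|case: Hg'].
by apply: filterS2 ff' gg' => x -> ->.
Qed.

End L2.

(** * Dilations of a cone *)

Section lebesgue_scale.
Context {R : realType}.
Local Open Scope ereal_scope.
Variable t : {posnum R}.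
Local Notation leb := (@lebesgue_measure R).

Let mt : measurable_fun setT
  (fun r : measurableTypeR R => (t%:num * r)%R : measurableTypeR R).
Proof. exact: measurable_funM. Qed.

Let push : {measure set (measurableTypeR R) -> \bar R} :=
  measure_function_pushforward__canonical__measure_function_Measure leb mt.

Let scaled : {measure set (measurableTypeR R) -> \bar R} :=
  mscale (t%:num%:nng)%R push.

(** The right-hand side is a measure that agrees with Lebesgue measure on half-open intervals, so
    uniqueness applies. *)
Lemma lebesgue_measure_scale (A : set (measurableTypeR R)) : measurable A ->
  leb A = t%:num%:E * leb ((fun r => t%:num * r)%R @^-1` A).
Proof.
move=> mA; rewrite (@lebesgue_measure_unique _ scaled)//.
move=> X [[a b] _ <-].
rewrite [RHS](_ : _ = t%:num%:E * leb ((fun r => t%:num * r)%R @^-1` `]a, b]%classic))//.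
rewrite (_ : _ @^-1` _ = `](t%:num^-1 * a)%R, (t%:num^-1 * b)%R]%classic); last first.
  apply/seteqP; split => r /=; rewrite !in_itv/= => /andP[h1 h2]; apply/andP.
    by rewrite ltr_pdivrMl// ler_pdivlMl.
  by move: h1 h2; rewrite ltr_pdivrMl// ler_pdivlMl.
rewrite !lebesgue_measure_itv/= !lte_fin ltr_pM2l ?invr_gt0//.
case: ifPn => _; last by rewrite mule0.
by rewrite -!EFinB -EFinM -mulrBr mulrA divff ?mul1r.
Qed.

Lemma integral_lebesgue_scale (h : R -> \bar R) : measurable_fun setT h ->
  (forall r, 0 <= h r) ->
  \int[leb]_r h r = t%:num%:E * \int[leb]_r h (t%:num * r)%R.
Proof.
move=> mh h0.
rewrite (@eq_measure_integral _ _ _ _ scaled); last first.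
  by move=> A mA _; exact: lebesgue_measure_scale.
rewrite ge0_integral_mscale//; congr (_ * _).
by rewrite (ge0_integral_pushforward mt).
Qed.

End lebesgue_scale.

(** * Borel sets and norms under dilation *)

Section cone_measurable.
Context {R : realType} {d : nat} (Om : convexCone R d).
Local Notation cv := (@cone_val R d Om).

(** Traces of Borel sets form a sigma-algebra that contains the relatively open sets. This lets
    [polar_decomposition], stated for Borel sets of the whole space, reach every measurable set of
    the cone. *)
Lemma measurable_cone_preimage (B : set Om) : measurable B ->
  exists2 A, measurable A & B = cv @^-1` A.
Proof.
pose X := [set B : set Om | exists2 A, measurable A & B = cv @^-1` A].
have sX : sigma_algebra setT X.
  split.
  - by exists set0 => //; rewrite preimage_set0.
  - move=> _ [A mA ->]; exists (~` A); first exact: measurableC.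
    by rewrite setTD preimage_setC.
  - move=> F XF.
    have /choice[A FA] : forall n, exists A, measurable A /\ F n = cv @^-1` A.
      by move=> n; have [A] := XF n; exists A.
    exists (\bigcup_n A n).
      by apply: bigcup_measurable => n _; case: (FA n).
    by rewrite preimage_bigcup; apply: eq_bigcupr => n _; case: (FA n).
have oX : @open Om `<=` X.
  by move=> U [V oV <-]; exists V => //; exact: open_measurable_rV.
move=> mB; exact: (smallest_sub sX oX mB).
Qed.

Lemma measurable_scale_rV : measurable_fun setT
  (fun p : 'rV[R]_d * R => p.2 *: p.1).
Proof.
apply: measurable_fun_rV => i.
rewrite (_ : (fun _ => _) = (fun p : 'rV[R]_d * R => p.2 * p.1 ord0 i)); last first.
  by apply/funext => p; rewrite mxE.
apply: measurable_funM => //.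
apply: (@measurableT_comp _ _ _ _ _ _ (fun x : 'rV[R]_d => x ord0 i)) => //.
exact: measurable_coord.
Qed.

Lemma measurable_scalel_rV (t : R) :
  measurable_fun setT (fun x : 'rV[R]_d => t *: x).
Proof.
apply: measurable_fun_rV => i; under eq_fun do rewrite mxE.
by apply: measurable_funM => //; exact: measurable_coord.
Qed.

Lemma measurable_dilate t : measurable_fun setT (@dilate R d Om t).
Proof.
move=> _ B /measurable_cone_preimage[A mA ->]; rewrite setTI.
have mA' : measurable ((fun x => t%:num *: x) @^-1` A).
  by rewrite -[X in measurable X]setTI; exact: measurable_scalel_rV.
by have := @measurable_cone_val _ _ Om measurableT _ mA'; rewrite setTI.
Qed.

Lemma enormZ (t : R) (x : 'rV[R]_d) : 0 <= t -> enorm (t *: x) = t * enorm x.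
Proof.
move=> t0; rewrite /enorm.
under eq_bigr do rewrite mxE exprMn.
by rewrite -mulr_sumr sqrtrM ?sqr_ge0// sqrtr_sqr ger0_norm.
Qed.

Lemma enorm0 : enorm (0 : 'rV[R]_d) = 0.
Proof. by rewrite /enorm big1 ?sqrtr0// => i _; rewrite mxE expr0n. Qed.

Lemma enorm_eq0 (x : 'rV[R]_d) : enorm x = 0 -> x = 0.
Proof.
move=> /eqP; rewrite sqrtr_eq0 => x0.
have s0 : \sum_i x ord0 i ^+ 2 = 0.
  by apply/eqP; rewrite eq_le x0 sumr_ge0// => j _; exact: sqr_ge0.
apply/rowP => i; rewrite mxE; apply/eqP; rewrite -sqrf_eq0; apply/eqP.
by apply: (psumr_eq0P _ s0) => // j _; exact: sqr_ge0.
Qed.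

Lemma enorm_dilate t (x : Om) : enorm (cv (dilate t x)) = t%:num * enorm (cv x).
Proof. by rewrite [cv _]/(t%:num *: cv x) enormZ. Qed.

Lemma dilateK t : cancel (@dilate R d Om t) (dilate (t%:num^-1)%:pos).
Proof.
move=> x; apply/val_inj => /=.
by rewrite [cone_val _]/(t%:num *: cv x) scalerA mulVf ?scale1r.
Qed.

Lemma dilateVK t : cancel (@dilate R d Om (t%:num^-1)%:pos) (dilate t).
Proof.
move=> x; apply/val_inj => /=.
by rewrite [cone_val _]/(_ *: cv x) scalerA mulfV ?scale1r.
Qed.

Lemma measurable_enorm_cone : measurable_fun setT (fun x : Om => enorm (cv x)).
Proof. by apply: measurableT_comp; [exact: measurable_enorm|exact: measurable_cone_val]. Qed.

End cone_measurable.

Section cone_balls.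
Context {R : realType} {d : nat} {Om : convexCone R d}.
Local Notation cv := (@cone_val R d Om).

Definition cone_ball (r : R) : set Om := [set x | (enorm (cv x) < r)%R].

Lemma measurable_cone_ball r : measurable (cone_ball r).
Proof.
rewrite (_ : cone_ball r = (fun x : Om => enorm (cv x)) @^-1` `]-oo, r[%classic).
  by rewrite -[X in measurable X]setTI; exact: measurable_enorm_cone.
by apply/seteqP; split => x /=; rewrite in_itv.
Qed.

(** A dyadic shell: its dilates by the powers of 2 tile the cone away from the origin. *)
Definition cone_shell : set Om := [set x | (1 <= enorm (cv x) < 2)%R].

Lemma measurable_cone_shell : measurable cone_shell.
Proof.
rewrite (_ : cone_shell = (fun x : Om => enorm (cv x)) @^-1` `[1%R, 2%R[%classic).
  by rewrite -[X in measurable X]setTI; exact: measurable_enorm_cone.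
by apply/seteqP; split => x /=; rewrite in_itv.
Qed.

End cone_balls.

(** * Homogeneity of measures with a polar decomposition *)

Section polar.
Context {R : realType} {d : nat} {Om : convexCone R d}.
Variables (mu : {measure set Om -> \bar R}) (a : R) (Q : 'rV[R]_d -> R).
Hypothesis Q_density : polar_density Q.
Hypothesis mu_polar : polar_decomposition mu a Q.
Hypothesis a_gt0 : 0 < a.
Local Notation cv := (@cone_val R d Om).
Local Notation leb := (@lebesgue_measure R).
Local Open Scope ereal_scope.

(** The radial integrand, extended by zero to all real r and seen as a function of the pair (zeta,
    r): measurability in zeta of its integral over r is then Tonelli's theorem. *)
Let radial (A : set 'rV[R]_d) (p : 'rV[R]_d * R) : R :=
  (\1_A (p.2 *: p.1) * p.2 `^ (2 * a - 1) * \1_(`]0%R, +oo[%classic : set R) p.2)%R.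

Let radial_ge0 A p : (0 <= radial A p)%R.
Proof. by rewrite /radial !mulr_ge0 ?powR_ge0. Qed.

Let radialE A z :
  \int[leb]_(r in `]0%R, +oo[) (\1_A (r *: z) * r `^ (2 * a - 1))%:E =
  \int[leb]_r (radial A (z, r))%:E.
Proof.
rewrite integral_mkcond; apply: eq_integral => r _.
rewrite patchE /radial /= !indicE.
by case: ifPn => _; rewrite ?mulr1 ?mulr0.
Qed.

Let measurable_radial A : measurable A -> measurable_fun setT (radial A).
Proof.
move=> mA; apply: measurable_funM; first apply: measurable_funM.
- apply: (@measurableT_comp _ _ _ _ _ _ (\1_A : _ -> R)); first exact: measurable_indic.
  exact: measurable_scale_rV.
- apply: (@measurableT_comp _ _ _ _ _ _ (fun r : R => r `^ (2 * a - 1))%R).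
    exact: measurable_powR.
  exact: measurable_snd.
- apply: (@measurableT_comp _ _ _ _ _ _ (\1_(`]0%R, +oo[%classic : set R) : R -> R)).
    exact: measurable_indic.
  exact: measurable_snd.
Qed.

Let inner_measurable A : measurable A ->
  measurable_fun setT (fun z => \int[leb]_r (radial A (z, r))%:E).
Proof.
move=> mA.
apply: (measurable_fun_fubini_tonelli_F (m2 := leb) (fun p => (radial A p)%:E)).
  by apply/measurable_EFinP; exact: measurable_radial.
by move=> p; rewrite lee_fin.
Qed.

(** Substitution of t r for r: dr contributes a factor t and the density a factor t^(2a - 1). *)
Let radial_scale (t : {posnum R}) A z : measurable A ->
  \int[leb]_r (radial A (z, r))%:E =
  (t%:num `^ (2 * a))%:E * \int[leb]_r (radial ((fun x => t%:num *: x)%R @^-1` A) (z, r))%:E.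
Proof.
move=> mA.
have mr B : measurable B -> measurable_fun setT (fun r => (radial B (z, r))%:E).
  move=> mB; apply/measurable_EFinP.
  by apply: (measurableT_comp (measurable_radial mB)); exact: measurable_pair1.
rewrite (integral_lebesgue_scale t)//; [|exact: mr|by move=> r; rewrite lee_fin].
have mA' : measurable ((fun x => t%:num *: x)%R @^-1` A).
  by rewrite -[X in measurable X]setTI; exact: measurable_scalel_rV.
have m1 := mr _ mA'.
have m2 : measurable_fun setT (fun r => (radial A (z, t%:num * r)%R)%:E).
  by apply: (measurableT_comp (mr _ mA)); exact: measurable_funM.
have p1 B (r : R) : setT r -> 0 <= (radial B (z, r))%:E by rewrite lee_fin.
have p2 (r : R) : setT r -> 0 <= (radial A (z, t%:num * r)%R)%:E by rewrite lee_fin.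
have p3 : 0 <= (t%:num `^ (2 * a))%:E by rewrite lee_fin powR_ge0.
have p4 : 0 <= (t%:num)%:E by [].
have -> : (t%:num `^ (2 * a))%:E * \int[leb]_r (radial ((fun x => t%:num *: x)%R @^-1` A) (z, r))%:E
    = \int[leb]_r ((t%:num `^ (2 * a))%:E * (radial ((fun x => t%:num *: x)%R @^-1` A) (z, r))%:E).
  by apply/esym; apply: ge0_integralZl => // r; exact: p1.
have -> : t%:num%:E * \int[leb]_r (radial A (z, t%:num * r)%R)%:E
    = \int[leb]_r (t%:num%:E * (radial A (z, t%:num * r)%R)%:E).
  by apply/esym; apply: ge0_integralZl => //; exact: p2.
apply: eq_integral => r _; rewrite -!EFinM; congr EFin.
rewrite /radial/= !indicE/=.
have -> : (r *: z \in (fun x => t%:num *: x)%R @^-1` A)%R = ((t%:num * r) *: z \in A)%R.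
  by apply/idP/idP; rewrite !inE/= scalerA.
have -> : (r \in (`]0%R, +oo[%classic : set R)) = (0 < r)%R.
  by rewrite mem_setE in_itv/= andbT.
have -> : ((t%:num * r)%R \in (`]0%R, +oo[%classic : set R)) = (0 < r)%R.
  by rewrite mem_setE in_itv/= andbT pmulr_rgt0.
have [r0|_] := ltP; last by rewrite !mulr0.
rewrite !mulr1 powRM ?ltW//.
have -> : (t%:num `^ (2 * a) = t%:num * t%:num `^ (2 * a - 1))%R.
  rewrite -{2}[t%:num]powRr1 ?ltW// -powRD; last by apply/implyP => _; rewrite gt_eqF.
  by congr (_ `^ _)%R; ring.
by ring.
Qed.

Let measurable_sphere : measurable (@unit_sphere R d).
Proof.
rewrite (_ : unit_sphere = enorm @^-1` [set 1%R])//.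
by rewrite -[X in measurable X]setTI; apply: measurable_enorm.
Qed.

Let Q_ge0 z : unit_sphere z -> (0 <= Q z)%R. Proof. by case: Q_density => h _ _; exact: h. Qed.

Let Q_int : surface_measure.-integrable unit_sphere (EFin \o Q).
Proof. by case: Q_density. Qed.

Let Q_meas : measurable_fun unit_sphere (EFin \o Q).
Proof. by case/integrableP: Q_int. Qed.

Lemma polar_dilate (t : {posnum R}) (B : set Om) : measurable B ->
  mu B = (t%:num `^ (2 * a))%:E * mu (dilate t @^-1` B).
Proof.
move=> /measurable_cone_preimage[A mA ->].
rewrite (_ : dilate t @^-1` _ = cv @^-1` ((fun x => t%:num *: x)%R @^-1` A))//.
have mA' : measurable ((fun x => t%:num *: x)%R @^-1` A).
  by rewrite -[X in measurable X]setTI; exact: measurable_scalel_rV.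
rewrite !mu_polar//.
transitivity (\int[surface_measure]_(z in unit_sphere) ((t%:num `^ (2 * a))%:E *
    ((Q z)%:E * \int[leb]_(r in `]0%R, +oo[)
      (\1_((fun x => t%:num *: x)%R @^-1` A) (r *: z) * r `^ (2 * a - 1))%:E))).
  by apply: eq_integral => z _; rewrite !radialE (radial_scale t)// muleCA.
apply: ge0_integralZl => //.
- apply: emeasurable_funM => //; under eq_fun do rewrite radialE.
  by apply: measurable_funTS; exact: inner_measurable.
- move=> z Sz; rewrite mule_ge0 ?lee_fin ?Q_ge0//; apply: integral_ge0 => r _.
  by rewrite lee_fin mulr_ge0 ?powR_ge0.
Qed.

Lemma polar_preimageE (t : {posnum R}) (B : set Om) : measurable B ->
  mu (dilate t @^-1` B) = (t%:num `^ (- (2 * a)))%:E * mu B.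
Proof.
move=> mB; rewrite (polar_dilate t mB) muleA -EFinM powRN mulVf ?mul1e//.
Qed.

Lemma cone_shell_finite : mu cone_shell < +oo.
Proof.
pose A : set 'rV[R]_d := enorm @^-1` `[1%R, 2%R[%classic.
have mA : measurable A.
  by rewrite -[X in measurable X]setTI; exact: measurable_enorm.
rewrite (_ : cone_shell = cv @^-1` A); last first.
  by apply/seteqP; split => x; rewrite /A/= in_itv.
rewrite mu_polar//.
(* For 1 <= r < 2 one has r^(2a - 1) <= r^(2a) <= 2^(2a), whatever the sign of 2a - 1, and the
   radial interval has length 1. *)
apply: (@le_lt_trans _ _ (\int[surface_measure]_(z in unit_sphere)
    ((2 `^ (2 * a))%:E * (Q z)%:E))).
  apply: ge0_le_integral => //.
  - move=> z Sz; rewrite mule_ge0 ?lee_fin ?Q_ge0//; apply: integral_ge0 => r _.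
    by rewrite lee_fin mulr_ge0 ?powR_ge0.
  - apply: emeasurable_funM => //; under eq_fun do rewrite radialE.
    by apply: measurable_funTS; exact: inner_measurable.
  - exact: emeasurable_funM.
  - move=> z Sz; rewrite muleC; apply: lee_pmul => //.
    + by apply: integral_ge0 => r _; rewrite lee_fin mulr_ge0 ?powR_ge0.
    + by rewrite lee_fin Q_ge0.
    rewrite radialE.
    apply: (@le_trans _ _ (\int[leb]_r ((2 `^ (2 * a)) * \1_(`[1%R, 2%R]%classic : set R) r)%:E)).
      apply: ge0_le_integral => //.
      - by move=> r _; rewrite lee_fin.
      - apply/measurable_EFinP.
        by apply: (measurableT_comp (measurable_radial mA)); exact: measurable_pair1.
      - by apply/measurable_EFinP; apply: measurable_funM => //; exact: measurable_indic.
      move=> r _; rewrite lee_fin /radial/= !indicE.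
      have [r0|r0] := ltP 0%R r; last first.
        rewrite [X in (_ * _ * X)%R](_ : _ = 0%R) ?mulr0 ?mulr_ge0 ?powR_ge0//.
        by rewrite mem_setE in_itv/= andbT ltNge r0.
      have -> : (r *: z \in A)%R = (1 <= r < 2)%R.
        by apply/idP/idP; rewrite inE /A/= in_itv/= (enormZ _ (ltW r0)) [enorm z]Sz mulr1.
      have [/andP[r1 r2]|] := boolP (_ <= r < _)%R; last by rewrite !mul0r mulr_ge0 ?powR_ge0.
      have -> : (r \in (`[1%R, 2%R]%classic : set R)) = true.
        by rewrite mem_setE in_itv/= r1 ltW.
      rewrite mul1r mulr1.
      apply: (@le_trans _ _ (r `^ (2 * a - 1))%R).
        by rewrite ler_piMr ?powR_ge0//; case: (_ \in _).
      apply: (@le_trans _ _ (r `^ (2 * a))%R).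
        by apply: ler_powR => //; rewrite gerBl.
      by apply: ge0_ler_powR; rewrite ?nnegrE ?ltW// mulr_gt0.
    under eq_integral do rewrite EFinM.
    rewrite ge0_integralZl//; last by apply/measurable_EFinP; exact: measurable_indic.
    rewrite integral_indic// setIT.
    have e : leb `[1%R, 2%R]%classic = 1.
      rewrite lebesgue_measure_itv/= lte_fin ltr1n -EFinB.
      by congr EFin; ring.
    by rewrite -[leRHS]mule1 -e.
rewrite ge0_integralZl//.
rewrite lte_mul_pinfty ?lee_fin ?powR_ge0//.
case/integrableP: Q_int => _; apply: le_lt_trans; apply: ge0_le_integral => //.
- by apply: measurableT_comp.
by move=> z _; exact: lee_abs.
Qed.

End polar.

Lemma powR_exprn {R : realType} (x s : R) n : 0 <= x ->
  (x ^+ n) `^ s = (x `^ s) ^+ n.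
Proof.
move=> x0; elim: n => [|n IH]; first by rewrite !expr0 powR1.
by rewrite !exprS powRM ?exprn_ge0// IH.
Qed.

(** * Finite measure of balls and integrable weights *)

Section polar_finite.
Context {R : realType} {d : nat} {Om : convexCone R d}.
Variables (mu : {measure set Om -> \bar R}) (a : R) (Q : 'rV[R]_d -> R).
Hypothesis Q_density : polar_density Q.
Hypothesis mu_polar : polar_decomposition mu a Q.
Hypothesis a_gt0 : 0 < a.
Local Notation cv := (@cone_val R d Om).
Local Open Scope ereal_scope.

Let pow2 n : {posnum R} := (2 ^+ n)%:pos%R.

Let pow2E n : ((pow2 n)%:num `^ (- (2 * a)) = (2 `^ (- (2 * a))) ^+ n)%R.
Proof. exact: powR_exprn. Qed.

Let q01 : (0 < (2 : R) `^ (- (2 * a)) < 1)%R.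
Proof.
rewrite powR_gt0//= powRN invf_lt1 ?powR_gt0//.
have : (1 `^ (2 * a) < (2 : R) `^ (2 * a))%R.
  by apply: gt0_ltr_powR; rewrite ?mulr_gt0 ?nnegrE ?ltr1n.
by rewrite powR1.
Qed.

Lemma geometric_nneseries_lty (c x : R) : (0 <= c)%R -> (0 < x < 1)%R ->
  \sum_(0 <= n <oo) (c * x ^+ n)%:E < +oo.
Proof.
move=> c0 /andP[x0 x1]; apply: (@le_lt_trans _ _ (c / (1 - x))%:E); last exact: ltry.
apply: lime_le.
  by apply: is_cvg_nneseries => n _ _; rewrite lee_fin mulr_ge0// exprn_ge0// ltW.
apply: nearW => n; rewrite sumEFin lee_fin.
by apply: (@geometric_le_lim _ n c x); rewrite ?gtr0_norm.
Qed.

Let measurable_origin : measurable [set (0 : 'rV[R]_d)%R].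
Proof.
rewrite (_ : [set _] = enorm @^-1` [set 0%R]).
  by rewrite -[X in measurable X]setTI; apply: measurable_enorm.
by apply/seteqP; split => x /=; [move=> ->; exact: enorm0|exact: enorm_eq0].
Qed.

Let origin_null : mu (cv @^-1` [set 0%R]) = 0.
Proof.
rewrite mu_polar// integral0_eq// => z Sz.
rewrite integral0_eq ?mule0// => r; rewrite /= in_itv/= andbT => r0.
rewrite indicE (_ : (r *: z \in _)%R = false) ?mul0r//.
apply/negP; rewrite inE /= => rz.
have := congr1 enorm rz; rewrite (enormZ _ (ltW r0)) [enorm z]Sz mulr1 enorm0.
by move=> r00; rewrite r00 ltxx in r0.
Qed.

(** The unit ball consists of the origin, a null set, and of the shell shrunk by the factors
    2^(n+1). By homogeneity the measures of these form a geometric series of ratio 2^(-2a), which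
    converges because a > 0. *)
Lemma cone_ball1_finite : mu (cone_ball 1) < +oo.
Proof.
have cover : cone_ball 1 `<=` cv @^-1` [set 0%R] `|`
    \bigcup_n (dilate (pow2 n.+1) @^-1` cone_shell).
  move=> x /= x1; have [x0|x0] := eqVneq (enorm (cv x)) 0%R.
    by left; exact: enorm_eq0.
  right.
  have xp : (0 < enorm (cv x))%R by rewrite lt_neqAle eq_sym x0 enorm_ge0.
  have ex : exists n : nat, (1 <= 2 ^+ n * enorm (cv x))%R.
    have [n _ /(_ n (leqnn n)) h] := near_infty_natSinv_lt (PosNum xp).
    exists n.+1; rewrite /= in h.
    rewrite -ler_pdivrMr// mul1r; apply: (@le_trans _ _ n.+1%:R).
      by rewrite -[leRHS]invrK lef_pV2 ?posrE ?invr_gt0// ltW.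
    by rewrite -natrX ler_nat ltnW// ltn_expl.
  (* The least n with 2^n |x| >= 1 is positive because |x| < 1, and its minimality gives 2^n |x| <
     2. *)
  pose n := ex_minn ex; have : (0 < n)%N.
    rewrite lt0n /n; case: ex_minnP => k hk _; apply: contraTneq hk => ->.
    by rewrite expr0 mul1r -ltNge.
  rewrite /n; case: ex_minnP => -[//|k] hk mk _.
  exists k => //; rewrite /cone_shell /preimage/= enorm_dilate hk/=.
  have : (2 ^+ k * enorm (cv x) < 1)%R.
    by rewrite ltNge; apply/negP => /mk; rewrite ltnn.
  move=> h; rewrite (_ : _ * _ = 2 * (2 ^+ k * enorm (cv x)))%R ?gtr_pMr//.
  by rewrite mulrA -exprS.
have m0 : measurable (cv @^-1` [set 0%R]).
  by rewrite -[X in measurable X]setTI; exact: measurable_cone_val.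
have ms n : measurable (dilate (pow2 n.+1) @^-1` (@cone_shell _ _ Om)).
  rewrite -[X in measurable X]setTI; apply: measurable_dilate => //.
  exact: measurable_cone_shell.
apply: (@le_lt_trans _ _ (mu (cv @^-1` [set 0%R] `|`
    \bigcup_n (dilate (pow2 n.+1) @^-1` cone_shell)))).
  apply: le_measure => //; rewrite inE; first exact: measurable_cone_ball.
  by apply: measurableU => //; exact: bigcup_measurable.
apply: (@le_lt_trans _ _ (mu (cv @^-1` [set 0%R]) +
    mu (\bigcup_n (dilate (pow2 n.+1) @^-1` cone_shell)))).
  by apply: measureU2 => //; exact: bigcup_measurable.
rewrite origin_null add0e.
apply: (@le_lt_trans _ _ (\sum_(0 <= n <oo) mu (dilate (pow2 n.+1) @^-1` cone_shell))).
  by apply: measure_sigma_subadditive => //; exact: bigcup_measurable.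
have fs : mu cone_shell \is a fin_num.
  by rewrite ge0_fin_numE//; exact: (cone_shell_finite Q_density mu_polar).
under eq_eseriesr => n _.
  rewrite (polar_preimageE Q_density mu_polar)//; last exact: measurable_cone_shell.
  rewrite pow2E exprSr -(fineK fs) -EFinM mulrC mulrA [(_ * _ ^+ n * _)%R]mulrAC.
  over.
exact: geometric_nneseries_lty.
Qed.

Let ball_scale (r : {posnum R}) :
  mu (cone_ball r%:num) = (r%:num `^ (2 * a))%:E * mu (cone_ball 1).
Proof.
rewrite (polar_dilate Q_density mu_polar r); last exact: measurable_cone_ball.
congr (_ * mu _); apply/seteqP; split => x; rewrite /cone_ball /preimage/= enorm_dilate.
  by rewrite gtr_pMr.
by rewrite gtr_pMr.
Qed.

Lemma cone_ball_finite r : mu (cone_ball r) < +oo.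
Proof.
apply: (@le_lt_trans _ _ (mu (cone_ball (`|r| + 1)))).
  apply: le_measure; rewrite ?inE; try exact: measurable_cone_ball.
  move=> x; rewrite /cone_ball/= => /lt_le_trans; apply.
  by rewrite (le_trans (ler_norm r))// lerDl.
have r0 : (0 < `|r| + 1)%R by rewrite ltr_wpDl.
rewrite (ball_scale (PosNum r0)) lte_mul_pinfty ?lee_fin ?powR_ge0//.
exact: cone_ball1_finite.
Qed.

Lemma polar_sigma_finite : sigma_finite setT mu.
Proof.
exists (fun n => cone_ball n%:R) => [|n].
  apply/esym; rewrite -subTset => x _.
  exists (Num.truncn (enorm (cv x))).+1 => //=.
  by rewrite /cone_ball/= truncnS_gt.
by split; [exact: measurable_cone_ball|exact: cone_ball_finite].
Qed.

(** Every x satisfies 2^n <= 1 + |x| and |x| < 2^(n+1) for some n. There the weight is at most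
    2^(-nk), while the ball of radius 2^(n+1) has measure proportional to 2^(2a(n+1)); the sum is
    geometric of ratio 2^(2a - k) < 1. *)
Lemma integrable_weight (k : nat) : (2 * a < k%:R)%R ->
  mu.-integrable setT (fun x => ((1 + enorm (cv x)) ^- k)%:E).
Proof.
move=> ak.
have e0 (x : Om) : (0 < 1 + enorm (cv x))%R by rewrite ltr_pwDl ?enorm_ge0.
have mw : measurable_fun setT (fun x : Om => ((1 + enorm (cv x)) ^- k)%R).
  under eq_fun do rewrite -powR_invn ?ltW//.
  apply: (@measurableT_comp _ _ _ _ _ _ (fun r : R => r `^ (- k%:R))%R).
    exact: measurable_powR.
  by apply: measurable_funD => //; exact: measurable_enorm_cone.
apply/integrableP; split; first exact/measurable_EFinP.
pose g n (x : Om) := ((2 ^- (n * k)) * \1_(cone_ball (2 ^+ n.+1)) x : R)%R.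
have g0 n x : (0 <= g n x)%R by rewrite /g mulr_ge0 ?invr_ge0 ?exprn_ge0.
have mg n : measurable_fun setT (fun x => (g n x)%:E).
  apply/measurable_EFinP; apply: measurable_funM => //; apply: measurable_indic.
  exact: measurable_cone_ball.
apply: (@le_lt_trans _ _ (\int[mu]_x \sum_(0 <= n <oo) (g n x)%:E)).
  apply: ge0_le_integral => //.
  - by apply: measurableT_comp => //; exact/measurable_EFinP.
  - by apply: ge0_emeasurable_sum => // n x _ _; rewrite lee_fin.
  move=> x _; rewrite gee0_abs; last by rewrite lee_fin invr_ge0 exprn_ge0// ltW.
  have [n nx xn] : exists2 n : nat, (2 ^+ n <= 1 + enorm (cv x))%R &
      (enorm (cv x) < 2 ^+ n.+1)%R.
    have ex : exists n : nat, (enorm (cv x) < 2 ^+ n.+1)%R.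
      exists (Num.truncn (enorm (cv x))).+1.
      apply: lt_le_trans (truncnS_gt _) _; rewrite -natrX ler_nat.
      by rewrite (leq_trans (leqnSn _))// ltnW// ltn_expl.
    exists (ex_minn ex); case: ex_minnP => -[|n] hn mn //.
      by rewrite expr0 lerDl enorm_ge0.
    have : ~~ (enorm (cv x) < 2 ^+ n.+1)%R.
      by apply/negP => /mn; rewrite ltnn.
    by rewrite -leNgt => /le_trans; apply; rewrite lerDr.
  apply: (@le_trans _ _ (g n x)%:E).
    rewrite lee_fin /g indicE mem_set//= mulr1 lef_pV2 ?posrE ?exprn_gt0//.
    by rewrite exprM lerXn2r ?nnegrE ?exprn_ge0// ltW.
  apply: (@le_trans _ _ (\sum_(0 <= i < n.+1) (g i x)%:E)).
    rewrite big_nat_recr//= leeDr//; apply: sume_ge0 => i _; rewrite lee_fin; exact: g0.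
  by apply: nneseries_lim_ge => i _ _; rewrite lee_fin; exact: g0.
rewrite integral_nneseries//; last by move=> n x _; rewrite lee_fin.
have fb : mu (cone_ball 1) \is a fin_num.
  by rewrite ge0_fin_numE//; exact: cone_ball1_finite.
pose c := ((2 : R) `^ (2 * a) * fine (mu (cone_ball 1)))%R.
pose q := ((2 : R) `^ (2 * a - k%:R))%R.
under eq_eseriesr => n _.
  rewrite (_ : (\int[mu]_x _ = (c * q ^+ n)%:E)); last first.
    under eq_integral do rewrite EFinM.
    rewrite ge0_integralZl//; last first.
      by apply/measurable_EFinP; apply: measurable_indic; exact: measurable_cone_ball.
    rewrite integral_indic ?setIT//; last exact: measurable_cone_ball.
    rewrite -[X in cone_ball X]/((pow2 n.+1)%:num)%R ball_scale.
    rewrite -(fineK fb) -!EFinM [(pow2 n.+1)%:num]/(2 ^+ n.+1)%R powR_exprn//.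
    congr EFin; rewrite /c /q powRB; last by apply/implyP.
    rewrite powR_mulrn// expr_div_n exprSr -exprM [(k * n)%N]mulnC.
    by field.
  over.
apply: geometric_nneseries_lty.
  by rewrite mulr_ge0 ?fine_ge0 ?powR_ge0.
rewrite /q powR_gt0//=.
have : ((2 : R) `^ (2 * a) < 2 `^ k%:R)%R.
  by rewrite -ltr_ln ?posrE ?powR_gt0// !ln_powR ltr_pM2r// ln_gt0// ltr1n.
by rewrite powRB ?ltr_pdivrMr ?powR_gt0 ?mul1r//; apply/implyP.
Qed.

End polar_finite.

(** * Change of variables under dilation *)

Section dilation_integral.
Context {R : realType} {d : nat} {Om : convexCone R d}.
Variables (mu : {measure set Om -> \bar R}) (a : R) (Q : 'rV[R]_d -> R).
Hypothesis Q_density : polar_density Q.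
Hypothesis mu_polar : polar_decomposition mu a Q.
Local Open Scope ereal_scope.
Variable t : {posnum R}.

Let c : {nonneg R} := (t%:num `^ (- (2 * a)))%:nng%R.

Let push : {measure set Om -> \bar R} :=
  measure_function_pushforward__canonical__measure_function_Measure mu
    (@measurable_dilate R d Om t).

Let pushE A : measurable A -> push A = mscale c mu A.
Proof. by move=> mA; exact: (polar_preimageE Q_density mu_polar t mA). Qed.

Lemma ge0_integral_dilate (f : Om -> \bar R) : measurable_fun setT f ->
  (forall x, 0 <= f x) ->
  \int[mu]_x f (dilate t x) = (t%:num `^ (- (2 * a)))%:E * \int[mu]_x f x.
Proof.
move=> mf f0; have <- : \int[push]_x f x = \int[mu]_x f (dilate t x).
  by rewrite (ge0_integral_pushforward (@measurable_dilate R d Om t)).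
rewrite (eq_measure_integral (mscale c mu)); last by move=> A mA _; exact: pushE.
by rewrite ge0_integral_mscale.
Qed.

Lemma integrable_dilate (f : Om -> \bar R) : mu.-integrable setT f ->
  mu.-integrable setT (fun x => f (dilate t x)).
Proof.
move=> /integrableP[mf foo]; apply/integrableP; split.
  by apply: (measurableT_comp mf); exact: measurable_dilate.
rewrite (ge0_integral_dilate (f := fun x => `|f x|))//; last exact: measurableT_comp.
by rewrite lte_mul_pinfty.
Qed.

Lemma Rintegral_dilate (f : Om -> R) : mu.-integrable setT (EFin \o f) ->
  Rintegral mu setT (fun x => f (dilate t x)) =
  (t%:num `^ (- (2 * a)) * Rintegral mu setT f)%R.
Proof.
move=> If; have /integrableP[mf _] := If.
have fi := integrable_fin_num measurableT If.
rewrite /Rintegral integralE.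
have -> : \int[mu]_x (fun x => (f (dilate t x))%:E)^\+ x =
    (t%:num `^ (- (2 * a)))%:E * \int[mu]_x (fun x => (f x)%:E)^\+ x.
  rewrite -ge0_integral_dilate//; last exact: measurable_funepos mf.
  by apply: eq_integral => x _; rewrite !funeposE.
have -> : \int[mu]_x (fun x => (f (dilate t x))%:E)^\- x =
    (t%:num `^ (- (2 * a)))%:E * \int[mu]_x (fun x => (f x)%:E)^\- x.
  rewrite -ge0_integral_dilate//; last exact: measurable_funeneg mf.
  by apply: eq_integral => x _; rewrite !funenegE.
rewrite -muleBr//; last first.
  by apply: fin_num_adde_defl; rewrite fin_numN; exact: integrable_neg_fin_num.
by rewrite -(integralE mu setT (EFin \o f)) fineM.
Qed.

Lemma ae_dilate (P : Om -> Prop) : {ae mu, forall x, P x} ->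
  {ae mu, forall x, P (dilate t x)}.
Proof.
move=> [N [mN N0 PN]]; exists (dilate t @^-1` N); split.
- by rewrite -[X in measurable X]setTI; exact: measurable_dilate.
- by rewrite (polar_preimageE Q_density mu_polar)// N0 mule0.
- by move=> x /= Px; exact: PN.
Qed.

End dilation_integral.

(** * Borel measurability on a product of two cones *)

Section product_measurability.
Context {R : realType} {d : nat} {Om Omh : convexCone R d}.

Let box (q : 'rV[rat]_d) (k : nat) : set 'rV[R]_d :=
  [set x | forall i, ball (ratr (q ord0 i) : R) k.+1%:R^-1 (x ord0 i)].

Let measurable_box (C : convexCone R d) q k : measurable (@cone_val _ _ C @^-1` box q k).
Proof.
rewrite -[X in measurable X]setTI; apply: measurable_cone_val => //.
rewrite (_ : box q k = \bigcap_(i in [set: 'I_d])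
    (fun x : 'rV[R]_d => x ord0 i) @^-1` ball (ratr (q ord0 i) : R) k.+1%:R^-1); last first.
  by apply/seteqP; split => [x /= h i _|x /= h i]; exact: h.
apply: fin_bigcap_measurable => // i _; rewrite -[X in measurable X]setTI.
by apply: measurable_coord => //; apply: open_measurable; exact: ball_open.
Qed.

Let nbhs_box (C : convexCone R d) (x : C) (A : set C) : nbhs x A ->
  exists q k, box q k (cone_val x) /\ @cone_val _ _ C @^-1` box q k `<=` A.
Proof.
rewrite nbhsE => -[U [[V oV <-] /= Vx] UA].
move: Vx; rewrite (open_rV_box oV) => -[[q k] /= h bx].
exists q, k; split => // y yq; apply: UA => /=; rewrite /preimage/=.
by rewrite (open_rV_box oV); exists (q, k).
Qed.

(** [measurable] refers here to the product of the two Borel sigma-algebras. Boxes with rational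
    data form a countable base, so an open set is a countable union of measurable rectangles. *)
Lemma open_measurable_cone_prod (W : set (Om * Omh)) : open W -> measurable W.
Proof.
move=> oW.
pose B (i : ('rV[rat]_d * nat) * ('rV[rat]_d * nat)) : set (Om * Omh) :=
  (@cone_val _ _ Om @^-1` box i.1.1 i.1.2) `*`
  (@cone_val _ _ Omh @^-1` box i.2.1 i.2.2).
rewrite (_ : W = \bigcup_(i in [set i | B i `<=` W]) B i).
  rewrite bigcup_mkcond; apply: countable_bigcupT_measurable => // i.
  by case: ifPn => // _; apply: measurableX; exact: measurable_box.
apply/seteqP; split => [[x y] Wxy|p [i /= iW] /iW//].
have [[A1 A2] /= [/nbhs_box[q [k [bq qA]]] /nbhs_box[q' [k' [bq' qA']]]] AW] :
  nbhs (x, y) W by exact: open_nbhs_nbhs.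
exists ((q, k), (q', k')) => //= -[u v] [/= hu hv]; apply: AW; split.
  exact: qA.
exact: qA'.
Qed.

Lemma continuous_measurable_cone_prod (f : Om * Omh -> R) : continuous f ->
  measurable_fun setT f.
Proof.
move=> cf; apply: (measurability _ (RGenOpens.measurableE R)).
move=> _ [_ [u [v ->]] <-]; rewrite setTI; apply: open_measurable_cone_prod.
by move/continuousP : cf; apply; exact: interval_open.
Qed.

Lemma continuous_kernel_ReIm (K : Om -> Omh -> R[i]) : continuous_kernel K ->
  continuous (fun p : Om * Omh => complex.Re (K p.1 p.2)) /\
  continuous (fun p : Om * Omh => complex.Im (K p.1 p.2)).
Proof.
move=> cK; split => p; apply/cvgrPdist_lt => e e0.
all: have e0' : 0 < (e%:C%C : R[i]) by rewrite ltcR.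
all: have /cvgrPdist_lt/(_ _ e0') := cK p; apply: filterS => q.
all: rewrite -[X in X < _]/((Normc.normc (K p.1 p.2 - K q.1 q.2))%:C%C) ltcR.
all: apply: le_lt_trans; rewrite -?cReN -?cReD -?cImN -?cImD.
  exact: normc_Re.
exact: normc_Im.
Qed.

End product_measurability.

(** * Fubini's theorem for real integrals *)

Section sigma_finite_copy.
Context {R : realType} {dT} {T : measurableType dT}.
Variables (m : {measure set T -> \bar R}) (sf : sigma_finite setT m).

(** An alias that takes the proof of sigma-finiteness as an argument, so that the structure required
    by Fubini's theorem can be attached to a measure given as a variable. *)
Definition sigma_finite_copy of sigma_finite setT m : set T -> \bar R := m.

HB.instance Definition _ := isMeasure.Build _ _ _ (sigma_finite_copy sf)
  (measure0 m) (measure_ge0 m) (@measure_semi_sigma_additive _ _ _ m).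

HB.instance Definition _ :=
  Measure_isSigmaFinite.Build _ _ _ (sigma_finite_copy sf) sf.

End sigma_finite_copy.

Section real_fubini.
Context {R : realType} {d1 d2} {T1 : measurableType d1} {T2 : measurableType d2}.
Variables (m1 : {measure set T1 -> \bar R}) (m2 : {measure set T2 -> \bar R}).
Hypothesis sf1 : sigma_finite setT m1.
Hypothesis sf2 : sigma_finite setT m2.

Let n1 : {sigma_finite_measure set T1 -> \bar R} := sigma_finite_copy sf1.
Let n2 : {sigma_finite_measure set T2 -> \bar R} := sigma_finite_copy sf2.

Variables (f : T1 * T2 -> R) (g1 : T1 -> R) (g2 : T2 -> R).
Hypothesis mf : measurable_fun setT f.
Hypothesis g1_int : m1.-integrable setT (EFin \o g1).
Hypothesis g2_int : m2.-integrable setT (EFin \o g2).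
Hypothesis g1_ge0 : forall x, 0 <= g1 x.
Hypothesis g2_ge0 : forall y, 0 <= g2 y.
Hypothesis f_le : forall x y, `|f (x, y)| <= g1 x * g2 y.
Local Open Scope ereal_scope.

Let int_f : (n1 \x n2).-integrable setT (EFin \o f).
Proof.
apply/integrable12ltyP; first exact/measurable_EFinP.
have [mg1 g1oo] := integrableP _ _ _ g1_int.
have [mg2 g2oo] := integrableP _ _ _ g2_int.
apply: (@le_lt_trans _ _ (\int[m1]_x ((g1 x)%:E * \int[m2]_y (g2 y)%:E))).
  apply: ge0_le_integral => //.
  - by move=> x _; exact: integral_ge0.
  - apply: (measurable_fun_fubini_tonelli_F (m2 := n2) (fun p => `|(f p)%:E|)) => //.
    by apply: measurableT_comp => //; exact/measurable_EFinP.
  - by apply: emeasurable_funM.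
  move=> x _; rewrite -ge0_integralZl ?lee_fin//; last by move=> y _; rewrite lee_fin g2_ge0.
  apply: ge0_le_integral => //.
  - apply: measurableT_comp => //; apply/measurable_EFinP.
    by apply: (measurableT_comp mf); exact: measurable_pair1.
  - exact: emeasurable_funM.
  by move=> y _; rewrite /= -EFinM lee_fin.
have g2f : \int[m2]_y (g2 y)%:E \is a fin_num by exact: integrable_fin_num.
rewrite ge0_integralZr//; last 2 first.
- by move=> x _; rewrite lee_fin g1_ge0.
- by apply: integral_ge0 => y _; rewrite lee_fin g2_ge0.
rewrite lte_mul_pinfty//.
- by apply: integral_ge0 => x _; rewrite lee_fin g1_ge0.
- exact: integrable_fin_num.
by rewrite -ge0_fin_numE//; apply: integral_ge0 => y _; rewrite lee_fin g2_ge0.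
Qed.

(** The product bound makes every slice integrable, not only almost every one, so extended and real
    iterated integrals agree at every point. *)
Lemma Rintegral_slice1 x : m2.-integrable setT (fun y => (f (x, y))%:E).
Proof.
apply: (le_integrable measurableT _ _ (integrableZl measurableT (g1 x) g2_int)).
  apply/measurable_EFinP; apply: (measurableT_comp mf); exact: measurable_pair1.
move=> y _; rewrite -EFinM lee_fin (le_trans (f_le x y))//.
by rewrite ler_norm.
Qed.

Lemma Rintegral_slice2 y : m1.-integrable setT (fun x => (f (x, y))%:E).
Proof.
apply: (le_integrable measurableT _ _ (integrableZl measurableT (g2 y) g1_int)).
  apply/measurable_EFinP; apply: (measurableT_comp mf); exact: measurable_pair2.
move=> x _; rewrite -EFinM lee_fin (le_trans (f_le x y))// mulrC.
by rewrite ler_norm.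
Qed.

Let F_EFin x : \int[m2]_y (f (x, y))%:E = (Rintegral m2 setT (fun y => f (x, y)))%:E.
Proof. by rewrite fineK//; apply: integrable_fin_num => //; exact: Rintegral_slice1. Qed.

Let G_EFin y : \int[m1]_x (f (x, y))%:E = (Rintegral m1 setT (fun x => f (x, y)))%:E.
Proof. by rewrite fineK//; apply: integrable_fin_num => //; exact: Rintegral_slice2. Qed.

Lemma Rintegral_fubini_integrable :
  m1.-integrable setT (fun x => (Rintegral m2 setT (fun y => f (x, y)))%:E).
Proof.
by apply: eq_integrable (integrable_fubini_F int_f) => // x _; rewrite -F_EFin.
Qed.

Lemma Rintegral_fubini_measurable2 :
  measurable_fun setT (fun y => Rintegral m1 setT (fun x => f (x, y))).
Proof.
apply/measurable_EFinP; rewrite (_ : _ \o _ = fubini_G n1 (EFin \o f)).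
  exact: measurable_fubini_G int_f.
by apply/funext => y /=; rewrite -G_EFin.
Qed.

Lemma Rintegral_fubini :
  Rintegral m1 setT (fun x => Rintegral m2 setT (fun y => f (x, y))) =
  Rintegral m2 setT (fun y => Rintegral m1 setT (fun x => f (x, y))).
Proof.
rewrite /Rintegral; congr fine.
under eq_integral do rewrite -F_EFin.
under [RHS]eq_integral do rewrite -G_EFin.
exact: (Fubini int_f).
Qed.

End real_fubini.

(** * Schwartz functions *)

Section schwartz_weight.
Context {R : realType} {d : nat}.
Local Notation V := 'rV[R]_d.
Local Notation dl i := (delta_mx ord0 i : V).

(** A smooth substitute for (1 + |x|)^(-2), which is not differentiable at the origin. Its powers
    tame polynomial growth and multiply Schwartz functions into Schwartz functions. *)
Definition sweight (x : V) : R := (1 + enorm x ^+ 2)^-1.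

Lemma sqr_enorm (x : V) : enorm x ^+ 2 = \sum_i x ord0 i ^+ 2.
Proof. by rewrite sqr_sqrtr// sumr_ge0// => i _; exact: sqr_ge0. Qed.

Let q : V -> R := cst 1 + \sum_(i < d) (fun x : V => x ord0 i) ^+ 2.

Let qE x : q x = 1 + enorm x ^+ 2.
Proof. by rewrite sqr_enorm /q fctE fct_sumE. Qed.

Let q_gt0 x : 0 < q x.
Proof. by rewrite qE ltr_pwDl ?sqr_ge0. Qed.

Let sweightE : sweight = (fun x => (q x)^-1).
Proof. by apply/funext => x; rewrite qE. Qed.

Let is_derive_coord i (x v : V) : is_derive x v (fun x : V => x ord0 i) (v ord0 i).
Proof.
have dc : derivable (fun x : V => x ord0 i) x v.
  by apply: diff_derivable; exact: differentiable_coord.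
apply: DeriveDef => //.
have did : derivable (id : V -> V) x v by exact: derivable_id.
have := derive_mx did; rewrite derive_id => /matrixP/(_ ord0 i).
by rewrite mxE.
Qed.

Let differentiable_q x : differentiable q x.
Proof.
apply: differentiableD; first exact: differentiable_cst.
apply: differentiable_sum => i; apply: differentiableX.
exact: differentiable_coord.
Qed.

Let differentiable_sweight x : differentiable sweight x.
Proof.
rewrite sweightE; apply: differentiableV => //.
by rewrite gt_eqF.
Qed.

Let is_derive_q x i : is_derive x (dl i) q (2 * x ord0 i).
Proof.
have h : is_derive x (dl i) q (0 + \sum_(j < d) (2 * x ord0 j ^+ 1) *: (dl i) ord0 j).
  apply: is_deriveD; apply: is_derive_sum => j.
  exact: (@is_deriveX _ _ (fun x : V => x ord0 j) 2 x (dl i)).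
apply: is_derive_eq h _; rewrite add0r (bigD1 i)//= big1 => [|j ji].
  by rewrite mxE !eqxx addr0 expr1 /GRing.scale/= mulr1 mulr_natl.
by rewrite mxE eqxx (negbTE ji) /= scaler0.
Qed.

Let derive_sweight x i :
  'D_(dl i) sweight x = - 2 * (x ord0 i * (sweight x * sweight x)).
Proof.
rewrite sweightE deriveV ?gt_eqF//; last by case: (is_derive_q x i).
have [_ ->] := is_derive_q x i.
by rewrite /GRing.scale/= -exprVn; ring.
Qed.

Variable g : V -> R.
Hypothesis g_schwartz : schwartz g.

(** A class containing g and stable under partial derivatives, since the i-th derivative of
    [sweight] is -2 x_i times its square. Structural induction on it replaces a Leibniz formula for
    iterated derivatives of a product. *)
Inductive schwartz_module : (V -> R) -> Prop :=
| SchwartzModulePartial s : schwartz_module (iter_partial s g)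
| SchwartzModuleCoord i f : schwartz_module f ->
    schwartz_module (fun x : V => x ord0 i * f x)
| SchwartzModuleWeight f : schwartz_module f ->
    schwartz_module (fun x => sweight x * f x)
| SchwartzModuleScale c f : schwartz_module f ->
    schwartz_module (fun x => c * f x)
| SchwartzModuleAdd f1 f2 : schwartz_module f1 -> schwartz_module f2 ->
    schwartz_module (fun x => f1 x + f2 x).

Lemma schwartz_module_differentiable f x : schwartz_module f -> differentiable f x.
Proof.
elim=> {f} [s|i f _ IH|f _ IH|c f _ IH|f1 f2 _ IH1 _ IH2].
- by case: g_schwartz => + _; apply.
- exact: (@differentiableM _ _ (fun x : V => x ord0 i) f x (differentiable_coord _ _ _) IH).
- exact: (@differentiableM _ _ sweight f x (differentiable_sweight x) IH).
- exact: (@differentiableZ _ _ _ f c).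
- exact: (@differentiableD _ _ _ f1 f2).
Qed.

Lemma sweight_ge0 x : 0 <= sweight x.
Proof. by rewrite invr_ge0 addr_ge0 ?sqr_ge0. Qed.

Lemma sweight_gt0 x : 0 < sweight x.
Proof. by rewrite invr_gt0 ltr_pwDl ?sqr_ge0. Qed.

Lemma sweight_le1 x : sweight x <= 1.
Proof. by rewrite invf_le1 ?lerDl ?sqr_ge0// ltr_pwDl ?sqr_ge0. Qed.

Lemma le_coord_enorm (x : V) i : `|x ord0 i| <= enorm x.
Proof.
rewrite -ler_sqr ?nnegrE ?enorm_ge0// real_normK ?num_real// sqr_enorm.
by rewrite (bigD1 i)//= lerDl sumr_ge0// => j _; exact: sqr_ge0.
Qed.

Lemma schwartz_module_decay f (k : nat) : schwartz_module f ->
  exists C : R, forall x, (1 + enorm x) ^+ k * `|f x| <= C.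
Proof.
move=> Hf; elim: Hf k => {f} [s|i f _ IH|f _ IH|c f _ IH|f1 f2 _ IH1 _ IH2] k.
- by case: g_schwartz => _; apply.
- have [C HC] := IH k.+1; exists C => x; apply: le_trans (HC x).
  rewrite normrM mulrA exprSr ler_wpM2r// ler_wpM2l ?exprn_ge0 ?addr_ge0 ?enorm_ge0//.
  by rewrite (le_trans (le_coord_enorm _ _))// lerDr.
- have [C HC] := IH k; exists C => x; apply: le_trans (HC x).
  rewrite normrM ler_wpM2l ?exprn_ge0 ?addr_ge0 ?enorm_ge0//.
  by rewrite ler_piMl// ger0_norm ?sweight_ge0 ?sweight_le1.
- have [C HC] := IH k; exists (`|c| * C) => x.
  by rewrite normrM mulrCA ler_wpM2l.
- have [C1 HC1] := IH1 k; have [C2 HC2] := IH2 k; exists (C1 + C2) => x.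
  apply: le_trans (lerD (HC1 x) (HC2 x)); rewrite -mulrDr ler_wpM2l ?ler_normD//.
  by rewrite exprn_ge0 ?addr_ge0 ?enorm_ge0.
Qed.

Lemma schwartz_module_derive f i : schwartz_module f ->
  schwartz_module (fun x => 'D_(dl i) f x).
Proof.
have dm f' x : schwartz_module f' -> derivable f' x (dl i).
  by move=> /schwartz_module_differentiable df; exact: diff_derivable.
elim=> {f} [s|j f Hf IH|f Hf IH|c f Hf IH|f1 f2 H1 IH1 H2 IH2].
- exact: (SchwartzModulePartial (i :: s)).
- rewrite (_ : (fun x => _) = (fun x : V => x ord0 j * 'D_(dl i) f x + (dl i) ord0 j * f x)).
    by apply: SchwartzModuleAdd; [exact: SchwartzModuleCoord|exact: SchwartzModuleScale].
  apply/funext => x; have [dc ec] := is_derive_coord j x (dl i).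
  rewrite (@deriveM _ _ (fun x : V => x ord0 j) f)//; last exact: dm.
  by rewrite ec /GRing.scale/= [f x * _]mulrC.
- rewrite (_ : (fun x => _) = (fun x : V => sweight x * 'D_(dl i) f x +
      (- 2) * (x ord0 i * (sweight x * (sweight x * f x))))).
    apply: SchwartzModuleAdd; first exact: SchwartzModuleWeight.
    apply: SchwartzModuleScale; apply: SchwartzModuleCoord.
    by do 2 apply: SchwartzModuleWeight.
  apply/funext => x; rewrite (@deriveM _ _ sweight f)//; last exact: dm.
    by rewrite derive_sweight /GRing.scale/=; ring.
  exact: diff_derivable.
- rewrite (_ : (fun x => _) = (fun x : V => c * 'D_(dl i) f x)).
    exact: SchwartzModuleScale.
  by apply/funext => x; rewrite (@deriveZ _ _ _ f c)//; exact: dm.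
- rewrite (_ : (fun x => _) = (fun x : V => 'D_(dl i) f1 x + 'D_(dl i) f2 x)).
    exact: SchwartzModuleAdd.
  by apply/funext => x; rewrite (@deriveD _ _ _ f1 f2)//; exact: dm.
Qed.

Lemma schwartz_module_schwartz f : schwartz_module f -> schwartz f.
Proof.
move=> Hf; have Hs s : schwartz_module (iter_partial s f).
  by elim: s => [//|i s IH]; exact: schwartz_module_derive.
by split => [s x|s k]; [exact: schwartz_module_differentiable|exact: schwartz_module_decay].
Qed.

Lemma schwartz_mul_weight N : schwartz (fun x => sweight x ^+ N * g x).
Proof.
apply: schwartz_module_schwartz; elim: N => [|N IH].
  by under eq_fun do rewrite expr0 mul1r; exact: (SchwartzModulePartial [::]).
by under eq_fun do rewrite exprS -mulrA; exact: SchwartzModuleWeight.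
Qed.

Lemma schwartzZ c : schwartz (fun x => c * g x).
Proof.
by apply: schwartz_module_schwartz; apply: SchwartzModuleScale; exact: (SchwartzModulePartial [::]).
Qed.

End schwartz_weight.

(** * Complex linearity of integrals and of L2 *)

Section complex_L2.
Context {R : realType} {dT} {T : measurableType dT}.
Variable mu : {measure set T -> \bar R}.
Implicit Types (f g h : T -> R[i]) (c : R[i]).

Lemma integrable_inL2 f : cmeasurable f ->
  mu.-integrable setT (fun x => (cdot (f x) (f x))%:E) -> inL2 mu f.
Proof.
move=> mf /integrableP[_ foo]; split => //; rewrite sqnormL2E.
apply: le_lt_trans foo; rewrite le_eqVlt; apply/orP; left; apply/eqP.
by apply: eq_integral => x _; rewrite gee0_abs ?lee_fin ?cdot_ge0.
Qed.

Let RintZ (r : R) (u : T -> R) : mu.-integrable setT (EFin \o u) ->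
  mu.-integrable setT (EFin \o (fun x => r * u x)).
Proof.
by move=> /(integrableZl measurableT r); apply: eq_integrable => // x _ /=; rewrite EFinM.
Qed.

Lemma cintegralZD c f g : inL1 mu f -> inL1 mu g ->
  cintegral mu (fun x => c * f x + g x) = c * cintegral mu f + cintegral mu g.
Proof.
move=> [f1 f2] [g1 g2]; apply: complex_ext; rewrite !ReImE /=.
  rewrite -!RintegralZl// -RintegralB//; try exact: RintZ.
  rewrite -RintegralD//; first by apply: eq_Rintegral => x _; rewrite !ReImE.
  have := integrableB measurableT (RintZ (complex.Re c) f1) (RintZ (complex.Im c) f2).
  by apply: eq_integrable => // x _ /=.
rewrite -!RintegralZl// -RintegralD//; try exact: RintZ.
rewrite -RintegralD//; first by apply: eq_Rintegral => x _; rewrite !ReImE.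
have := integrableD measurableT (RintZ (complex.Re c) f2) (RintZ (complex.Im c) f1).
by apply: eq_integrable => // x _ /=.
Qed.

Lemma inL1_0 : inL1 mu (fun=> 0).
Proof. by split; exact: integrable0. Qed.

Lemma cintegral0 : cintegral mu (fun=> 0) = 0.
Proof. by apply: complex_ext; rewrite /= /Rintegral integral0. Qed.

Lemma innerL2_0l h : innerL2 mu (fun=> 0) h = 0.
Proof.
rewrite /innerL2 (_ : (fun x => _) = (fun=> 0)) ?cintegral0//.
by apply/funext => x; rewrite mul0r.
Qed.

Lemma cintegralZ c f : inL1 mu f ->
  cintegral mu (fun x => c * f x) = c * cintegral mu f.
Proof.
move=> Hf; have := cintegralZD c Hf inL1_0.
by rewrite cintegral0 addr0 => <-; congr cintegral; apply/funext => x; rewrite addr0.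
Qed.

Lemma cintegralJ f : inL1 mu f ->
  cintegral mu (fun x => conjc (f x)) = conjc (cintegral mu f).
Proof.
move=> [_ f2]; apply: complex_ext; rewrite !ReImE /=.
  by apply: eq_Rintegral => x _; rewrite ReImE.
rewrite -mulN1r -RintegralZl//; apply: eq_Rintegral => x _.
by rewrite ReImE mulN1r.
Qed.

Lemma cdot_mulI (z w : R[i]) : cdot ('i%C * z) ('i%C * w) = cdot z w.
Proof. by rewrite /cdot !ReImE /=; ring. Qed.

Lemma inL2_mulI f : inL2 mu f -> inL2 mu (fun x => 'i%C * f x).
Proof.
move=> [[f1 f2] foo]; split.
  split.
    rewrite (_ : (fun _ => _) = \- (fun x => complex.Im (f x))); first exact: measurable_funN.
    by apply/funext => x; rewrite ReImE /=; ring.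
  rewrite (_ : (fun _ => _) = (fun x => complex.Re (f x)))//.
  by apply/funext => x; rewrite ReImE /=; ring.
move: foo; rewrite !sqnormL2E; under eq_integral do rewrite -cdot_mulI.
by [].
Qed.

Lemma inL2_cZD c f g : inL2 mu f -> inL2 mu g -> inL2 mu (fun x => c * f x + g x).
Proof.
move=> Hf Hg.
have := inL2_ZD (complex.Re c) Hf (inL2_ZD (complex.Im c) (inL2_mulI Hf) Hg).
congr (inL2 mu _); apply/funext => x; apply: complex_ext.
  by rewrite cReD cReZ cReD cReZ !ReImE /=; ring.
by rewrite cImD cImZ cImD cImZ !ReImE /=; ring.
Qed.

Lemma inL1_mulJ f g : inL2 mu f -> inL2 mu g -> inL1 mu (fun x => f x * conjc (g x)).
Proof.
move=> Hf Hg; split.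
  have := inL2_integrable Hf Hg; apply: eq_integrable => // x _.
  by rewrite /cdot !ReImE; congr EFin; ring.
have := inL2_integrable Hf (inL2_mulI Hg); apply: eq_integrable => // x _.
by rewrite /cdot !ReImE /=; congr EFin; ring.
Qed.

Lemma Re_innerL2 f g : complex.Re (innerL2 mu f g) = rip mu f g.
Proof. by apply: eq_Rintegral => x _; rewrite /cdot !ReImE; ring. Qed.

Lemma innerL2ZDl c f g h : inL2 mu f -> inL2 mu g -> inL2 mu h ->
  innerL2 mu (fun x => c * f x + g x) h = c * innerL2 mu f h + innerL2 mu g h.
Proof.
move=> Hf Hg Hh; rewrite -cintegralZD; try exact: inL1_mulJ.
by congr cintegral; apply/funext => x; rewrite mulrDl mulrA.
Qed.

Lemma innerL2J f g : inL2 mu f -> inL2 mu g ->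
  innerL2 mu g f = conjc (innerL2 mu f g).
Proof.
move=> Hf Hg; rewrite -cintegralJ; last exact: inL1_mulJ.
congr cintegral; apply/funext => x.
by rewrite rmorphM /= conjcK mulrC.
Qed.

Lemma innerL2ZDr c f g h : inL2 mu f -> inL2 mu g -> inL2 mu h ->
  innerL2 mu h (fun x => c * f x + g x) = conjc c * innerL2 mu h f + innerL2 mu h g.
Proof.
move=> Hf Hg Hh; rewrite innerL2J ?innerL2ZDl//; last exact: inL2_cZD.
by rewrite (innerL2J Hf Hh) (innerL2J Hg Hh) rmorphD rmorphM.
Qed.

Lemma innerL2_norm f : inL2 mu f -> innerL2 mu f f = (rip mu f f)%:C%C.
Proof.
move=> Hf; apply: complex_ext; rewrite ?Re_innerL2//=.
rewrite (_ : Rintegral _ _ _ = Rintegral mu setT (fun=> 0)).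
  by rewrite /Rintegral integral0.
by apply: eq_Rintegral => x _; rewrite !ReImE; ring.
Qed.

Lemma eq_innerL2 f f' g : inL2 mu f -> inL2 mu f' -> inL2 mu g ->
  ae_equal mu f f' -> innerL2 mu f g = innerL2 mu f' g.
Proof.
move=> Hf Hf' Hg ff'.
have [h1 h2] := inL1_mulJ Hf Hg; have [h1' h2'] := inL1_mulJ Hf' Hg.
apply: complex_ext; rewrite /= /Rintegral; congr fine; apply: ae_eq_integral => //.
all: try by [apply: measurable_int; eassumption].
all: by apply: filterS ff' => x ->.
Qed.

End complex_L2.

(** * Schwartz functions on a cone *)

Section schwartz_on_cone.
Context {R : realType} {d : nat} {Om : convexCone R d}.
Local Notation cv := (@cone_val R d Om).
Implicit Types f : Om -> R[i].

Lemma schwartz_on_decay f (k : nat) : schwartz_on f ->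
  exists2 C : R, 0 <= C & forall x, Normc.normc (f x) <= C * (1 + enorm (cv x)) ^- k.
Proof.
move=> [g [h [[_ /(_ [::] k)[C1 HC1]] [_ /(_ [::] k)[C2 HC2]] fE]]].
have e0 x : 0 < (1 + enorm (cv x)) ^+ k by rewrite exprn_gt0// ltr_pwDl ?enorm_ge0.
have H x : Normc.normc (f x) <= (C1 + C2) * (1 + enorm (cv x)) ^- k.
  rewrite ler_pdivlMr// mulrC.
  apply: le_trans (lerD (HC1 (cv x)) (HC2 (cv x))).
  rewrite -mulrDr ler_wpM2l ?(ltW (e0 x))// fE.
  exact: normc_ReIm.
exists (C1 + C2) => //.
(* The cone is nonempty, so the bound at its base point forces the constant to be nonnegative. *)
have := H point; rewrite ler_pdivlMr//; apply: le_trans.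
by rewrite mulr_ge0 ?normc_ge0 ?(ltW (e0 _)).
Qed.

Lemma schwartz_on_measurable f : schwartz_on f -> cmeasurable f.
Proof.
move=> [g [h [[dg _] [dh _] fE]]].
have m u : (forall s x, differentiable (iter_partial s u) x) ->
    measurable_fun setT (fun x : Om => u (cv x)).
  move=> du; apply: measurableT_comp; last exact: measurable_cone_val.
  apply: continuous_measurable_rV => x; apply: differentiable_continuous.
  exact: (du [::]).
by split; under eq_fun do rewrite fE; exact: m.
Qed.

Lemma schwartz_on_mulI f : schwartz_on f -> schwartz_on (fun x => 'i%C * f x).
Proof.
move=> [g [h [sg sh fE]]]; exists (fun x => -1 * h x), g; split => //.
  exact: schwartzZ.
by move=> x; rewrite fE; apply: complex_ext; rewrite !ReImE /=; ring.
Qed.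

Lemma schwartz_on_mul_weight f N : schwartz_on f ->
  schwartz_on (fun x => (sweight (cv x) ^+ N)%:C%C * f x).
Proof.
move=> [g [h [sg sh fE]]].
exists (fun x => sweight x ^+ N * g x), (fun x => sweight x ^+ N * h x); split.
- exact: schwartz_mul_weight.
- exact: schwartz_mul_weight.
by move=> x; rewrite fE; apply: complex_ext; rewrite !ReImE /=; ring.
Qed.

Variables (mu : {measure set Om -> \bar R}) (a : R) (Q : 'rV[R]_d -> R).
Hypothesis Q_density : polar_density Q.
Hypothesis mu_polar : polar_decomposition mu a Q.
Hypothesis a_gt0 : 0 < a.

Lemma weight_exponent : exists k : nat, 2 * a < k%:R.
Proof. by exists (Num.truncn (2 * a)).+1; exact: truncnS_gt. Qed.

Lemma schwartz_on_inL2 f : schwartz_on f -> inL2 mu f.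
Proof.
move=> sf; have mf := schwartz_on_measurable sf; apply: integrable_inL2 => //.
have [k ak] := weight_exponent.
have Iw := integrable_weight Q_density mu_polar a_gt0 ak.
have [C C0 HC] := schwartz_on_decay k sf.
apply: (le_integrable measurableT _ _ (integrableZl measurableT (C ^+ 2) Iw)).
  by apply/measurable_EFinP; exact: measurable_cdot.
move=> x _; rewrite -EFinM lee_fin ger0_norm ?cdot_ge0//.
rewrite -sqr_normcE; apply: le_trans (ler_norm _).
have e1 : 1 <= 1 + enorm (cv x) by rewrite lerDl enorm_ge0.
have w0 : 0 <= (1 + enorm (cv x)) ^- k.
  by rewrite invr_ge0 exprn_ge0// (le_trans _ e1).
apply: (@le_trans _ _ ((C * (1 + enorm (cv x)) ^- k) ^+ 2)).
  by rewrite lerXn2r ?nnegrE ?normc_ge0 ?mulr_ge0.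
rewrite exprMn ler_wpM2l ?sqr_ge0// expr2 ler_piMl//.
by rewrite invf_le1 ?exprn_ege1// exprn_gt0// (lt_le_trans _ e1).
Qed.

End schwartz_on_cone.

(** * Density of Schwartz functions *)

Section schwartz_density.
Context {R : realType} {d : nat} {Om Omh : convexCone R d}.
Variables (mu : {measure set Om -> \bar R}) (muh : {measure set Omh -> \bar R}).
Variables (K : Om -> Omh -> R[i]) (U : (Om -> R[i]) -> (Omh -> R[i])).
Hypothesis U_plancherel : plancherel mu muh K U.
Hypothesis schwartz_L2 : forall f : Om -> R[i], schwartz_on f -> inL2 mu f.

Let uU : unitaryL2 mu muh U. Proof. by case: U_plancherel => _ []. Qed.

Lemma unitary_rip f g : inL2 mu f -> inL2 mu g -> rip muh (U f) (U g) = rip mu f g.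
Proof. by move=> Hf Hg; rewrite -!Re_innerL2 (unitary_inner uU). Qed.

(* Composing U with the reflection along h gives a unitary extension, which
   by uniqueness coincides with U. *)
Lemma schwartz_orthogonal h : inL2 mu h ->
  (forall psi, schwartz_on psi -> rip mu psi h = 0) -> ae_equal mu h (fun=> 0).
Proof.
move=> Hh oh; apply: rip_eq0 => //; apply/eqP; apply: contraT => n0.
set n := rip mu h h in n0.
have H0 : inL2 mu (fun=> 0) by exact: inL2_0.
(* [r] is 2 / |h|^2, so that [W f] below is f - (2 <f, h> / |h|^2) h: an involution that preserves
   inner products and fixes the Schwartz functions, which are orthogonal to h. *)
have [r rJ two] : exists2 r : R[i], conjc r = r & r * n%:C%C = 2.
  exists (2 / n)%:C%C; first exact: conjc_real.
  by apply: complex_ext; rewrite !ReImE /=; field.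
pose c f : R[i] := innerL2 mu f h * r.
pose W f : Om -> R[i] := fun x => - c f * h x + f x.
have nn : innerL2 mu h h = n%:C%C by rewrite innerL2_norm.
have nC : (n%:C%C : R[i]) != 0 by rewrite eq_complex /= (negbTE n0).
have HW f : inL2 mu f -> inL2 mu (W f) by move=> Hf; exact: inL2_cZD.
have c_ae f g : inL2 mu f -> inL2 mu g -> ae_equal mu f g -> c f = c g.
  by move=> Hf Hg fg; rewrite /c (eq_innerL2 Hf Hg Hh fg).
have cZD k f g : inL2 mu f -> inL2 mu g -> c (fun x => k * f x + g x) = k * c f + c g.
  by move=> Hf Hg; rewrite /c innerL2ZDl// mulrDl mulrA.

have ch : c h = 2 by rewrite /c nn mulrC two.
have cW f : inL2 mu f -> c (W f) = - c f.
  by move=> Hf; rewrite /W cZD// ch; ring.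
have WW f : inL2 mu f -> W (W f) = f.
  by move=> Hf; apply/funext => x; rewrite {1}/W cW// /W; ring.
(* The hypothesis gives the real part of <psi, h>; applied to i psi, again a Schwartz function, it
   gives the imaginary part. *)
have cs psi : schwartz_on psi -> c psi = 0.
  move=> spsi; rewrite /c (_ : innerL2 mu psi h = 0) ?mul0r//.
  apply: complex_ext; first by rewrite Re_innerL2 oh.
  have := oh _ (schwartz_on_mulI spsi); rewrite -Re_innerL2.
  have Hpsi := schwartz_L2 spsi.
  have := innerL2ZDl 'i%C Hpsi H0 Hh; rewrite innerL2_0l addr0.
  rewrite (_ : (fun x => _) = (fun x => 'i%C * psi x)); last first.
    by apply/funext => x; rewrite addr0.
  by move=> ->; rewrite cReM /= mul0r mul1r sub0r => /eqP; rewrite oppr_eq0 => /eqP.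
have uV : unitary_extension mu muh K (fun f => U (W f)).
  split; last first.
    move=> psi spsi; rewrite (_ : W psi = psi); last first.
      by apply/funext => x; rewrite /W cs// oppr0 mul0r add0r.
    by case: U_plancherel => _ [_ H] _; exact: H.
  split.
  - by move=> f Hf; apply: (unitary_inL2 uU); exact: HW.
  - move=> f g Hf Hg fg; apply: (unitary_ae uU); try exact: HW.
    by rewrite /W (c_ae _ _ Hf Hg fg); apply: filterS fg => x ->.
  - move=> k f g Hf Hg.
    rewrite (_ : W (fun x => k * f x + g x) = (fun x => k * W f x + W g x)).
      by apply: (unitary_linear uU); exact: HW.
    by apply/funext => x; rewrite /W cZD//; ring.
  - move=> f g Hf Hg; rewrite (unitary_inner uU); try exact: HW.
    rewrite /W innerL2ZDl//; last exact: HW.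
    rewrite !innerL2ZDr// nn (innerL2J Hg Hh) /c.
    move: (innerL2 mu f h) (innerL2 mu g h) => x y.
    rewrite !rmorphN !rmorphM/= rJ -[RHS]add0r addrA; congr (_ + _).
    have e : x * r * (conjc y * r) * n%:C%C = 2 * (x * conjc y * r).
      by rewrite -two; ring.
    transitivity (x * r * (conjc y * r) * n%:C%C - 2 * (x * conjc y * r)); first by ring.
    by rewrite e subrr.
  - move=> g Hg; have [f Hf fg] := unitary_onto uU Hg.
    by exists (W f); [exact: HW|rewrite WW].
(* Since W h = - h, uniqueness says that U (- h) = U h; pairing with U h gives - |h|^2 = |h|^2. *)
have := (let: And3 _ _ u := U_plancherel in u) _ uV h Hh.
rewrite (_ : W h = (fun x => -1 * h x + (fun=> 0) x)); last first.
  by apply/funext => x; rewrite /W ch; ring.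
have HN : inL2 mu (fun x => -1 * h x + (fun=> 0) x) by exact: inL2_cZD.
move=> e1.
have : rip muh (U (fun x => -1 * h x + (fun=> 0) x)) (U h) = rip muh (U h) (U h).
  apply: eq_rip => //; try exact: (unitary_inL2 uU).
  by apply: aeW.
rewrite !unitary_rip// -Re_innerL2 innerL2ZDl// nn.
by rewrite innerL2_0l !ReImE /= -/n => e2; exfalso; move/eqP: n0; apply; lra.
Qed.

End schwartz_density.

(** * The adjoint transform *)

Section complex_integrable.
Context {R : realType} {dT} {T : measurableType dT}.
Variable mu : {measure set T -> \bar R}.
Implicit Types f g : T -> R[i].

Lemma normcJ (z : R[i]) : Normc.normc (conjc z) = Normc.normc z.
Proof. by case: z => x y /=; rewrite sqrrN. Qed.

Lemma normc_real (r : R) : Normc.normc (r%:C%C) = `|r|.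
Proof. by rewrite /= expr0n /= addr0 sqrtr_sqr. Qed.

Lemma cmeasurableM f g : cmeasurable f -> cmeasurable g ->
  cmeasurable (fun x => f x * g x).
Proof.
move=> [f1 f2] [g1 g2]; split.
  under eq_fun do rewrite cReM.
  by apply: measurable_funB; exact: measurable_funM.
under eq_fun do rewrite cImM.
by apply: measurable_funD; exact: measurable_funM.
Qed.

Lemma cmeasurableJ f : cmeasurable f -> cmeasurable (fun x => conjc (f x)).
Proof.
move=> [f1 f2]; split; first by under eq_fun do rewrite cReJ.
by under eq_fun do rewrite cImJ; exact: measurable_funN.
Qed.

Lemma cmeasurableR (r : T -> R) : measurable_fun setT r ->
  cmeasurable (fun x => (r x)%:C%C).
Proof. by split => //=; exact: measurable_cst. Qed.

Lemma cmeasurable_normc f : cmeasurable f ->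
  measurable_fun setT (fun x => Normc.normc (f x)).
Proof.
move=> mf; rewrite (_ : (fun _ => _) = (fun x => Num.sqrt (cdot (f x) (f x)))).
  apply: (@measurableT_comp _ _ _ _ _ _ (@Num.sqrt R)); last exact: measurable_cdot.
  by apply: continuous_measurable_fun; exact: sqrt_continuous.
by apply/funext => x; rewrite -sqr_normcE sqrtr_sqr ger0_norm ?normc_ge0.
Qed.

Lemma inL1_le f (g : T -> R) : cmeasurable f -> mu.-integrable setT (EFin \o g) ->
  (forall x, Normc.normc (f x) <= g x) -> inL1 mu f.
Proof.
move=> [f1 f2] Ig fg; split.
  apply: (le_integrable measurableT _ _ Ig); first exact/measurable_EFinP.
  move=> x _; rewrite lee_fin (le_trans (normc_Re _))//.
  by rewrite (le_trans (fg x))// ler_norm.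
apply: (le_integrable measurableT _ _ Ig); first exact/measurable_EFinP.
move=> x _; rewrite lee_fin (le_trans (normc_Im _))//.
by rewrite (le_trans (fg x))// ler_norm.
Qed.

Lemma inL2_le f (g : T -> R) : cmeasurable f -> mu.-integrable setT (EFin \o g) ->
  (forall x, Normc.normc (f x) ^+ 2 <= g x) -> inL2 mu f.
Proof.
move=> mf Ig fg; apply: integrable_inL2 => //.
apply: (le_integrable measurableT _ _ Ig).
  by apply/measurable_EFinP; exact: measurable_cdot.
move=> x _; rewrite lee_fin ger0_norm ?cdot_ge0// -sqr_normcE.
by rewrite (le_trans (fg x))// ler_norm.
Qed.

Lemma inL2_normc_integrable f : inL2 mu f ->
  mu.-integrable setT (EFin \o (fun x => Normc.normc (f x) ^+ 2)).
Proof.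
move=> Hf; have := inL2_integrable Hf Hf.
by apply: eq_integrable => // x _ /=; rewrite sqr_normcE.
Qed.

Lemma inL1_J f : inL1 mu f -> inL1 mu (fun x => conjc (f x)).
Proof.
move=> [f1 f2]; split; first by apply: eq_integrable f1 => // x _; rewrite cReJ.
have := integrableN f2.
by apply: eq_integrable => // x _; rewrite cImJ.
Qed.

Definition crestrict (A : set T) (f : T -> R[i]) : T -> R[i] :=
  fun x => (\1_A x)%:C%C * f x.

Lemma crestrict_in A f x : A x -> crestrict A f x = f x.
Proof. by move=> Ax; rewrite /crestrict indicE mem_set// mul1r. Qed.

Lemma crestrict_out A f x : ~ A x -> crestrict A f x = 0.
Proof. by move=> Ax; rewrite /crestrict indicE memNset// mul0r. Qed.

Lemma normc_crestrict A f x : Normc.normc (crestrict A f x) <= Normc.normc (f x).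
Proof.
have [Ax|Ax] := pselect (A x); first by rewrite crestrict_in.
by rewrite crestrict_out// Normc.normc0 normc_ge0.
Qed.

Lemma cmeasurable_crestrict A f : measurable A -> cmeasurable f ->
  cmeasurable (crestrict A f).
Proof.
by move=> mA mf; apply: cmeasurableM => //; apply: cmeasurableR; exact: measurable_indic.
Qed.

Lemma inL2_crestrict A f : measurable A -> inL2 mu f -> inL2 mu (crestrict A f).
Proof.
move=> mA Hf; apply: inL2_le (inL2_normc_integrable Hf) _.
  by apply: cmeasurable_crestrict => //; case: Hf.
by move=> x /=; rewrite lerXn2r ?nnegrE ?normc_ge0// normc_crestrict.
Qed.

End complex_integrable.

(** * Measurability and growth of kernel slices *)

Section kernel_bounds.
Context {R : realType} {d : nat} {Om Omh : convexCone R d}.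
Variable muh : {measure set Omh -> \bar R}.
Variables (m mh : R) (K : Om -> Omh -> R[i]).
Hypothesis K_continuous : continuous_kernel K.
Hypothesis K_bounded : polynomially_bounded_kernel m mh K.
Local Notation cx := (fun x : Om => 1 + enorm (cone_val x)).
Local Notation cxi := (fun xi : Omh => 1 + enorm (cone_val xi)).

Lemma measurable_kernel1 x : cmeasurable (K x).
Proof.
have [c1 c2] := continuous_kernel_ReIm K_continuous.
have h1 := measurableT_comp (continuous_measurable_cone_prod c1) (measurable_pair1 x).
have h2 := measurableT_comp (continuous_measurable_cone_prod c2) (measurable_pair1 x).
by split; [exact: h1|exact: h2].
Qed.

Lemma measurable_kernel2 xi : cmeasurable (K ^~ xi).
Proof.
have [c1 c2] := continuous_kernel_ReIm K_continuous.
have h1 := measurableT_comp (continuous_measurable_cone_prod c1) (measurable_pair2 xi).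
have h2 := measurableT_comp (continuous_measurable_cone_prod c2) (measurable_pair2 xi).
by split; [exact: h1|exact: h2].
Qed.

Lemma cmeasurable_kernel : cmeasurable (fun p : Om * Omh => K p.1 p.2).
Proof.
have [c1 c2] := continuous_kernel_ReIm K_continuous.
by split; exact: continuous_measurable_cone_prod.
Qed.

Lemma cmeasurable_fst (f : Om -> R[i]) : cmeasurable f ->
  cmeasurable (fun p : Om * Omh => f p.1).
Proof.
move=> [f1 f2]; have h1 := measurableT_comp f1 (@measurable_fst _ _ Om Omh).
have h2 := measurableT_comp f2 (@measurable_fst _ _ Om Omh).
by split; [exact: h1|exact: h2].
Qed.

Lemma cmeasurable_snd (f : Omh -> R[i]) : cmeasurable f ->
  cmeasurable (fun p : Om * Omh => f p.2).
Proof.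
move=> [f1 f2]; have h1 := measurableT_comp f1 (@measurable_snd _ _ Om Omh).
have h2 := measurableT_comp f2 (@measurable_snd _ _ Om Omh).
by split; [exact: h1|exact: h2].
Qed.

Lemma cx_ge1 x : 1 <= cx x. Proof. by rewrite lerDl enorm_ge0. Qed.

Lemma kernel_bound : exists2 c : R, 0 <= c & forall x xi,
  Normc.normc (K x xi) <= c * cx x `^ m * cxi xi `^ mh.
Proof.
have [c Hc] := K_bounded; exists `|c| => // x xi; apply: le_trans (Hc x xi) _.
by rewrite -!mulrA ler_wpM2r ?ler_norm// mulr_ge0 ?powR_ge0.
Qed.

Lemma weighted_integrable (C : convexCone R d) (nu : {measure set C -> \bar R}) rho B :
  measurable B -> (weighted nu rho B < +oo)%E ->
  nu.-integrable setT
    (EFin \o (fun x : C => \1_B x * (1 + enorm (cone_val x)) `^ rho)).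
Proof.
move=> mB Boo.
have mw : measurable_fun setT (fun x : C => (1 + enorm (cone_val x)) `^ rho).
  apply: (@measurableT_comp _ _ _ _ _ _ (fun r : R => r `^ rho)).
    exact: measurable_powR.
  by apply: measurable_funD => //; exact: measurable_enorm_cone.
apply/integrableP; split.
  apply/measurable_EFinP; apply: measurable_funM => //; exact: measurable_indic.
apply: le_lt_trans Boo; rewrite /weighted [leRHS]integral_mkcond.
apply: ge0_le_integral => //.
- apply: measurableT_comp => //; apply/measurable_EFinP.
  by apply: measurable_funM => //; exact: measurable_indic.
- apply/(measurable_restrictT _ _).1 => //; apply: measurable_funTS.
  exact/measurable_EFinP.
move=> x _ /=; rewrite patchE indicE; case: ifPn => _; last by rewrite mul0r normr0.
by rewrite mul1r ger0_norm ?powR_ge0.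
Qed.

Section supported.
Variables (g : Omh -> R[i]) (B : set Omh).
Hypothesis B_measurable : measurable B.
Hypothesis B_finite : (weighted muh (2 * mh) B < +oo)%E.
Hypothesis g_L2 : inL2 muh g.
Hypothesis g_supp : forall xi, ~ B xi -> g xi = 0.

(** On B one has |g| w <= |g|^2 + w^2 with w = (1 + |xi|)^mh, and w^2 is integrable over B exactly
    because B has finite measure for the weight of exponent 2 mh. *)
Lemma weighted_L1 :
  muh.-integrable setT (EFin \o (fun xi => Normc.normc (g xi) * cxi xi `^ mh)).
Proof.
have mg : cmeasurable g by case: g_L2.
have mw : measurable_fun setT (fun xi : Omh => cxi xi `^ mh).
  apply: (@measurableT_comp _ _ _ _ _ _ (fun r : R => r `^ mh)).
    exact: measurable_powR.
  by apply: measurable_funD => //; exact: measurable_enorm_cone.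
have I := integrableD measurableT (inL2_normc_integrable g_L2)
  (weighted_integrable B_measurable B_finite).
apply: (le_integrable measurableT _ _ I).
  by apply/measurable_EFinP; apply: measurable_funM => //; exact: cmeasurable_normc.
move=> xi _; rewrite /= lee_fin ger0_norm ?mulr_ge0 ?normc_ge0 ?powR_ge0//.
apply: le_trans (ler_norm _).
have [Bx|Bx] := pselect (B xi); last first.
  by rewrite g_supp// Normc.normc0 mul0r addr_ge0 ?sqr_ge0// mulr_ge0 ?powR_ge0.
rewrite indicE mem_set// mul1r mulrC [2 * mh]mulrC powRrM powR_mulrn ?powR_ge0//.
have := sqr_ge0 (Normc.normc (g xi) - cxi xi `^ mh).
set u := Normc.normc _; set v := _ `^ _ => h.
have : 0 <= u ^+ 2 by exact: sqr_ge0.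
have : 0 <= v ^+ 2 by exact: sqr_ge0.
nra.
Qed.

(** The formal adjoint of [transform]; since U is unitary, it is the candidate for its inverse on
    functions supported on B. *)
Definition dual_transform (x : Om) : R[i] :=
  cintegral muh (fun xi => g xi * conjc (K x xi)).

Lemma dual_slice_inL1 x : inL1 muh (fun xi => g xi * conjc (K x xi)).
Proof.
have [c c0 Hc] := kernel_bound.
apply: inL1_le (integrableZl measurableT (c * cx x `^ m) weighted_L1) _ => [|xi].
  apply: cmeasurableM; first by case: g_L2.
  by apply: cmeasurableJ; exact: measurable_kernel1.
rewrite Normc.normcM normcJ.
rewrite [leRHS](_ : _ = Normc.normc (g xi) * (c * cx x `^ m * cxi xi `^ mh)); last by rewrite mulrCA.
by rewrite ler_wpM2l ?normc_ge0.
Qed.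

End supported.
End kernel_bounds.

Section dual_transform.
Context {R : realType} {d : nat} {Om Omh : convexCone R d}.
Variables (mu : {measure set Om -> \bar R}) (muh : {measure set Omh -> \bar R}).
Variables (a : R) (Q Qh : 'rV[R]_d -> R) (m mh : R) (K : Om -> Omh -> R[i]).
Hypothesis Q_density : polar_density Q.
Hypothesis Qh_density : polar_density Qh.
Hypothesis mu_polar : polar_decomposition mu a Q.
Hypothesis muh_polar : polar_decomposition muh a Qh.
Hypothesis a_gt0 : 0 < a.
Hypothesis K_continuous : continuous_kernel K.
Hypothesis K_bounded : polynomially_bounded_kernel m mh K.
Local Notation cx := (fun x : Om => 1 + enorm (cone_val x)).
Local Notation cxi := (fun xi : Omh => 1 + enorm (cone_val xi)).
Variables (g : Omh -> R[i]) (B : set Omh).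
Hypothesis B_measurable : measurable B.
Hypothesis B_finite : (weighted muh (2 * mh) B < +oo)%E.
Hypothesis g_L2 : inL2 muh g.
Hypothesis g_supp : forall xi, ~ B xi -> g xi = 0.

Let G := dual_transform muh K g.

Let gw xi : R := Normc.normc (g xi) * cxi xi `^ mh.

Let gw_int : muh.-integrable setT (EFin \o gw).
Proof. exact: weighted_L1 B_measurable B_finite g_L2 g_supp. Qed.

Let gw_ge0 xi : 0 <= gw xi.
Proof. by rewrite mulr_ge0 ?normc_ge0 ?powR_ge0. Qed.

Let slice_inL1 x : inL1 muh (fun xi => g xi * conjc (K x xi)).
Proof. exact: (dual_slice_inL1 K_continuous K_bounded B_measurable B_finite g_L2 g_supp). Qed.

Lemma powR_cone_le (C : convexCone R d) (x : C) (r : R) (n : nat) : r <= n%:R ->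
  (1 + enorm (cone_val x)) `^ r <= (1 + enorm (cone_val x)) ^+ n.
Proof.
move=> rn; have e1 : 1 <= 1 + enorm (cone_val x) by rewrite lerDl enorm_ge0.
by rewrite -powR_mulrn ?(le_trans _ e1)// ler_powR.
Qed.

(** Real and imaginary parts are bounded separately, whence the factor 2. *)
Lemma normc_cintegral_le dT (T : measurableType dT) (nu : {measure set T -> \bar R})
    (f : T -> R[i]) (u : T -> R) : inL1 nu f -> nu.-integrable setT (EFin \o u) ->
  (forall x, Normc.normc (f x) <= u x) ->
  Normc.normc (cintegral nu f) <= 2 * Rintegral nu setT u.
Proof.
move=> [f1 f2] Iu fu; rewrite mulr_natl mulr2n; apply: (le_trans (normc_ReIm _)).
apply: lerD => /=.
  apply: (le_trans (le_normr_Rintegral measurableT f1)).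
  apply: le_Rintegral => //; first exact: integrable_norm.
  by move=> x _; rewrite (le_trans (normc_Re _)).
apply: (le_trans (le_normr_Rintegral measurableT f2)).
apply: le_Rintegral => //; first exact: integrable_norm.
by move=> x _; rewrite (le_trans (normc_Im _)).
Qed.

Lemma dual_transform_bound : exists2 C : R, 0 <= C &
  forall x, Normc.normc (G x) <= C * cx x `^ m.
Proof.
have [c c0 Hc] := kernel_bound K_bounded.
have I0 : 0 <= Rintegral muh setT gw by apply: Rintegral_ge0 => xi _; exact: gw_ge0.
exists (2 * (c * Rintegral muh setT gw)) => [|x]; first by rewrite mulr_ge0// mulr_ge0.
have Iu : muh.-integrable setT (EFin \o (fun xi => (c * cx x `^ m) * gw xi)).
  have := integrableZl measurableT (c * cx x `^ m) gw_int.
  by apply: eq_integrable => // xi _ /=; rewrite EFinM.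
apply: (le_trans (normc_cintegral_le (slice_inL1 x) Iu _)) => [xi|].
  rewrite Normc.normcM normcJ /gw.
  rewrite [leRHS](_ : _ = Normc.normc (g xi) * (c * cx x `^ m * cxi xi `^ mh)); last by rewrite mulrCA.
  by rewrite ler_wpM2l ?normc_ge0.
rewrite RintegralZl//.
by rewrite le_eqVlt; apply/orP; left; apply/eqP; ring.
Qed.

(** The integrand whose two iterated integrals are the real parts of <u, G> and of <T u, g>. *)
Let joint (u : Om -> R[i]) (p : Om * Omh) : R :=
  complex.Re (u p.1 * K p.1 p.2 * conjc (g p.2)).

Let joint_measurable u : cmeasurable u -> measurable_fun setT (joint u).
Proof.
move=> mu1.
have := cmeasurableM (cmeasurableM (cmeasurable_fst (Omh := Omh) mu1)
  (cmeasurable_kernel K_continuous))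
  (cmeasurable_snd (Om := Om) (cmeasurableJ g_L2.1)).
by case.
Qed.

Let joint_le u (v : Om -> R) c : 
  (forall x xi, Normc.normc (K x xi) <= c * cx x `^ m * cxi xi `^ mh) ->
  (forall x, Normc.normc (u x) * (c * cx x `^ m) <= v x) ->
  forall x xi, `|joint u (x, xi)| <= v x * gw xi.
Proof.
move=> Hc uv x xi; apply: (le_trans (normc_Re _)); rewrite !Normc.normcM normcJ /=.
apply: (@le_trans _ _ (Normc.normc (u x) * (c * cx x `^ m) * gw xi)); last by rewrite ler_wpM2r.
rewrite /gw -!mulrA ler_wpM2l ?normc_ge0//.
rewrite [leRHS](_ : _ = c * cx x `^ m * cxi xi `^ mh * Normc.normc (g xi)); last by ring.
by rewrite ler_wpM2r ?normc_ge0.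
Qed.

Let sf1 := polar_sigma_finite Q_density mu_polar a_gt0.
Let sf2 := polar_sigma_finite Qh_density muh_polar a_gt0.

(* The weight (1 + |x|) ^ m is what Fubini's theorem costs against K. *)
Definition kernel_integrable (u : Om -> R[i]) : Prop :=
  cmeasurable u /\ exists2 v : Om -> R, mu.-integrable setT (EFin \o v) &
    forall x, Normc.normc (u x) * cx x `^ m <= v x.

Section joint.
Variable u : Om -> R[i].
Hypothesis u_int : kernel_integrable u.

Let dominated : exists v : Om -> R, [/\ mu.-integrable setT (EFin \o v),
  forall x, 0 <= v x & forall x xi, `|joint u (x, xi)| <= v x * gw xi].
Proof.
have [c c0 Hc] := kernel_bound K_bounded.
have [mu1 [v Iv uv]] := u_int.
have v0 x : 0 <= v x.
  by apply: le_trans (uv x); rewrite mulr_ge0 ?normc_ge0 ?powR_ge0.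
exists (fun x => c * v x); split => [|x|].
- have := integrableZl measurableT c Iv.
  by apply: eq_integrable => // x _ /=; rewrite EFinM.
- by rewrite mulr_ge0.
apply: (joint_le Hc) => x.
by rewrite mulrCA ler_wpM2l.
Qed.

Lemma dual_transform_pairing x :
  Rintegral muh setT (fun xi => joint u (x, xi)) = complex.Re (u x * conjc (G x)).
Proof.
rewrite /G /dual_transform -cintegralJ// -cintegralZ; last exact: inL1_J.
by apply: eq_Rintegral => xi _; rewrite /joint/= rmorphM/= conjcK mulrCA mulrA mulrC mulrA.
Qed.

Lemma kernel_slice_inL1 xi : inL1 mu (fun x => u x * K x xi).
Proof.
have [c c0 Hc] := kernel_bound K_bounded.
have [mu1 [v Iv uv]] := u_int.
apply: inL1_le (integrableZl measurableT (c * cxi xi `^ mh) Iv) _ => [|x].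
  by apply: cmeasurableM => //; exact: measurable_kernel2.
rewrite Normc.normcM; apply: (@le_trans _ _ (Normc.normc (u x) * (c * cx x `^ m * cxi xi `^ mh))).
  by rewrite ler_wpM2l ?normc_ge0.
rewrite [leLHS](_ : _ = c * cxi xi `^ mh * (Normc.normc (u x) * cx x `^ m)); last by ring.
by rewrite ler_wpM2l ?mulr_ge0 ?powR_ge0.
Qed.

Lemma transform_pairing xi : Rintegral mu setT (fun x => joint u (x, xi)) =
  complex.Re (transform mu K u xi * conjc (g xi)).
Proof.
rewrite /transform mulrC -cintegralZ; last exact: kernel_slice_inL1.
by apply: eq_Rintegral => x _; rewrite /joint/= mulrC.
Qed.

Lemma dual_pairing_integrable :
  mu.-integrable setT (fun x => (complex.Re (u x * conjc (G x)))%:E).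
Proof.
have [v [Iv v0 Hv]] := dominated.
have := Rintegral_fubini_integrable sf1 sf2 (joint_measurable u_int.1) Iv gw_int v0 gw_ge0 Hv.
by apply: eq_integrable => // x _; rewrite dual_transform_pairing.
Qed.

Lemma transform_pairing_measurable :
  measurable_fun setT (fun xi => complex.Re (transform mu K u xi * conjc (g xi))).
Proof.
have [v [Iv v0 Hv]] := dominated.
have := Rintegral_fubini_measurable2 sf1 sf2 (joint_measurable u_int.1) Iv gw_int v0 gw_ge0 Hv.
by under eq_fun do rewrite transform_pairing.
Qed.

Lemma transform_duality :
  Rintegral mu setT (fun x => complex.Re (u x * conjc (G x))) =
  Rintegral muh setT (fun xi => complex.Re (transform mu K u xi * conjc (g xi))).
Proof.
have [v [Iv v0 Hv]] := dominated.
under eq_Rintegral do rewrite -dual_transform_pairing.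
under [RHS]eq_Rintegral do rewrite -transform_pairing.
exact: (Rintegral_fubini sf1 sf2 (joint_measurable u_int.1) Iv gw_int v0 gw_ge0 Hv).
Qed.

End joint.

(** M powers of the decay pay for the weight (1 + |x|)^m; the remaining k, more than 2a, leave an
    integrable function. *)
Lemma kernel_integrable_decay (u : Om -> R[i]) (M k : nat) (C : R) :
  m <= M%:R -> 2 * a < k%:R -> cmeasurable u ->
  (forall x, Normc.normc (u x) <= C * cx x ^- (M + k)) -> kernel_integrable u.
Proof.
move=> mM ak mu1 uC; split => //.
exists (fun x => C * cx x ^- k) => [|x].
  have := integrableZl measurableT C (integrable_weight Q_density mu_polar a_gt0 ak).
  by apply: eq_integrable => // x _ /=; rewrite EFinM.
have e0 : 0 < cx x by rewrite (lt_le_trans _ (cx_ge1 x)).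
apply: (@le_trans _ _ (C * cx x ^- (M + k) * cx x ^+ M)).
  apply: ler_pM; rewrite ?normc_ge0 ?powR_ge0//; exact: powR_cone_le.
rewrite exprD invfM [_^-1 * _]mulrC -!mulrA mulVf ?mulr1//.
by rewrite expf_neq0// gt_eqF.
Qed.

Lemma measurable_cone_weight (C : convexCone R d) (n : nat) :
  measurable_fun setT (fun x : C => (1 + enorm (cone_val x)) ^- n).
Proof.
under eq_fun do rewrite -powR_invn ?addr_ge0 ?enorm_ge0//.
apply: (@measurableT_comp _ _ _ _ _ _ (fun r : R => r `^ (- n%:R))).
  exact: measurable_powR.
by apply: measurable_funD => //; exact: measurable_enorm_cone.
Qed.

(** G may grow polynomially, so Fubini's theorem is applied to its product with a decaying u. Taking
    u = r z with a positive weight [r], which is divided out afterwards, the choices z = 1 and z = i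
    yield the real and imaginary parts. *)
Lemma measurable_dual_transform : cmeasurable G.
Proof.
have [k ak] := weight_exponent a.
pose M := (Num.truncn m).+1.
have mM : m <= M%:R by rewrite ltW// truncnS_gt.
pose r (x : Om) : R := cx x ^- (M + k).
have mr : measurable_fun setT r by exact: measurable_cone_weight.
have r0 x : 0 < r x by rewrite invr_gt0 exprn_gt0// (lt_le_trans _ (cx_ge1 x)).
have key (z : R[i]) : Normc.normc z = 1 ->
    measurable_fun setT (fun x => complex.Re (z * conjc (G x))).
  move=> z1.
  have ku : kernel_integrable (fun x => (r x)%:C%C * z).
    apply: (@kernel_integrable_decay _ M k 1) => //.
      by apply: cmeasurableM; [exact: cmeasurableR|split; exact: measurable_cst].
    by move=> x; rewrite Normc.normcM normc_real z1 mulr1 mul1r gtr0_norm.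
  have /measurable_int/measurable_EFinP h := dual_pairing_integrable ku.
  rewrite (_ : (fun x => _) = (fun x => (r x)^-1 * complex.Re ((r x)%:C%C * z * conjc (G x)))).
    apply: measurable_funM => //.
    rewrite (_ : (fun x => _) = (fun x => cx x ^+ (M + k))); last by apply/funext => x; rewrite invrK.
    by apply: measurable_funX; apply: measurable_funD => //; exact: measurable_enorm_cone.
  by apply/funext => x; rewrite -mulrA [in RHS]cReM /= mul0r subr0 mulKf// gt_eqF.
split.
  have := key 1 (Normc.normc1 R); congr (measurable_fun _ _); apply/funext => x.
  by rewrite mul1r cReJ.
have ni : Normc.normc ('i%C : R[i]) = 1 by rewrite /= expr0n expr1n add0r sqrtr1.
by have := key _ ni; congr (measurable_fun _ _); apply/funext => x; rewrite !ReImE /=; ring.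
Qed.

End dual_transform.

(** * The inverse transform on functions supported on B *)

Section dual_representation.
Context {R : realType} {d : nat} {Om Omh : convexCone R d}.
Variables (mu : {measure set Om -> \bar R}) (muh : {measure set Omh -> \bar R}).
Variables (a : R) (Q Qh : 'rV[R]_d -> R) (m mh : R) (K : Om -> Omh -> R[i]).
Variable U : (Om -> R[i]) -> (Omh -> R[i]).
Hypothesis Q_density : polar_density Q.
Hypothesis Qh_density : polar_density Qh.
Hypothesis mu_polar : polar_decomposition mu a Q.
Hypothesis muh_polar : polar_decomposition muh a Qh.
Hypothesis a_gt0 : 0 < a.
Hypothesis K_continuous : continuous_kernel K.
Hypothesis K_bounded : polynomially_bounded_kernel m mh K.
Hypothesis U_plancherel : plancherel mu muh K U.
Local Notation cx := (fun x : Om => 1 + enorm (cone_val x)).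
Variables (g : Omh -> R[i]) (B : set Omh).
Hypothesis B_measurable : measurable B.
Hypothesis B_finite : (weighted muh (2 * mh) B < +oo)%E.
Hypothesis g_L2 : inL2 muh g.
Hypothesis g_supp : forall xi, ~ B xi -> g xi = 0.

Let G := dual_transform muh K g.
Let w (x : Om) : R := sweight (cone_val x).

Let schwartz_kernel_integrable psi : schwartz_on psi -> kernel_integrable mu m psi.
Proof.
move=> spsi; have [k ak] := weight_exponent a.
have mM : m <= (Num.truncn m).+1%:R by rewrite ltW// truncnS_gt.
have [C _ HC] := schwartz_on_decay ((Num.truncn m).+1 + k) spsi.
apply: (kernel_integrable_decay Q_density mu_polar a_gt0 mM ak _ HC).
exact: schwartz_on_measurable.
Qed.

Let schwartz_L2 (psi : Om -> R[i]) : schwartz_on psi -> inL2 mu psi.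
Proof. exact: (schwartz_on_inL2 Q_density mu_polar a_gt0). Qed.

(** The chain <psi, h> = <U psi, U h> = <T psi, g> = <psi, G>: unitarity, the formula for U on
    Schwartz functions, then Fubini. *)
Let pairing h psi : inL2 mu h -> ae_equal muh (U h) g -> schwartz_on psi ->
  rip mu psi h = Rintegral mu setT (fun x => complex.Re (psi x * conjc (G x))).
Proof.
move=> Hh Uh spsi; have Hpsi := schwartz_L2 spsi.
have kpsi := schwartz_kernel_integrable spsi.
have [_ [uU Us] _] := U_plancherel.
rewrite -(unitary_rip U_plancherel Hpsi Hh).
rewrite /G (transform_duality Q_density Qh_density mu_polar muh_polar a_gt0
  K_continuous K_bounded B_measurable B_finite g_L2 g_supp kpsi).
rewrite /rip /Rintegral; congr fine; apply: ae_eq_integral => //.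
- apply/measurable_EFinP; apply: measurable_cdot.
    by case: (unitary_inL2 uU Hpsi).
  by case: (unitary_inL2 uU Hh).
- apply/measurable_EFinP.
  exact: (transform_pairing_measurable Q_density Qh_density mu_polar muh_polar a_gt0
  K_continuous K_bounded B_measurable B_finite g_L2 g_supp kpsi).
apply: filterS2 (Us _ spsi) Uh => xi -> -> _.
by rewrite /cdot !ReImE mulrN opprK.
Qed.

Let w_le x : w x <= 2 * (cx x)^-1.
Proof.
have e0 := enorm_ge0 (cone_val x); rewrite /w /sweight.
have := sqr_ge0 (enorm (cone_val x) - 1).
set e := enorm (cone_val x) in e0 * => h.
rewrite ler_pdivlMr; last by rewrite ltr_pwDl.
rewrite ler_pdivrMl; last by rewrite ltr_pwDl ?sqr_ge0.
by nra.
Qed.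

Let w_ge0 x : 0 <= w x. Proof. exact: sweight_ge0. Qed.

Let measurable_w N : measurable_fun setT (fun x => w x ^+ N).
Proof.
apply: measurable_funX; rewrite /w /sweight.
have m1 : measurable_fun setT (fun x : Om => 1 + enorm (cone_val x) ^+ 2).
  apply: measurable_funD => //; apply: measurable_funX; exact: measurable_enorm_cone.
under eq_fun do rewrite -powR_inv1 ?addr_ge0 ?sqr_ge0//.
by apply: (@measurableT_comp _ _ _ _ _ _ (fun r : R => r `^ -1)).
Qed.

(** [pairing] says that h - G is orthogonal to Schwartz functions, but G is only known to grow at
    most like (1 + |x|)^m. Multiplication by [w ^+ N] brings the difference into L2 and keeps the
    orthogonality, because w^N psi is again a Schwartz function. Density then applies, and w > 0 can
    be cancelled. *)
Theorem dual_representation h : inL2 mu h -> ae_equal muh (U h) g ->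
  ae_equal mu h G.
Proof.
move=> Hh Uh; have [k ak] := weight_exponent a.
pose M := (Num.truncn m).+1; pose N := (M + k)%N.
have mM : m <= M%:R by rewrite ltW// truncnS_gt.
have mG : cmeasurable G.
  exact: (measurable_dual_transform Q_density Qh_density mu_polar muh_polar a_gt0
  K_continuous K_bounded B_measurable B_finite g_L2 g_supp).
have [C C0 HC] : exists2 C : R, 0 <= C & forall x, Normc.normc (G x) <= C * cx x `^ m.
  exact: (dual_transform_bound K_continuous K_bounded B_measurable B_finite g_L2 g_supp).
have wN0 x : 0 <= w x ^+ N by rewrite exprn_ge0 ?w_ge0.
have HwG : inL2 mu (fun x => (w x ^+ N)%:C%C * G x).
  have I := integrableZl measurableT ((2 ^+ N * C) ^+ 2)
    (integrable_weight Q_density mu_polar a_gt0 ak).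
  apply: inL2_le I _ => [|x]; last cbv beta.
    by apply: cmeasurableM => //; exact: cmeasurableR.
  have e1 := cx_ge1 x; have e0 : 0 < cx x by rewrite (lt_le_trans _ e1).
  have ek0 : 0 <= cx x ^- k by rewrite invr_ge0 exprn_ge0// (ltW e0).
  apply: (@le_trans _ _ ((2 ^+ N * C * cx x ^- k) ^+ 2)); last first.
    rewrite exprMn ler_wpM2l ?sqr_ge0// expr2 ler_piMl//.
    by rewrite invf_le1 ?exprn_ege1// exprn_gt0.
  rewrite lerXn2r ?nnegrE ?normc_ge0//; first by rewrite !mulr_ge0 ?exprn_ge0.
  rewrite Normc.normcM normc_real ger0_norm//.
  apply: (@le_trans _ _ ((2 * (cx x)^-1) ^+ N * (C * cx x ^+ M))).
    apply: ler_pM; rewrite ?normc_ge0//.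
      by rewrite lerXn2r ?nnegrE ?w_le ?w_ge0 ?mulr_ge0 ?invr_ge0 ?(ltW e0).
    by apply: (le_trans (HC x)); rewrite ler_wpM2l// powR_cone_le.
  rewrite exprMn exprVn.
  have eN : cx x ^+ N = cx x ^+ M * cx x ^+ k by exact: exprD.
  have eM0 : cx x ^+ M != 0 by rewrite expf_neq0// gt_eqF.
  have ek1 : cx x ^+ k != 0 by rewrite expf_neq0// gt_eqF.
  rewrite eN; move: (cx x ^+ M) (cx x ^+ k) eM0 ek1 (2 ^+ N) => A D A0 D0 q.
  by rewrite le_eqVlt; apply/orP; left; apply/eqP; field; rewrite D0 A0.
have Hwh : inL2 mu (fun x => (w x ^+ N)%:C%C * h x).
  apply: inL2_le (inL2_normc_integrable Hh) _ => [|x]; last cbv beta.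
    by apply: cmeasurableM; [exact: cmeasurableR|case: Hh].
  rewrite lerXn2r ?nnegrE ?normc_ge0// Normc.normcM normc_real ger0_norm//.
  by rewrite ler_piMl ?normc_ge0// exprn_ile1// sweight_le1.
have HH := inL2_cZD (-1) HwG Hwh.
have : ae_equal mu (fun x => -1 * ((w x ^+ N)%:C%C * G x) + (w x ^+ N)%:C%C * h x) (fun=> 0).
  apply: (schwartz_orthogonal U_plancherel schwartz_L2 HH) => psi spsi.
  have swpsi := schwartz_on_mul_weight N spsi.
  have kw := schwartz_kernel_integrable swpsi.
  have := pairing Hh Uh swpsi => /eqP; rewrite -subr_eq0 => /eqP <-.
  rewrite /rip -RintegralB//; first last.
  - exact: (dual_pairing_integrable Q_density Qh_density mu_polar muh_polar a_gt0
      K_continuous K_bounded B_measurable B_finite g_L2 g_supp kw).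
  - by apply: inL2_integrable => //; exact: schwartz_L2.
  apply: eq_Rintegral => x _; rewrite /cdot !ReImE /= /w; ring.
apply: filterS => x; rewrite mulN1r addrC -mulrBr => /eqP.
rewrite mulf_eq0 => /orP[|]; last by rewrite subr_eq0 => /eqP.
rewrite eq_complex/= eqxx andbT expf_eq0 => /andP[_].
by rewrite gt_eqF// sweight_gt0.
Qed.

End dual_representation.

(** * Continuity of dilations in measure *)

Section measure_null_sequence.
Context {R : realType} {dT} {T : measurableType dT}.
Variable eta : {measure set T -> \bar R}.
Local Open Scope ereal_scope.

Definition null_sequence (u : nat -> \bar R) : Prop :=
  forall e : R, (0 < e)%R -> \forall n \near \oo, u n < e%:E.

Lemma null_sequence_le (u v : nat -> \bar R) : (forall n, u n <= v n) ->
  null_sequence v -> null_sequence u.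
Proof.
by move=> uv nv e /nv; apply: filterS => n; exact: le_lt_trans.
Qed.

Lemma null_sequenceD (u v : nat -> \bar R) :
  (forall n, 0 <= u n) -> (forall n, 0 <= v n) ->
  null_sequence u -> null_sequence v -> null_sequence (fun n => u n + v n).
Proof.
move=> u0 v0 nu nv e e0; have e2 : (0 < e / 2)%R by rewrite divr_gt0.
apply: filterS2 (nu _ e2) (nv _ e2) => n h1 h2.
rewrite (_ : e = e / 2 + e / 2)%R; last by rewrite -splitr.
by rewrite EFinD lteD.
Qed.

Lemma null_sequenceZ (c : R) (u : nat -> \bar R) :
  null_sequence u -> (0 < c)%R -> null_sequence (fun n => c%:E * u n).
Proof.
move=> nu c0 e e0; have ec : (0 < e / c)%R by rewrite divr_gt0.
apply: filterS (nu _ ec) => n h.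
have -> : e = (c * (e / c))%R by rewrite mulrCA divff ?mulr1// gt_eqF.
by rewrite EFinM lte_pmul2l// lte_fin.
Qed.

(** The sets [F n] of points met at some time k >= n decrease to the empty set inside a set of
    finite measure, so continuity from above applies. *)
Lemma measure_null_sequence (E : nat -> set T) (B : set T) :
  (forall n, measurable (E n)) -> measurable B -> eta B < +oo ->
  (forall n, E n `<=` B) -> (forall x, \forall n \near \oo, ~ E n x) ->
  null_sequence (fun n => eta (E n)).
Proof.
move=> mE mB Boo EB Ex.
pose F n := \bigcup_(k >= n) E k.
have mF n : measurable (F n) by apply: bigcup_measurable => k _.
have Foo : eta (F 0%N) < +oo.
  apply: le_lt_trans Boo; apply: le_measure; rewrite ?inE//.
  by move=> x [k _]; exact: EB.
have ndF : nonincreasing_seq F.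
  move=> n k nk; apply/subsetPset => x [j /= kj Ej]; exists j => //=.
  exact: leq_trans kj.
have F0 : \bigcap_n F n = set0.
  rewrite -subset0 => x Fx; have [N _ HN] := Ex x.
  by have [j /= Nj Ej] := Fx N I; exact: (HN j Nj).
have := nonincreasing_cvg_mu Foo mF _ ndF.
rewrite F0 measure0 => /(_ measurable0) cv e e0.
have e0' : 0 < e%:E by rewrite lte_fin.
have nb : \forall n \near \oo, eta (F n) < e%:E.
  exact: (cv (fun u => u < e%:E) (open_ereal_lt' e0')).
apply: filterS nb => n; apply: le_lt_trans; apply: le_measure; rewrite ?inE//.
by move=> x Ex'; exists n => /=.
Qed.

End measure_null_sequence.

Definition posinv {R : realType} (t : {posnum R}) : {posnum R} := (t%:num^-1)%:pos.

(** A range stable under inversion on which a single constant controls the effect of all dilations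
    on a weighted measure. *)
Definition near_unit {R : realType} (t : {posnum R}) : Prop := 2^-1 <= t%:num <= 2.

Lemma near_unitV {R : realType} (t : {posnum R}) : near_unit t -> near_unit (posinv t).
Proof.
move=> /andP[h1 h2]; apply/andP; split; first by rewrite lef_pV2 ?posrE.
by rewrite -[leRHS]invrK lef_pV2 ?posrE ?invr_gt0.
Qed.

Section dilation_continuity.
Context {R : realType} {d : nat} {Om : convexCone R d}.
Variable eta : {measure set Om -> \bar R}.
Hypothesis eta_ball : forall r, (eta (cone_ball r) < +oo)%E.
Variable c : R.
Hypothesis c_gt0 : 0 < c.

Hypothesis eta_dilate : forall t A, near_unit t -> measurable A ->
  (eta (dilate t @^-1` A) <= c%:E * eta A)%E.

Definition unit_sequence (t : nat -> {posnum R}) : Prop :=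
  (forall n, near_unit (t n)) /\ (fun n => (t n)%:num) @ \oo --> (1 : R).

Local Notation inv := posinv.

Lemma unit_sequenceV t : unit_sequence t -> unit_sequence (fun n => inv (t n)).
Proof.
move=> [tn t1]; split => [n|].
  exact: near_unitV.
rewrite -(invr1 R); apply: cvgV t1; exact: oner_neq0.
Qed.

Let measurable_dilate_preimage t (A : set Om) : measurable A ->
  measurable (dilate t @^-1` A).
Proof.
by move=> mA; rewrite -[X in measurable X]setTI; exact: measurable_dilate.
Qed.

(** The form is dictated by closure properties: quantification over all sequences t makes
    complements work, by inverting t, and the restriction to balls is there because complements have
    infinite measure in general. Such sets form a sigma-algebra. *)
Definition dilation_continuous (A : set Om) : Prop := measurable A /\
  forall t, unit_sequence t -> forall r,
    null_sequence (fun n => eta (cone_ball r `&` (A `\` dilate (t n) @^-1` A))).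

Let mE (r : R) (A : set Om) (t : nat -> {posnum R}) n : measurable A ->
  measurable (cone_ball r `&` (A `\` dilate (t n) @^-1` A)).
Proof.
move=> mA; apply: measurableI; first exact: measurable_cone_ball.
by apply: measurableD => //; exact: measurable_dilate_preimage.
Qed.

(** A point of an open set stays in it under all dilations close to 1, so each point is eventually
    outside the difference. *)
Lemma dilation_continuous_open (A : set Om) : open A -> dilation_continuous A.
Proof.
move=> oA; have mA : measurable A by exact: sub_sigma_algebra.
split => // t [tn t1] r.
apply: (@measure_null_sequence _ _ _ _ _ (cone_ball r)) => //.
- by move=> n; exact: mE.
- exact: measurable_cone_ball.
move=> x; have [Ax|Ax] := pselect (A x); last first.
  by near=> n => -[_ []].
case: oA Ax => V oV <- /= Vx.
have cv1 : (fun n => (t n)%:num *: cone_val x) @ \oo --> cone_val x.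
  by rewrite -[X in _ --> X]scale1r; exact: cvgZr_tmp.
have nV : \forall n \near \oo, V ((t n)%:num *: cone_val x).
  exact: (cv1 V (open_nbhs_nbhs (conj oV Vx))).
by apply: filterS nV => n Vn [_ [_]]; apply.
Unshelve. all: by end_near. Qed.

(** If x is outside A while t x is in A, then t x is a point of A that the inverse dilation moves
    out. The set for the complement and t is thus contained in a dilated copy of the set for A and
    1/t, in a ball of twice the radius since t <= 2. *)
Lemma dilation_continuousC A : dilation_continuous A -> dilation_continuous (~` A).
Proof.
move=> [mA hA]; split; first exact: measurableC.
move=> t tu r; have su := unit_sequenceV tu.
have := null_sequenceZ (hA _ su (2 * r)) c_gt0.
apply: null_sequence_le => n.
apply: le_trans (eta_dilate (tu.1 n) (mE (2 * r) (fun n => inv (t n)) n mA)).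
apply: le_measure; rewrite ?inE.
- by apply: mE; exact: measurableC.
- apply: measurable_dilate_preimage; exact: (mE _ (fun n => inv (t n)) n mA).
move=> x [xr [/= Ax /contrapT Atx]]; split => /=; last first.
  by split => //=; rewrite /posinv dilateK.
rewrite /cone_ball /= enorm_dilate; have /andP[_ t2] := tu.1 n.
apply: (@le_lt_trans _ _ (2 * enorm (cone_val x))); first by rewrite ler_wpM2r ?enorm_ge0.
by rewrite ltr_pM2l.
Qed.

Lemma dilation_continuousU A B : dilation_continuous A -> dilation_continuous B ->
  dilation_continuous (A `|` B).
Proof.
move=> [mA hA] [mB hB]; split; first exact: measurableU.
move=> t tu r.
have := null_sequenceD _ _ (hA t tu r) (hB t tu r) => /(_ (fun=> _) (fun=> _)) h.
apply: null_sequence_le (h _ _) => // n.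
apply: le_trans (measureU2 _ _ _) => //; try exact: mE.
apply: le_measure; rewrite ?inE.
- by apply: mE; exact: measurableU.
- by apply: measurableU; exact: mE.
move=> x [xr [[Ax|Bx] /= nt]]; [left|right]; split => //; split => //.
  by move=> h'; apply: nt; left.
by move=> h'; apply: nt; right.
Qed.

Lemma dilation_continuous0 : dilation_continuous set0.
Proof. by apply: dilation_continuous_open; exact: open0. Qed.

(** Inside a ball, what the first N sets miss of the union has small measure, independently of t,
    which reduces the claim to finite unions. *)
Lemma dilation_continuous_bigcup (F : nat -> set Om) :
  (forall n, dilation_continuous (F n)) -> dilation_continuous (\bigcup_n F n).
Proof.
move=> dF.
have mF n : measurable (F n) by case: (dF n).
have mU : measurable (\bigcup_n F n) by exact: bigcup_measurable.
split => // t tu r.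
pose P N := \big[setU/set0]_(i < N) F i.
have dP N : dilation_continuous (P N).
  rewrite /P; elim: N => [|N IH]; first by rewrite big_ord0; exact: dilation_continuous0.
  by rewrite big_ord_recr/=; exact: dilation_continuousU.
have PF N : P N `<=` \bigcup_n F n.
  by rewrite /P -bigcup_mkord => x [i _ Fx]; exists i.
have mtail N : measurable (cone_ball r `&` (\bigcup_n F n `\` P N)).
  apply: measurableI; first exact: measurable_cone_ball.
  by apply: measurableD => //; case: (dP N).
have tail : null_sequence (fun N => eta (cone_ball r `&` (\bigcup_n F n `\` P N))).
  apply: (@measure_null_sequence _ _ _ _ _ (cone_ball r)) => //.
    exact: measurable_cone_ball.
  move=> x; have [[i _ Fx]|nF] := pselect ((\bigcup_n F n) x); last first.
    by near=> n => -[_ []].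
  near=> n => -[_ [_]]; apply; rewrite /P -bigcup_mkord; exists i => //=.
  by near: n; exact: nbhs_infty_gt.
move=> e e0; have e2 : 0 < e / 2 by rewrite divr_gt0.
have [N _ /(_ N (leqnn N)) tN] := tail _ e2.
apply: filterS ((dP N).2 t tu r _ e2) => n hn.
apply: (@le_lt_trans _ _ (eta (cone_ball r `&` (P N `\` dilate (t n) @^-1` P N)) +
    eta (cone_ball r `&` (\bigcup_n F n `\` P N)))%E).
  apply: le_trans (measureU2 _ _ _) => //; last by apply: mE; case: (dP N).
  apply: le_measure; rewrite ?inE.
  - exact: mE.
  - by apply: measurableU => //; apply: mE; case: (dP N).
  move=> x [xr [Fx nx]]; have [Px|Px] := pselect (P N x); last by right.
  left; split => //; split => // Ptx; apply: nx; exact: (PF N).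
by rewrite [e in e%:E](splitr e) EFinD lteD.
Unshelve. all: by end_near. Qed.

Lemma measurable_dilation_continuous A : measurable A -> dilation_continuous A.
Proof.
have sD : sigma_algebra setT dilation_continuous.
  split.
  - exact: dilation_continuous0.
  - by move=> B dB; rewrite setTD; exact: dilation_continuousC.
  - by move=> F dF; exact: dilation_continuous_bigcup.
have oD : @open Om `<=` dilation_continuous by exact: dilation_continuous_open.
by move=> mA; exact: (smallest_sub sD oD mA).
Qed.

(** Finite measure makes the part of A outside a large ball small, which removes the restriction to
    balls. *)
Lemma dilation_difference_null A t : measurable A -> (eta A < +oo)%E ->
  unit_sequence t -> null_sequence (fun n => eta (A `\` dilate (t n) @^-1` A)).
Proof.
move=> mA Aoo tu.
have mt n : measurable (A `\` cone_ball n%:R).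
  by apply: measurableD => //; exact: measurable_cone_ball.
have tail : null_sequence (fun n => eta (A `\` cone_ball n%:R)).
  apply: (@measure_null_sequence _ _ _ _ _ A) => // x.
  near=> n => -[_]; apply; rewrite /cone_ball /=.
  near: n; exists (Num.truncn (enorm (cone_val x))).+1 => // n /= hn.
  by apply: lt_le_trans (truncnS_gt _) _; rewrite ler_nat.
move=> e e0; have e2 : 0 < e / 2 by rewrite divr_gt0.
have [N _ /(_ N (leqnn N)) tN] := tail _ e2.
apply: filterS ((measurable_dilation_continuous mA).2 t tu N%:R _ e2) => n hn.
apply: (@le_lt_trans _ _ (eta (cone_ball N%:R `&` (A `\` dilate (t n) @^-1` A)) +
    eta (A `\` cone_ball N%:R))%E).
  apply: le_trans (measureU2 _ _ _) => //; last exact: mE.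
  apply: le_measure; rewrite ?inE.
  - by apply: measurableD => //; exact: measurable_dilate_preimage.
  - by apply: measurableU => //; exact: mE.
  move=> x [Ax nx]; have [bx|bx] := pselect (cone_ball N%:R x); last by right.
  by left.
by rewrite [e in e%:E](splitr e) EFinD lteD.
Unshelve. all: by end_near. Qed.

Lemma dilation_excess_null A t : measurable A -> (eta A < +oo)%E ->
  unit_sequence t -> null_sequence (fun n => eta (dilate (t n) @^-1` A `\` A)).
Proof.
move=> mA Aoo tu; have su := unit_sequenceV tu.
have := null_sequenceZ (dilation_difference_null mA Aoo su) c_gt0.
apply: null_sequence_le => n.
have mD : measurable (A `\` dilate (inv (t n)) @^-1` A).
  by apply: measurableD => //; exact: measurable_dilate_preimage.
apply: le_trans (eta_dilate (tu.1 n) mD).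
apply: le_measure; rewrite ?inE.
- by apply: measurableD => //; exact: measurable_dilate_preimage.
- exact: measurable_dilate_preimage.
by move=> x [Atx Ax]; split => //=; rewrite /posinv dilateK.
Qed.

End dilation_continuity.

(** * Functions concentrated on a pair of sets *)

Lemma powRNV {R : realType} (x s : R) : 0 <= x -> x `^ (- s) = x^-1 `^ s.
Proof. by move=> x0; rewrite -(powR_inv1 x0) -powRrM mulN1r. Qed.

(** * Weighted measures under dilation *)

Section weighted_measure.
Context {R : realType} {d : nat} {Om : convexCone R d}.
Variables (mu : {measure set Om -> \bar R}) (a : R) (Q : 'rV[R]_d -> R).
Hypothesis Q_density : polar_density Q.
Hypothesis mu_polar : polar_decomposition mu a Q.
Hypothesis a_gt0 : 0 < a.
Variable rho : R.
Hypothesis rho_ge0 : 0 <= rho.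
Local Notation cx := (fun x : Om => 1 + enorm (cone_val x)).

Lemma measurable_powR_weight : measurable_fun setT (fun x => cx x `^ rho).
Proof.
apply: (@measurableT_comp _ _ _ _ _ _ (fun r : R => r `^ rho)).
  exact: measurable_powR.
by apply: measurable_funD => //; exact: measurable_enorm_cone.
Qed.

Lemma weightedE A : measurable A -> weighted mu rho A =
  (\int[mu]_x (\1_A x * cx x `^ rho)%:E)%E.
Proof.
move=> mA; rewrite /weighted integral_mkcond; apply: eq_integral => x _.
by rewrite patchE indicE; case: ifPn => _; rewrite ?mul1r ?mul0r.
Qed.

Lemma measure_le_weighted A : measurable A -> (mu A <= weighted mu rho A)%E.
Proof.
move=> mA; rewrite -[leLHS]mul1e -(integral_cst mu mA) /weighted.
apply: ge0_le_integral => //.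
- by apply: measurable_funTS; apply/measurable_EFinP; exact: measurable_powR_weight.
- move=> x _; rewrite lee_fin -[leLHS](powRr0 (cx x)).
  by rewrite ler_powR// lerDl enorm_ge0.
Qed.

Lemma weighted_cone_ball r : (weighted mu rho (cone_ball r) < +oo)%E.
Proof.
have mb := @measurable_cone_ball _ _ Om r.
apply: (@le_lt_trans _ _ (((1 + `|r|) `^ rho)%:E * mu (cone_ball r))%E).
  rewrite -(integral_cst mu mb) /weighted; apply: ge0_le_integral => //.
  - by move=> x _; rewrite lee_fin powR_ge0.
  - by apply: measurable_funTS; apply/measurable_EFinP; exact: measurable_powR_weight.
  move=> x xr; rewrite lee_fin ge0_ler_powR// ?nnegrE ?addr_ge0 ?enorm_ge0//.
  by rewrite lerD2l (le_trans (ltW xr))// ler_norm.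
rewrite lte_mul_pinfty ?lee_fin ?powR_ge0//.
exact: (cone_ball_finite Q_density mu_polar a_gt0).
Qed.

(** For 1/t <= 2 the change of variables costs t^(-2a) <= 2^(2a), and the weight satisfies 1 + |y| /
    t <= 2 (1 + |y|), which costs 2^rho. *)
Lemma weighted_dilate t A : near_unit t -> measurable A ->
  (weighted mu rho (dilate t @^-1` A) <=
   (2 `^ (2 * a) * 2 `^ rho)%:E * weighted mu rho A)%E.
Proof.
move=> /andP[t1 t2] mA.
have mtA : measurable (dilate t @^-1` A).
  by rewrite -[X in measurable X]setTI; exact: measurable_dilate.
have tV : t%:num^-1 <= 2 by rewrite -[leRHS]invrK lef_pV2 ?posrE ?invr_gt0.
have mI : measurable_fun setT (\1_A : Om -> R) by exact: measurable_indic.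
pose f (y : Om) := (\1_A y * (1 + t%:num^-1 * enorm (cone_val y)) `^ rho)%:E.
have mf : measurable_fun setT f.
  apply/measurable_EFinP; apply: measurable_funM => //.
  apply: (@measurableT_comp _ _ _ _ _ _ (fun r : R => r `^ rho)).
    exact: measurable_powR.
  apply: measurable_funD => //; apply: measurable_funM => //.
  exact: measurable_enorm_cone.
have f0 y : (0 <= f y)%E by rewrite lee_fin mulr_ge0 ?powR_ge0.
have c0 : (0 <= (2 `^ rho : R)%:E)%E by rewrite lee_fin powR_ge0.
rewrite !weightedE//.
rewrite (_ : integral _ _ _ = \int[mu]_x f (dilate t x))%E; last first.
  apply: eq_integral => x _; rewrite /f enorm_dilate mulKf ?gt_eqF//.
rewrite (ge0_integral_dilate Q_density mu_polar)//.
rewrite [in leRHS]EFinM -muleA; apply: lee_pmul.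
- by rewrite lee_fin powR_ge0.
- by apply: integral_ge0 => x _; exact: f0.
- rewrite lee_fin powRNV//.
  by apply: ge0_ler_powR; rewrite ?nnegrE// mulr_ge0// ltW.
have mg : measurable_fun setT (fun x : Om => (\1_A x * cx x `^ rho)%:E).
  by apply/measurable_EFinP; apply: measurable_funM => //; exact: measurable_powR_weight.
have g0 (x : Om) : (0 <= (\1_A x * cx x `^ rho)%:E)%E.
  by rewrite lee_fin mulr_ge0 ?powR_ge0.
rewrite -ge0_integralZl//; apply: ge0_le_integral => //.
- by apply: emeasurable_funM.
move=> x _; rewrite -EFinM lee_fin mulrCA ler_wpM2l//.
rewrite -powRM ?addr_ge0 ?enorm_ge0//.
apply: ge0_ler_powR; rewrite ?nnegrE ?mulr_ge0 ?addr_ge0 ?mulr_ge0 ?enorm_ge0//.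
rewrite mulrDr; apply: lerD; first by rewrite mulr1 ler1n.
by rewrite ler_wpM2r ?enorm_ge0.
Qed.

End weighted_measure.

Section concentrated.
Context {R : realType} {d : nat} {Om Omh : convexCone R d}.
Variables (mu : {measure set Om -> \bar R}) (muh : {measure set Omh -> \bar R}).
Variables (a : R) (Q Qh : 'rV[R]_d -> R) (m mh : R) (K : Om -> Omh -> R[i]).
Variable U : (Om -> R[i]) -> (Omh -> R[i]).
Hypothesis Q_density : polar_density Q.
Hypothesis Qh_density : polar_density Qh.
Hypothesis mu_polar : polar_decomposition mu a Q.
Hypothesis muh_polar : polar_decomposition muh a Qh.
Hypothesis a_gt0 : 0 < a.
Hypothesis mh_ge0 : 0 <= mh.
Hypothesis K_continuous : continuous_kernel K.
Hypothesis K_bounded : polynomially_bounded_kernel m mh K.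
Hypothesis K_homogeneous : homogeneous_kernel K.
Hypothesis U_plancherel : plancherel mu muh K U.

Definition concentrated (A : set Om) (B : set Omh) (f : Om -> R[i]) : Prop :=
  [/\ inL2 mu f, {ae mu, forall x, ~ A x -> f x = 0} &
      {ae muh, forall xi, ~ B xi -> U f xi = 0}].

Let uU : unitaryL2 mu muh U. Proof. by case: U_plancherel => _ []. Qed.

Local Notation inv := posinv.

Lemma concentratedS A A' B B' f : A `<=` A' -> B `<=` B' ->
  concentrated A B f -> concentrated A' B' f.
Proof.
move=> AA' BB' [Hf fA fB]; split => //.
  by apply: filterS fA => x h nA; apply: h => /AA'.
by apply: filterS fB => x h nB; apply: h => /BB'.
Qed.

Lemma concentrated_restrict A B f : concentrated A B f ->
  ae_equal muh (U f) (crestrict B (U f)).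
Proof.
move=> [_ _]; apply: filterS => xi h; have [Bx|Bx] := pselect (B xi).
  by rewrite crestrict_in.
by rewrite crestrict_out// h.
Qed.

Lemma concentrated_dual A B f : measurable B ->
  (weighted muh (2 * mh) B < +oo)%E -> concentrated A B f ->
  ae_equal mu f (dual_transform muh K (crestrict B (U f))).
Proof.
move=> mB Boo cf; have [Hf _ _] := cf.
apply: (dual_representation Q_density Qh_density mu_polar muh_polar a_gt0
  K_continuous K_bounded U_plancherel mB Boo) => //.
- by apply: inL2_crestrict => //; exact: (unitary_inL2 uU).
- by move=> xi; exact: crestrict_out.
exact: concentrated_restrict cf.
Qed.

Lemma cintegral_dilate (C : convexCone R d) (nu : {measure set C -> \bar R}) P t
    (f : C -> R[i]) : polar_density P -> polar_decomposition nu a P -> inL1 nu f ->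
  cintegral nu (fun x => f (dilate t x)) = (t%:num `^ (- (2 * a)))%:C%C * cintegral nu f.
Proof.
move=> Pd nuP [f1 f2]; apply: complex_ext; rewrite !ReImE/= !mul0r ?subr0 ?addr0.
  exact: (Rintegral_dilate Pd nuP t f1).
exact: (Rintegral_dilate Pd nuP t f2).
Qed.

Lemma inL2_dilate (C : convexCone R d) (nu : {measure set C -> \bar R}) P t
    (f : C -> R[i]) : polar_density P -> polar_decomposition nu a P -> inL2 nu f ->
  inL2 nu (fun x => f (dilate t x)).
Proof.
move=> Pd nuP Hf; have [[f1 f2] _] := Hf.
have h1 := measurableT_comp f1 (@measurable_dilate _ _ C t).
have h2 := measurableT_comp f2 (@measurable_dilate _ _ C t).
apply: integrable_inL2; first by split; [exact: h1|exact: h2].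
exact: (integrable_dilate Pd nuP t (inL2_integrable Hf Hf)).
Qed.

(** The expected transform of f(t .) is [gt], that is t^(-2a) g(. / t). Its preimage h under U is
    computed by [dual_representation]: a change of variables and homogeneity of K give the value at
    t x of the dual transform of g, which is f(t x). Hence h = f(t .) a.e. and U maps f(t .) to
    [gt], supported on t B. *)
Lemma concentrated_dilate A B f t : near_unit t -> measurable B ->
  (weighted muh (2 * mh) B < +oo)%E -> concentrated A B f ->
  concentrated (dilate t @^-1` A) (dilate (inv t) @^-1` B) (fun x => f (dilate t x)).
Proof.
move=> tu mB Boo cf; have [Hf fA _] := cf.
have HfD := inL2_dilate t Q_density mu_polar Hf.
pose g := crestrict B (U f).
have Hg : inL2 muh g by apply: inL2_crestrict => //; exact: (unitary_inL2 uU).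
have g_supp xi : ~ B xi -> g xi = 0 by exact: crestrict_out.
pose gt xi := (t%:num `^ (- (2 * a)))%:C%C * g (dilate (inv t) xi).
have mB' : measurable (dilate (inv t) @^-1` B).
  by rewrite -[X in measurable X]setTI; exact: measurable_dilate.
have tu' := near_unitV tu.
have Boo' : (weighted muh (2 * mh) (dilate (inv t) @^-1` B) < +oo)%E.
  apply: le_lt_trans (weighted_dilate Qh_density muh_polar _ _ tu' mB) _ => //.
    by rewrite mulr_ge0.
  by rewrite lte_mul_pinfty// lee_fin mulr_ge0 ?powR_ge0.
have Hgt : inL2 muh gt.
  have HgD := inL2_dilate (inv t) Qh_density muh_polar Hg.
  have := inL2_cZD (t%:num `^ (- (2 * a)))%:C%C HgD (inL2_0 muh).
  by congr (inL2 _ _); apply/funext => xi; rewrite addr0.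
have gt_supp xi : ~ (dilate (inv t) @^-1` B) xi -> gt xi = 0.
  by move=> nB; rewrite /gt g_supp// mulr0.
have [h Hh Uh] := unitary_onto uU Hgt.
have hE := dual_representation Q_density Qh_density mu_polar muh_polar a_gt0
  K_continuous K_bounded U_plancherel mB' Boo' Hgt gt_supp Hh Uh.
have gtE x : dual_transform muh K gt x = dual_transform muh K g (dilate t x).
  have gL1 := dual_slice_inL1 K_continuous K_bounded mB Boo Hg g_supp (dilate t x).
  have e := cintegral_dilate (inv t) Qh_density muh_polar gL1.
  have gtL1 : inL1 muh (fun xi => g (dilate (inv t) xi) *
      conjc (K (dilate t x) (dilate (inv t) xi))).
    have [l1 l2] := gL1; split.
      exact: (integrable_dilate Qh_density muh_polar (inv t) l1).
    exact: (integrable_dilate Qh_density muh_polar (inv t) l2).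
  rewrite /dual_transform.
  rewrite (_ : (fun xi => gt xi * _) = (fun xi => (t%:num `^ (- (2 * a)))%:C%C *
      (g (dilate (inv t) xi) * conjc (K (dilate t x) (dilate (inv t) xi))))); last first.
    by apply/funext => xi; rewrite /gt K_homogeneous dilateVK mulrA.
  rewrite cintegralZ// e mulrA -rmorphM/=.
  rewrite [X in X%:C%C](_ : _ = 1) ?mul1r//.
  by rewrite -powRM// mulfV ?gt_eqF// powR1.
have fh : ae_equal mu h (fun x => f (dilate t x)).
  have fD := ae_dilate Q_density mu_polar t (concentrated_dual mB Boo cf).
  by apply: filterS2 hE fD => x e1 e2; rewrite e1 e2 gtE.
split => //; first exact: (ae_dilate Q_density mu_polar t fA).
by apply: filterS2 Uh (unitary_ae uU Hh HfD fh) => xi e1 e2 /gt_supp; rewrite -e1 e2.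
Qed.

End concentrated.

Section L2_inner_product.
Context {R : realType} {dT} {T : measurableType dT}.
Variable mu : {measure set T -> \bar R}.
Implicit Types f g : T -> Rcomplex R.

Definition L2_bessel := inner_bessel (inL2_0 mu) (@inL2_ZD _ _ _ mu)
  (@ripC _ _ _ mu) (@ripZD _ _ _ mu) (@rip_ge0 _ _ _ mu).

Definition L2_weak_compactness := inner_weak_compactness (inL2_0 mu)
  (@inL2_ZD _ _ _ mu) (@ripC _ _ _ mu) (@ripZD _ _ _ mu) (@rip_ge0 _ _ _ mu).

Definition L2_sqrD_le := inner_sqrD_le (@inL2_ZD _ _ _ mu)
  (@ripC _ _ _ mu) (@ripZD _ _ _ mu) (@rip_ge0 _ _ _ mu).

Definition L2_suml := inner_suml (inL2_0 mu) (@inL2_ZD _ _ _ mu) (@ripZD _ _ _ mu).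

Definition L2_innerZl := innerZl (inL2_0 mu) (@ripZD _ _ _ mu).

Definition L2_innerZr := innerZr (inL2_0 mu) (@inL2_ZD _ _ _ mu)
  (@ripC _ _ _ mu) (@ripZD _ _ _ mu).

Lemma Im_innerL2 f g : complex.Im (innerL2 mu f g) = rip mu f (fun x => 'i%C * g x).
Proof. by apply: eq_Rintegral => x _; rewrite /cdot !ReImE /=; ring. Qed.

Lemma rip_mulI f : rip mu (fun x => 'i%C * f x) (fun x => 'i%C * f x) = rip mu f f.
Proof. by apply: eq_Rintegral => x _; rewrite cdot_mulI. Qed.

Lemma scale_realE (c : R) f x : (c *: f) x = (c%:C%C : R[i]) * f x.
Proof.
by apply: complex_ext; rewrite ?cReM ?cImM /= ?mul0r ?subr0 ?addr0;
  [exact: cReZ|exact: cImZ].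
Qed.

End L2_inner_product.

(** * Counting orthonormal concentrated functions *)

Section concentrated_bessel.
Context {R : realType} {d : nat} {Om Omh : convexCone R d}.
Variables (mu : {measure set Om -> \bar R}) (muh : {measure set Omh -> \bar R}).
Variables (a : R) (Q Qh : 'rV[R]_d -> R) (m mh : R) (K : Om -> Omh -> R[i]).
Variable U : (Om -> R[i]) -> (Omh -> R[i]).
Hypothesis Q_density : polar_density Q.
Hypothesis Qh_density : polar_density Qh.
Hypothesis mu_polar : polar_decomposition mu a Q.
Hypothesis muh_polar : polar_decomposition muh a Qh.
Hypothesis a_gt0 : 0 < a.
Hypothesis K_continuous : continuous_kernel K.
Hypothesis K_bounded : polynomially_bounded_kernel m mh K.
Hypothesis U_plancherel : plancherel mu muh K U.
Local Notation cx := (fun x : Om => 1 + enorm (cone_val x)).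
Local Notation cxi := (fun xi : Omh => 1 + enorm (cone_val xi)).

Let uU : unitaryL2 mu muh U. Proof. by case: U_plancherel => _ []. Qed.

Variable c : R.
Hypothesis c_ge0 : 0 <= c.
Hypothesis K_le : forall x xi, Normc.normc (K x xi) <= c * cx x `^ m * cxi xi `^ mh.

Section row.
Variable B : set Omh.
Hypothesis B_measurable : measurable B.
Hypothesis B_finite : (weighted muh (2 * mh) B < +oo)%E.

(** The vector kappa_x of the overview, for a general set B. *)
Definition kernel_row (x : Om) : Omh -> R[i] := crestrict B (K x).

Lemma powR_sqr (r s : R) : (r `^ s) ^+ 2 = r `^ (2 * s).
Proof. by rewrite -powR_mulrn ?powR_ge0// -powRrM mulrC. Qed.

Let row_int := weighted_integrable B_measurable B_finite.

Let row_fin : weighted muh (2 * mh) B \is a fin_num.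
Proof. by rewrite ge0_fin_numE// measure_ge0. Qed.

Lemma kernel_row_L2 x : inL2 muh (kernel_row x) /\
  rip muh (kernel_row x) (kernel_row x) <=
    c ^+ 2 * cx x `^ (2 * m) * fine (weighted muh (2 * mh) B).
Proof.
have le xi : Normc.normc (kernel_row x xi) ^+ 2 <=
    (c ^+ 2 * cx x `^ (2 * m)) * (\1_B xi * cxi xi `^ (2 * mh)).
  have [Bx|Bx] := pselect (B xi); last first.
    rewrite /kernel_row crestrict_out// Normc.normc0 expr0n /=.
    by rewrite !mulr_ge0 ?powR_ge0 ?sqr_ge0.
  rewrite /kernel_row crestrict_in// indicE mem_set// mul1r -!powR_sqr -!exprMn.
  by rewrite lerXn2r ?nnegrE ?normc_ge0 ?mulr_ge0 ?powR_ge0.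
have I : muh.-integrable setT (EFin \o
    (fun xi => (c ^+ 2 * cx x `^ (2 * m)) * (\1_B xi * cxi xi `^ (2 * mh)))).
  have := integrableZl measurableT (c ^+ 2 * cx x `^ (2 * m)) row_int.
  by apply: eq_integrable => // xi _ /=; rewrite EFinM.
have HL : inL2 muh (kernel_row x).
  apply: inL2_le I le; apply: cmeasurable_crestrict => //.
  exact: measurable_kernel1.
split => //; apply: (@le_trans _ _ (Rintegral muh setT
  (fun xi => (c ^+ 2 * cx x `^ (2 * m)) * (\1_B xi * cxi xi `^ (2 * mh))))).
  apply: le_Rintegral => //; first exact: inL2_integrable.
  by move=> xi _; rewrite -sqr_normcE.
rewrite RintegralZl// ler_wpM2l ?mulr_ge0 ?powR_ge0 ?sqr_ge0//.
by rewrite /Rintegral weightedE.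
Qed.

Lemma dual_transform_row (g : Omh -> R[i]) x : inL2 muh g ->
  dual_transform muh K (crestrict B g) x = innerL2 muh (crestrict B g) (kernel_row x).
Proof.
move=> _; rewrite /dual_transform /innerL2; congr cintegral; apply/funext => xi.
have [Bx|Bx] := pselect (B xi); first by rewrite /kernel_row !crestrict_in.
by rewrite crestrict_out// !mul0r.
Qed.

Variables (A : set Om) (e : nat -> Om -> Rcomplex R) (n : nat).
Hypothesis A_measurable : measurable A.
Hypothesis e_conc : forall i, (i < n)%N -> concentrated mu muh U A B (e i).
Hypothesis e_orth : forall i j, (i < n)%N -> (j < n)%N ->
  rip mu (e i) (e j) = (i == j)%:R.

Let g i : Omh -> Rcomplex R := crestrict B (U (e i)).

Let e_L2 i : (i < n)%N -> inL2 mu (e i). Proof. by move=> /e_conc[]. Qed.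

Let g_L2 i : (i < n)%N -> inL2 muh (g i).
Proof. by move=> hi; apply: inL2_crestrict => //; apply: (unitary_inL2 uU); exact: e_L2. Qed.

Let g_orth i j : (i < n)%N -> (j < n)%N -> rip muh (g i) (g j) = (i == j)%:R.
Proof.
move=> hi hj; rewrite -e_orth// -(unitary_rip U_plancherel)//; try exact: e_L2.
apply/esym; apply: eq_rip; try exact: g_L2; try by apply: (unitary_inL2 uU); exact: e_L2.
  exact: concentrated_restrict (e_conc hi).
exact: concentrated_restrict (e_conc hj).
Qed.

(** The real and imaginary parts of the dual transform at x are real inner products with kappa_x and
    i kappa_x. Bessel's inequality is used once for each, and the two vectors have the same norm. *)
Let pointwise x : inL2 muh (kernel_row x) ->
  \sum_(i < n) cdot (dual_transform muh K (g i) x) (dual_transform muh K (g i) x) <=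
  2 * rip muh (kernel_row x) (kernel_row x).
Proof.
move=> Hk; have Hik := inL2_mulI Hk.
have b1 := L2_bessel Hk g_L2 g_orth; have b2 := L2_bessel Hik g_L2 g_orth.
rewrite rip_mulI in b2; rewrite mulr_natl mulr2n.
apply: le_trans (lerD b1 b2); rewrite -big_split/=; apply: ler_sum => i _.
have HU := unitary_inL2 uU (e_L2 (ltn_ord i)).
rewrite (dual_transform_row x HU) /cdot Re_innerL2 Im_innerL2.
by rewrite !expr2 (ripC Hk (g_L2 (ltn_ord i))) (ripC Hik (g_L2 (ltn_ord i))).
Qed.

(** The integral of the sum of the |e_i|^2 is n. The e_i vanish off A, and on A the sum is bounded
    by [pointwise] and the norm of kappa_x. *)
Lemma concentrated_bessel :
  (n%:R%:E <= (2 * c ^+ 2)%:E * (weighted mu (2 * m) A * weighted muh (2 * mh) B))%E.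
Proof.
pose f (i : 'I_n) (x : Om) : \bar R := (cdot (e i x) (e i x))%:E.
have mf (i : 'I_n) : measurable_fun setT (f i).
  by apply/measurable_EFinP; apply: measurable_cdot; case: (e_L2 (ltn_ord i)).
have f0 (i : 'I_n) x : (0 <= f i x)%E by rewrite lee_fin cdot_ge0.
have -> : (n%:R%:E = \int[mu]_x \sum_(i < n) f i x)%E.
  rewrite ge0_integral_sum//.
  under eq_bigr => i _.
    rewrite (_ : integral _ _ _ = 1%:E); last first.
      rewrite -sqnormL2E (inL2_sqnorm (e_L2 (ltn_ord i))) e_orth//.
      by rewrite eqxx.
    over.
  by rewrite sumEFin sumr_const card_ord.
pose k := 2 * c ^+ 2 * fine (weighted muh (2 * mh) B).
have k0 : 0 <= k by rewrite !mulr_ge0 ?sqr_ge0 ?fine_ge0.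
have mA1 : measurable_fun setT (fun x : Om => (\1_A x * cx x `^ (2 * m))%:E).
  apply/measurable_EFinP; apply: measurable_funM; first exact: measurable_indic.
  exact: measurable_powR_weight.
have A0 (x : Om) : (0 <= (\1_A x * cx x `^ (2 * m))%:E)%E.
  by rewrite lee_fin mulr_ge0 ?powR_ge0.
apply: (@le_trans _ _ (\int[mu]_x (k%:E * (\1_A x * cx x `^ (2 * m))%:E))%E); last first.
  rewrite ge0_integralZl//= -weightedE// /k EFinM fineK//.
  by rewrite -muleA [X in (_ * X)%E]muleC.
apply: ae_ge0_le_integral => //.
- by move=> x _; apply: sume_ge0 => i _; exact: f0.
- by apply: emeasurable_sum => i; exact: mf.
- by move=> x _; rewrite mule_ge0.
- exact: emeasurable_funM.
have E : {ae mu, forall x, forall i, (i < n)%N ->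
    e i x = dual_transform muh K (g i) x /\ (~ A x -> e i x = 0)}.
  apply: ae_foralln => i; have [hi|hi] := boolP (i < n)%N; last exact: aeW.
  have [_ h2 _] := e_conc hi.
  have h1 := concentrated_dual Q_density Qh_density mu_polar muh_polar a_gt0
    K_continuous K_bounded U_plancherel B_measurable B_finite (e_conc hi).
  by apply: filterS2 h1 h2 => x ? ? _.
apply: filterS E => x Ex _.
have [Ax|Ax] := pselect (A x); last first.
  rewrite big1 ?mule_ge0// => i _; have [_ /(_ Ax) e0] := Ex i (ltn_ord i).
  by rewrite /f e0 /cdot /= !mulr0 addr0.
rewrite indicE mem_set// mul1r sumEFin -EFinM lee_fin.
have [Hk kle] := kernel_row_L2 x.
under eq_bigr do rewrite (Ex _ (ltn_ord _)).1.
apply: le_trans (pointwise Hk) _.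
apply: (@le_trans _ _ (2 * (c ^+ 2 * cx x `^ (2 * m) * fine (weighted muh (2 * mh) B)))).
  by rewrite ler_wpM2l.
by rewrite /k le_eqVlt; apply/orP; left; apply/eqP; ring.
Qed.

End row.
End concentrated_bessel.

(** * Nonexistence of nonzero concentrated functions *)

Section weak_annihilation.
Context {R : realType} {d : nat} {Om Omh : convexCone R d}.
Variables (mu : {measure set Om -> \bar R}) (muh : {measure set Omh -> \bar R}).
Variables (a : R) (Q Qh : 'rV[R]_d -> R) (m mh : R) (K : Om -> Omh -> R[i]).
Variable U : (Om -> R[i]) -> (Omh -> R[i]).
Hypothesis Q_density : polar_density Q.
Hypothesis Qh_density : polar_density Qh.
Hypothesis mu_polar : polar_decomposition mu a Q.
Hypothesis muh_polar : polar_decomposition muh a Qh.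
Hypothesis a_gt0 : 0 < a.
Hypothesis m_ge0 : 0 <= m.
Hypothesis mh_ge0 : 0 <= mh.
Hypothesis K_continuous : continuous_kernel K.
Hypothesis K_bounded : polynomially_bounded_kernel m mh K.
Hypothesis K_homogeneous : homogeneous_kernel K.
Hypothesis U_plancherel : plancherel mu muh K U.
Local Notation V := (concentrated mu muh U).
Local Notation eta := (weighted mu (2 * m)).
Local Notation etah := (weighted muh (2 * mh)).
Local Notation fn := (Om -> Rcomplex R).

Let uU : unitaryL2 mu muh U. Proof. by case: U_plancherel => _ []. Qed.

Lemma concentratedZD A B (c : R) (f g : fn) : V A B f -> V A B g -> V A B (c *: f + g).
Proof.
move=> [Hf fA fB] [Hg gA gB]; split; first exact: inL2_ZD.
  apply: filterS2 fA gA => x h1 h2 nA.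
  by rewrite -[LHS]/((c *: f) x + g x) scale_realE h1// h2// mulr0 addr0.
have fE : (c *: f + g) = (fun x => c%:C%C * (f x : R[i]) + g x) :> fn.
  by apply/funext => x; rewrite -scale_realE.
have ul := unitary_linear uU c%:C%C Hf Hg.
rewrite fE; apply: filterS3 fB gB ul => xi h1 h2 -> nB.
by rewrite h1// h2// mulr0 addr0.
Qed.

Lemma concentrated0 A B : V A B (0 : fn).
Proof.
have H0 := inL2_0 mu; split => //; first exact: aeW.
have HU := unitary_inL2 uU H0.
have : rip muh (U 0) (U 0) = 0.
  rewrite (unitary_rip U_plancherel H0 H0) /rip /Rintegral integral0_eq// => x _.
  by rewrite /cdot /= mulr0 addr0.
by move=> /(rip_eq0 HU); apply: filterS => xi.
Qed.

Lemma concentrated_sum A B n (c : nat -> R) (e : nat -> fn) :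
  (forall i, (i < n)%N -> V A B (e i)) -> V A B (\sum_(i < n) c i *: e i).
Proof.
exact: (inner_pred_sum (concentrated0 A B) (fun c f g => @concentratedZD A B c f g)).
Qed.

(* Unlike the existence of a nonzero concentrated function, this property is
   stable under dilation, and it yields a function that lives on the part of a
   dilate of A outside A. *)
Definition spanned (A : set Om) (B : set Omh) : Prop :=
  forall N, measurable N -> N `<=` A ->
  (forall f, V A B f -> {ae mu, forall x, N x -> f x = 0}) -> mu N = 0%E.

Let measurable_dilate_preimage (C : convexCone R d) t (A : set C) : measurable A ->
  measurable (dilate t @^-1` A).
Proof.
by move=> mA; rewrite -[X in measurable X]setTI; exact: measurable_dilate.
Qed.

(** N is split along A and A / t. For the second part, f(t .) is concentrated on the enlarged pair
    whenever f is on the original one, so all such f vanish on the image of that part under x -> t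
    x, a subset of A; this image is null, and so is the part itself by homogeneity of mu. *)
Lemma spanned_dilate t A B : near_unit t -> measurable A -> measurable B ->
  (etah B < +oo)%E -> spanned A B ->
  spanned (A `|` dilate t @^-1` A) (B `|` dilate (posinv t) @^-1` B).
Proof.
move=> tu mA mB Boo sAB N mN NA hN.
have N1 : mu (N `&` A) = 0%E.
  apply: sAB => [||f Vf]; first exact: measurableI.
    exact: subIsetr.
  have := hN f (concentratedS (@subsetUl _ _ _) (@subsetUl _ _ _) Vf).
  by apply: filterS => x h [/h].
have mN2 : measurable (N `&` dilate t @^-1` A).
  by apply: measurableI => //; exact: measurable_dilate_preimage.
have N2 : mu (dilate (posinv t) @^-1` (N `&` dilate t @^-1` A)) = 0%E.
  apply: sAB => [||f Vf]; first exact: measurable_dilate_preimage.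
    by move=> x [_ /=]; rewrite /posinv dilateVK.
  have Vft := concentrated_dilate Q_density Qh_density mu_polar muh_polar a_gt0
    mh_ge0 K_continuous K_bounded K_homogeneous U_plancherel tu mB Boo Vf.
  have := hN _ (concentratedS (@subsetUr _ _ _) (@subsetUr _ _ _) Vft).
  move=> /(ae_dilate Q_density mu_polar (posinv t)).
  by apply: filterS => x h [/h]; rewrite /posinv dilateVK.
have N2' : mu (N `&` dilate t @^-1` A) = 0%E.
  by rewrite (polar_dilate Q_density mu_polar (posinv t) mN2) N2 mule0.
apply/eqP; rewrite eq_le measure_ge0 andbT.
have -> : (0 = mu (N `&` A) + mu (N `&` dilate t @^-1` A))%E by rewrite N1 N2' adde0.
apply: le_trans (measureU2 _ _ _) => //; last exact: measurableI.
apply: le_measure; rewrite ?inE//; first by apply: measurableU => //; exact: measurableI.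
by move=> x Nx; have [Ax|Ax] := NA x Nx; [left|right].
Qed.

(** mu (A / t) = t^(-2a) mu A is strictly larger than mu A, which is positive and finite. *)
Lemma dilation_excess_positive t A : t%:num < 1 -> measurable A ->
  (0 < mu A < +oo)%E -> (0 < mu (dilate t @^-1` A `\` A))%E.
Proof.
move=> t1 mA /andP[A0 Aoo]; rewrite lt_neqAle measure_ge0 andbT eq_sym.
apply/eqP => e0; have mtA := measurable_dilate_preimage t mA.
have : (mu (dilate t @^-1` A) <= mu A)%E.
  rewrite -[leRHS]adde0 -e0.
  apply: le_trans (measureU2 _ _ _) => //; last exact: measurableD.
  apply: le_measure; rewrite ?inE//; first by apply: measurableU => //; exact: measurableD.
  by move=> x tx; have [Ax|Ax] := pselect (A x); [left|right].
rewrite (polar_preimageE Q_density mu_polar)//.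
have fA : mu A \is a fin_num by rewrite ge0_fin_numE ?measure_ge0.
rewrite -(fineK fA) -EFinM lee_fin ger_pMl; last by rewrite fine_gt0// A0.
apply/negP; rewrite -ltNge powRNV//.
have : 1 `^ (2 * a) < t%:num^-1 `^ (2 * a).
  by apply: gt0_ltr_powR; rewrite ?nnegrE ?invr_ge0 ?mulr_gt0 ?invf_gt1.
by rewrite powR1.
Qed.

(** Factors below 1 that tend to 1; the offset makes the first one 1/2, so that all satisfy
    [near_unit]. *)
Let step (n : nat) : R := 1 - n.+2%:R^-1.

Let step_gt0 n : 0 < step n.
Proof. by rewrite subr_gt0 invf_lt1// ltr1n. Qed.

Let t n : {posnum R} := PosNum (step_gt0 n).

Let t_lt1 n : (t n)%:num < 1.
Proof. by rewrite /= /step ltrBlDr ltrDl. Qed.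

Let t_unit : unit_sequence t.
Proof.
split => [n|].
  apply/andP; split; last by rewrite (le_trans (ltW (t_lt1 n)))// ler1n.
  rewrite /= /step lerBrDr -lerBrDl.
  rewrite [leRHS](_ : _ = 2^-1); last by field.
  by rewrite lef_pV2 ?posrE// ler_nat.
apply/cvgrPdist_lt => e e0; near=> n.
rewrite /= /step opprB addrC subrK ger0_norm//.
apply: le_lt_trans (_ : n.+1%:R^-1 < e); first by rewrite lef_pV2 ?posrE// ler_nat.
by near: n; exact: (near_infty_natSinv_lt (PosNum e0)).
Unshelve. all: by end_near. Qed.



Lemma weighted_excess_null (C : convexCone R d) (nu : {measure set C -> \bar R}) P rho
    (A : set C) s : polar_density P -> polar_decomposition nu a P -> 0 <= rho ->
  measurable A -> (weighted nu rho A < +oo)%E -> unit_sequence s ->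
  null_sequence (fun n => weighted nu rho (dilate (s n) @^-1` A `\` A)).
Proof.
move=> Pd nuP rho0 mA Aoo su.
have h1 r : (weighted nu rho (cone_ball r) < +oo)%E.
  exact: (weighted_cone_ball Pd nuP a_gt0).
have h2 : 0 < (2 : R) `^ (2 * a) * 2 `^ rho by rewrite mulr_gt0 ?powR_gt0.
have h3 s' B : near_unit s' -> measurable B -> (weighted nu rho (dilate s' @^-1` B) <=
    (2 `^ (2 * a) * 2 `^ rho)%:E * weighted nu rho B)%E.
  exact: (weighted_dilate Pd nuP a_gt0 rho0).
exact: (dilation_excess_null h1 h2 h3 mA Aoo su).
Qed.

Let weightedU (C : convexCone R d) (nu : {measure set C -> \bar R}) rho (A : set C) s e :
  measurable A -> (weighted nu rho A < +oo)%E ->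
  (weighted nu rho (dilate s @^-1` A `\` A) < e%:E)%E ->
  (weighted nu rho (A `|` dilate s @^-1` A) <=
    (fine (weighted nu rho A) + e)%:E)%E.
Proof.
move=> mA Aoo le; have ms := measurable_dilate_preimage s mA.
have fA : weighted nu rho A \is a fin_num by rewrite ge0_fin_numE ?measure_ge0.
rewrite EFinD fineK//.
rewrite (_ : A `|` _ = A `|` (dilate s @^-1` A `\` A)); last by rewrite setUDr setDv setD0.
apply: le_trans (measureU2 _ _ _) _ => //; first exact: measurableD.
by rewrite leeD2l// ltW.
Qed.


Variable M : R.

(** The invariant of the induction. The last bound is strict so that it survives a small enough
    enlargement, and M stays fixed throughout. *)
Definition spanned_pair (A : set Om) (B : set Omh) : Prop :=
  [/\ measurable A /\ measurable B, (eta A < +oo)%E /\ (etah B < +oo)%E,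
      (0 < mu A)%E, spanned A B & fine (eta A) * fine (etah B) < M].

Lemma spanned_pair_extend A B : spanned_pair A B -> exists A' B',
  [/\ spanned_pair A' B', A `<=` A', B `<=` B' &
      exists2 f, V A' B' f & ~ {ae mu, forall x, ~ A x -> f x = 0}].
Proof.
move=> [[mA mB] [Aoo Boo] A0 sAB ABM].
set x := fine (eta A) in ABM; set y := fine (etah B) in ABM.
have x0 : 0 <= x by rewrite fine_ge0.
have y0 : 0 <= y by rewrite fine_ge0.
have [e [e0 eM]] : exists e : R, 0 < e /\ (x + e) * (y + e) < M.
  (* As e <= 1, (x + e)(y + e) - x y <= e (x + y + 1) <= (M - x y) / 2, so at most half of the
     available room is used. *)
  exists (Num.min 1 ((M - x * y) / (2 * (x + y + 1)))).
  set e' := (M - x * y) / (2 * (x + y + 1)).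
  have s0 : 0 < x + y + 1 by rewrite ltr_wpDl// addr_ge0.
  have e'0 : 0 < e' by rewrite divr_gt0 ?subr_gt0// mulr_gt0.
  have e'E : e' * (x + y + 1) = (M - x * y) / 2 by rewrite /e'; field; rewrite gt_eqF.
  have [h1 h2 h3] : [/\ 0 < Num.min 1 e', Num.min 1 e' <= 1 & Num.min 1 e' <= e'].
    by rewrite lt_min ltr01 e'0 ge_min lexx ge_min lexx orbT.
  split => //; set e := Num.min 1 e' in h1 h2 h3 *.
  have h4 : e * (x + y + 1) <= e' * (x + y + 1) by rewrite ler_pM2r.
  have h5 : e * e <= e by rewrite ger_pMl.
  by nra.
have m2 : 0 <= 2 * m by rewrite mulr_ge0.
have mh2 : 0 <= 2 * mh by rewrite mulr_ge0.
have nA := weighted_excess_null Q_density mu_polar m2 mA Aoo t_unit e0.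
have nB := weighted_excess_null Qh_density muh_polar mh2 mB Boo (unit_sequenceV t_unit) e0.
have [n [hA hB]] := filter_ex (filterI nA nB).
have mtA := measurable_dilate_preimage (t n) mA.
have mtB := measurable_dilate_preimage (posinv (t n)) mB.
exists (A `|` dilate (t n) @^-1` A), (B `|` dilate (posinv (t n)) @^-1` B).
have hA' := weightedU mA Aoo hA; have hB' := weightedU mB Boo hB.
have Aoo' : (eta (A `|` dilate (t n) @^-1` A) < +oo)%E by apply: le_lt_trans hA' (ltry _).
have Boo' : (etah (B `|` dilate (posinv (t n)) @^-1` B) < +oo)%E.
  by apply: le_lt_trans hB' (ltry _).
have sAB' := spanned_dilate (t_unit.1 n) mA mB Boo sAB.
split; try exact: subsetUl.
  split => //.
  - by split; exact: measurableU.
  - apply: lt_le_trans A0 _; apply: le_measure; rewrite ?inE//.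
    exact: measurableU.
  - apply: le_lt_trans eM; apply: ler_pM; rewrite ?fine_ge0//.
      by rewrite -lee_fin fineK// ge0_fin_numE ?measure_ge0.
    by rewrite -lee_fin fineK// ge0_fin_numE ?measure_ge0.
(* If every function concentrated on the new pair vanished off A, [spanned] for that pair would make
   A / t minus A a null set. *)
apply: contrapT => nf.
have muA : (0 < mu A < +oo)%E.
  rewrite A0/=; apply: le_lt_trans Aoo; exact: measure_le_weighted.
have := dilation_excess_positive (t_lt1 n) mA muA.
rewrite sAB' ?ltxx//; first exact: measurableD.
  by move=> z [tz _]; right.
move=> f Vf; apply: contrapT => nae; apply: nf; exists f => //.
by apply: contra_not nae; apply: filterS => z h [_ /h].
Qed.

Let orthonormal_family n A B (e : nat -> fn) : Prop :=
  (forall i, (i < n)%N -> V A B (e i)) /\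
  (forall i j, (i < n)%N -> (j < n)%N -> rip mu (e i) (e j) = (i == j)%:R).

(** Gram-Schmidt along growing pairs: the function supplied by [spanned_pair_extend] does not vanish
    off the previous set [A1], whereas all earlier ones do, so its component orthogonal to them is
    nonzero. *)
Lemma concentrated_orthonormal A B n : spanned_pair A B ->
  exists A' B' e, spanned_pair A' B' /\ orthonormal_family n A' B' e.
Proof.
move=> sp; elim: n => [|n [A1 [B1 [e [sp1 [Ve oe]]]]]].
  by exists A, B, (fun=> 0); split => //; split.
have [A2 [B2 [sp2 A12 B12 [f Vf nf]]]] := spanned_pair_extend sp1.
have Ve2 i : (i < n)%N -> V A2 B2 (e i).
  by move=> /Ve; exact: concentratedS.
have e_L2 i : (i < n)%N -> inL2 mu (e i) by move=> /Ve[].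
have Hf : inL2 mu f by case: Vf.
pose s : fn := \sum_(i < n) rip mu f (e i) *: e i.
pose f' : fn := (-1) *: s + f.
have Vs : V A2 B2 s := @concentrated_sum A2 B2 n (fun i => rip mu f (e i)) e Ve2.
have Vf' : V A2 B2 f' by exact: concentratedZD.
have Hs : inL2 mu s by case: Vs.
have Hf' : inL2 mu f' by case: Vf'.
have of' j : (j < n)%N -> rip mu f' (e j) = 0.
  move=> hj; have Hj := e_L2 j hj.
  rewrite ripZD// (@L2_suml _ _ _ mu n (fun i => rip mu f (e i)) e)//.
  rewrite (bigD1 (Ordinal hj))//= oe// eqxx mulr1 big1 ?addr0 ?mulN1r ?addNr// => i ij.
  by rewrite oe//; move: ij; rewrite -val_eqE /= => /negbTE ->; rewrite mulr0.
have p0 : 0 < rip mu f' f'.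
  rewrite lt_neqAle rip_ge0// andbT eq_sym; apply/eqP => /(rip_eq0 Hf') f'0.
  apply: nf.
  have E : {ae mu, forall x, forall i, (i < n)%N -> ~ A1 x -> e i x = 0}.
    apply: ae_foralln => i; have [hi|hi] := boolP (i < n)%N; last exact: aeW.
    by have [_ h _] := Ve i hi; apply: filterS h => x h _.
  apply: filterS2 f'0 E => x fx Ex nA.
  have sx : s x = 0.
    rewrite /s fct_sumE big1// => i _.
    by rewrite -[LHS]/((_ *: e i) x) scale_realE Ex// mulr0.
  move: fx; rewrite -[f' x]/(((-1) *: s) x + f x) scale_realE sx mulr0 add0r.
  by [].
pose p := Num.sqrt (rip mu f' f').
have pp : p * p = rip mu f' f' by rewrite -expr2 sqr_sqrtr ?ltW.
have pn0 : p != 0 by rewrite gt_eqF// sqrtr_gt0.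
(* The summand 0 puts the normalisation in the shape of [concentratedZD] and [ripZD]. *)
pose en : fn := p^-1 *: f' + 0.
have Ven : V A2 B2 en by apply: concentratedZD => //; exact: concentrated0.
have Hen : inL2 mu en by case: Ven.
have H0 := inL2_0 mu.
have ip0 h : inL2 mu h -> rip mu (0 : fn) h = 0.
  by move=> Hh; rewrite /rip /Rintegral integral0_eq// => x _; rewrite /cdot /= !mul0r addr0.
have oen j : (j < n)%N -> rip mu en (e j) = 0.
  by move=> hj; have Hj := e_L2 j hj; rewrite ripZD// of'// mulr0 ip0// addr0.
have nen : rip mu en en = 1.
  rewrite ripZD// ip0// addr0 (ripC Hf' Hen) ripZD// ip0// addr0 -pp.
  by field.
exists A2, B2, (fun i => if (i < n)%N then e i else en); split => //; split.
  by move=> i _; case: ifPn => [/Ve2|].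
move=> i j; rewrite !ltnS => iN jN.
case: ifPn => [hi|]; last first.
  rewrite -leqNgt => ni; have {ni iN}-> : i = n by apply/eqP; rewrite eqn_leq iN.
  case: ifPn => [hj|]; first by rewrite oen// gtn_eqF.
  by rewrite -leqNgt => nj; rewrite nen eqn_leq nj jN.
case: ifPn => [hj|]; first exact: oe.
rewrite -leqNgt => nj; have {nj jN}-> : j = n by apply/eqP; rewrite eqn_leq jN.
by rewrite (ripC (e_L2 i hi) Hen) oen// ltn_eqF.
Qed.

(** The bound M does not depend on the length of the orthonormal family, so [concentrated_bessel]
    bounds every n by 2 c^2 M. *)
Lemma spanned_pair_false A B : ~ spanned_pair A B.
Proof.
move=> sp; have [c c0 Hc] := kernel_bound K_bounded.
have C0 : 0 <= 2 * c ^+ 2 by rewrite mulr_ge0 ?sqr_ge0.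
have M0 : 0 <= M.
  case: sp => _ _ _ _ /ltW; apply: le_trans; by rewrite mulr_ge0 ?fine_ge0.
have bd n : n%:R <= 2 * c ^+ 2 * M.
  have [A' [B' [e [[[mA mB] [Aoo Boo] _ _ ABM] [Ve oe]]]]] := concentrated_orthonormal n sp.
  have := concentrated_bessel Q_density Qh_density mu_polar muh_polar a_gt0
    K_continuous K_bounded U_plancherel c0 Hc mB Boo mA Ve oe.
  have fA : eta A' \is a fin_num by rewrite ge0_fin_numE ?measure_ge0.
  have fB : etah B' \is a fin_num by rewrite ge0_fin_numE ?measure_ge0.
  rewrite -(fineK fA) -(fineK fB) -!EFinM lee_fin => /le_trans; apply.
  by rewrite ler_wpM2l// ltW.
have := bd (Num.truncn (2 * c ^+ 2 * M)).+1.
by rewrite leNgt truncnS_gt.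
Qed.

End weak_annihilation.

(** * Strong annihilation *)

Section crestrict_theory.
Context {R : realType} {dT} {T : measurableType dT}.
Variable mu : {measure set T -> \bar R}.
Implicit Types f g : T -> Rcomplex R.

Lemma crestrictZD A (c : R) f g :
  crestrict A (c *: f + g) = c *: (crestrict A f : T -> Rcomplex R) + crestrict A g :> (T -> Rcomplex R).
Proof.
apply/funext => x; have [Ax|Ax] := pselect (A x).
  by rewrite -[RHS]/((c *: (crestrict A f : T -> Rcomplex R)) x + crestrict A g x)
    scale_realE !crestrict_in// -scale_realE.
by rewrite -[RHS]/((c *: (crestrict A f : T -> Rcomplex R)) x + crestrict A g x)
  scale_realE !crestrict_out// mulr0 addr0.
Qed.

Lemma sqnormL2_crestrict A f : measurable A -> inL2 mu f ->
  sqnormL2 mu A f = (rip mu (crestrict A f) (crestrict A f))%:E.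
Proof.
move=> mA Hf; rewrite -inL2_sqnorm; last exact: inL2_crestrict.
rewrite /sqnormL2 integral_mkcond; apply: eq_integral => x _.
rewrite patchE; case: ifPn; first by rewrite inE => Ax; rewrite crestrict_in.
by rewrite notin_setE => Ax; rewrite crestrict_out// Normc.normc0 expr0n.
Qed.

Lemma rip_crestrict_le A f : measurable A -> inL2 mu f ->
  rip mu (crestrict A f) (crestrict A f) <= rip mu f f.
Proof.
move=> mA Hf; have Hr := inL2_crestrict mA Hf; apply: le_Rintegral => //.
- exact: inL2_integrable.
- exact: inL2_integrable.
by move=> x _; rewrite -!sqr_normcE lerXn2r ?nnegrE ?normc_ge0// normc_crestrict.
Qed.

End crestrict_theory.

Section strong_annihilation.
Context {R : realType} {d : nat} {Om Omh : convexCone R d}.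
Variables (mu : {measure set Om -> \bar R}) (muh : {measure set Omh -> \bar R}).
Variables (a : R) (Q Qh : 'rV[R]_d -> R) (m mh : R) (K : Om -> Omh -> R[i]).
Variable U : (Om -> R[i]) -> (Omh -> R[i]).
Hypothesis Q_density : polar_density Q.
Hypothesis Qh_density : polar_density Qh.
Hypothesis mu_polar : polar_decomposition mu a Q.
Hypothesis muh_polar : polar_decomposition muh a Qh.
Hypothesis a_gt0 : 0 < a.
Hypothesis m_ge0 : 0 <= m.
Hypothesis mh_ge0 : 0 <= mh.
Hypothesis K_continuous : continuous_kernel K.
Hypothesis K_bounded : polynomially_bounded_kernel m mh K.
Hypothesis K_homogeneous : homogeneous_kernel K.
Hypothesis U_plancherel : plancherel mu muh K U.
Local Notation V := (concentrated mu muh U).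
Local Notation eta := (weighted mu (2 * m)).
Local Notation etah := (weighted muh (2 * mh)).
Local Notation fn := (Om -> Rcomplex R).
Local Notation cx := (fun x : Om => 1 + enorm (cone_val x)).

Let uU : unitaryL2 mu muh U. Proof. by case: U_plancherel => _ []. Qed.

Variables (S : set Om) (Sig : set Omh).
Hypothesis S_measurable : measurable S.
Hypothesis Sig_measurable : measurable Sig.
Hypothesis S_finite : (eta S < +oo)%E.
Hypothesis Sig_finite : (etah Sig < +oo)%E.

(** S is shrunk to the set A where f is nonzero: a subset of A on which f vanishes a.e. is null, so
    f alone makes the pair [spanned]. The 1 added to the product of the measures makes the bound of
    [spanned_pair] strict. *)
Lemma weak_annihilation f : V S Sig f -> ae_equal mu f (fun=> 0).
Proof.
move=> Vf; apply: contrapT => nf; have [Hf fS _] := Vf.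
have mN : measurable [set x | f x <> 0].
  have mc : measurable_fun setT (fun x => cdot (f x) (f x)).
    by apply: measurable_cdot; case: Hf.
  rewrite (_ : [set _ | _] = ~` ((fun x => cdot (f x) (f x)) @^-1` [set 0])).
    by apply: measurableC; rewrite -[X in measurable X]setTI; exact: mc.
  apply/seteqP; split => x /= h; first by move=> /cdot_eq0.
  by move=> fx; apply: h; rewrite fx /cdot /= mulr0 addr0.
pose A := S `&` [set x | f x <> 0].
have mA : measurable A by exact: measurableI.
have AS : A `<=` S by exact: subIsetl.
have VA : V A Sig f.
  have [_ _ fSig] := Vf; split => //; apply: filterS fS => x h nA.
  by apply: contrapT => fx; apply: (fx); apply: h => Sx; apply: nA.
have etaAS : (eta A <= eta S)%E by apply: le_measure; rewrite ?inE.
have sp : spanned_pair mu muh m mh U (fine (eta S) * fine (etah Sig) + 1) A Sig.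
  split => //.
  - by split => //; exact: le_lt_trans S_finite.
  - rewrite lt_neqAle measure_ge0 andbT eq_sym; apply/eqP => A0; apply: nf.
    have : {ae mu, forall x, ~ A x} by exists A; split => // x /= /contrapT.
    by apply: filterS2 fS => x h nA; apply: contrapT => fx; apply: nA; split => //;
       apply: contrapT => /h.
  - move=> N mNN NA hN; have [N' [mN' N'0 NN']] := hN f VA.
    apply/eqP; rewrite eq_le measure_ge0 andbT -N'0; apply: le_measure; rewrite ?inE//.
    by move=> x Nx; apply: NN' => /= /(_ Nx); case: (NA _ Nx).
  rewrite (@le_lt_trans _ _ (fine (eta S) * fine (etah Sig)))//; last by rewrite ltrDl.
  rewrite ler_wpM2r ?fine_ge0// fine_le// ge0_fin_numE ?measure_ge0//.
  exact: le_lt_trans S_finite.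
exact: (spanned_pair_false Q_density Qh_density mu_polar muh_polar a_gt0 m_ge0 mh_ge0
  K_continuous K_bounded K_homogeneous U_plancherel sp).
Qed.


Local Notation hfn := (Omh -> Rcomplex R).

Lemma unitaryZD (c : R) (f g : fn) : inL2 mu f -> inL2 mu g ->
  ae_equal muh (U (c *: f + g)) (c *: (U f : hfn) + U g).
Proof.
move=> Hf Hg; have fE : (c *: f + g) = (fun x => c%:C%C * (f x : R[i]) + g x) :> fn.
  by apply/funext => x; rewrite -scale_realE.
rewrite fE; have := unitary_linear uU c%:C%C Hf Hg; apply: filterS => xi ->.
by rewrite -scale_realE.
Qed.

Let UL2 f : inL2 mu f -> inL2 muh (U f). Proof. exact: (unitary_inL2 uU). Qed.

Let mSc : measurable (~` S). Proof. exact: measurableC. Qed.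
Let mSigc : measurable (~` Sig). Proof. exact: measurableC. Qed.

Let defect_S (f : fn) : R := rip mu (crestrict (~` S) f) (crestrict (~` S) f).
Let defect_Sig (f : fn) : R :=
  rip muh (crestrict (~` Sig) (U f)) (crestrict (~` Sig) (U f)).

Lemma defect_eq_concentrated (f : fn) : inL2 mu f -> defect_S f = 0 ->
  defect_Sig f = 0 -> V S Sig f.
Proof.
move=> Hf dS dSig; split => //.
  have := rip_eq0 (inL2_crestrict mSc Hf) dS; apply: filterS => x + nS.
  by rewrite crestrict_in.
have := rip_eq0 (inL2_crestrict mSigc (UL2 Hf)) dSig; apply: filterS => x + nS.
by rewrite crestrict_in.
Qed.

(** U (f - h) is the restriction of U f to the complement of [Sig], and unitarity carries its norm
    back to f - h. *)
Lemma defect_approximation (f h : fn) : inL2 mu f -> inL2 mu h ->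
  ae_equal muh (U h) (crestrict Sig (U f)) ->
  rip mu ((-1) *: h + f) ((-1) *: h + f) = defect_Sig f.
Proof.
move=> Hf Hh Uh; have HD := inL2_ZD (-1) Hh Hf.
have Hr := inL2_crestrict mSigc (UL2 Hf).
rewrite -(unitary_rip U_plancherel HD HD).
have E : ae_equal muh (U ((-1) *: h + f)) (crestrict (~` Sig) (U f)).
  apply: filterS2 (unitaryZD (-1) Hh Hf) Uh => xi -> Uhx.
  rewrite -[LHS]/(((-1) *: (U h : hfn)) xi + U f xi) scale_realE Uhx.
  have [Sx|Sx] := pselect (Sig xi).
    rewrite (crestrict_in _ Sx) crestrict_out; last by move=> /(_ Sx).
    by apply: complex_ext; rewrite !ReImE /=; ring.
  by rewrite (crestrict_out _ Sx) crestrict_in// mulr0 add0r.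
have HU := UL2 HD; exact: (eq_rip HU Hr HU Hr E E).
Qed.

(** * A limit of unit vectors of small defect *)

Section unit_sequence_of_small_defect.
Variable f : nat -> fn.
Hypothesis f_L2 : forall n, inL2 mu (f n).
Hypothesis f_unit : forall n, rip mu (f n) (f n) = 1.
Hypothesis f_defect : forall n, defect_S (f n) + defect_Sig (f n) < n.+1%:R^-1.

Let g n : hfn := crestrict Sig (U (f n)).

Let g_L2 n : inL2 muh (g n).
Proof. by apply: inL2_crestrict => //; exact: UL2. Qed.

Let g_le1 n : rip muh (g n) (g n) <= 1.
Proof.
rewrite -(f_unit n) -(unitary_rip U_plancherel)//; apply: rip_crestrict_le => //.
exact: UL2.
Qed.

Let H n : Om -> R[i] := dual_transform muh K (g n).

Let mH n : cmeasurable (H n).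
Proof.
apply: (measurable_dual_transform Q_density Qh_density mu_polar muh_polar a_gt0
  K_continuous K_bounded Sig_measurable Sig_finite (g_L2 n)).
by move=> xi; exact: crestrict_out.
Qed.

Let row x := kernel_row K Sig x.

Let HE n x : H n x = (rip muh (g n) (row x) +i* rip muh (g n) (fun xi => 'i%C * row x xi))%C.
Proof.
rewrite /H (dual_transform_row K Sig x (UL2 (f_L2 n))).
by apply: complex_ext; [rewrite Re_innerL2|rewrite Im_innerL2].
Qed.

Lemma small_defect_limit : exists phi : fn, inL2 mu phi /\
  forall e : R, 0 < e -> exists n, rip mu ((-1) *: phi + f n) ((-1) *: phi + f n) < e /\
    defect_S (f n) + defect_Sig (f n) < e.
Proof.
have [c c0 Hc] := kernel_bound K_bounded.
pose D x : R := c ^+ 2 * cx x `^ (2 * m) * fine (etah Sig).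
have D0 x : 0 <= D x by rewrite !mulr_ge0 ?powR_ge0 ?sqr_ge0 ?fine_ge0.
have rowP x := kernel_row_L2 K_continuous c0 Hc Sig_measurable Sig_finite x.
have [u [uk ucv]] := L2_weak_compactness g_L2 g_le1.
(* Weak convergence is tested at each x against the row and i times the row only. *)
pose L x : R[i] := (limn (fun k => rip muh (g (u k)) (row x)) +i*
  limn (fun k => rip muh (g (u k)) (fun xi => 'i%C * row x xi)))%C.
have cRe x : (fun k => complex.Re (H (u k) x)) @ \oo --> complex.Re (L x).
  under eq_fun do rewrite HE /=.
  by apply: ucv; exact: (rowP x).1.
have cIm x : (fun k => complex.Im (H (u k) x)) @ \oo --> complex.Im (L x).
  under eq_fun do rewrite HE /=.
  by apply: ucv; apply: inL2_mulI; exact: (rowP x).1.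
have mL : cmeasurable L.
  split.
    apply: (measurable_fun_cvg (h := fun k x => complex.Re (H (u k) x))) => [k|x _].
      by case: (mH (u k)).
    exact: cRe.
  apply: (measurable_fun_cvg (h := fun k x => complex.Im (H (u k) x))) => [k|x _].
    by case: (mH (u k)).
  exact: cIm.
(* Cauchy-Schwarz for the real and imaginary parts separately, with |g n| <= 1 and |row x|^2 <= D
   x. *)
have HD n x : cdot (H n x) (H n x) <= 2 * D x.
  have [Hr rD] := rowP x; have Hir := inL2_mulI Hr.
  have cs := inner_cauchy (inL2_0 muh) (@inL2_ZD _ _ _ muh) (@ripC _ _ _ muh)
    (@ripZD _ _ _ muh) (@rip_ge0 _ _ _ muh).
  have r0 := rip_ge0 Hr; have h3 := ler_wpM2r r0 (g_le1 n); rewrite mul1r in h3.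
  have h1 : rip muh (g n) (row x) ^+ 2 <= D x.
    by apply: le_trans (cs _ _ (g_L2 n) Hr) _; exact: le_trans h3 rD.
  have h2 : rip muh (g n) (fun xi => 'i%C * row x xi) ^+ 2 <= D x.
    apply: le_trans (cs _ _ (g_L2 n) Hir) _; rewrite rip_mulI; exact: le_trans h3 rD.
  by rewrite /cdot HE /= -!expr2; lra.
have cLL x : (fun k => cdot (H (u k) x) (H (u k) x)) @ \oo --> cdot (L x) (L x).
  by apply: cvgD; apply: cvgM.
have LD x : cdot (L x) (L x) <= 2 * D x.
  rewrite -(cvg_lim (@Rhausdorff R) (cLL x)).
  apply: limr_le; first by apply/cvg_ex; exists (cdot (L x) (L x)).
  by apply: nearW => k; exact: HD.
pose phi : fn := crestrict S L.
have mS1 : measurable_fun setT (\1_S : Om -> R) by exact: measurable_indic.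
(* Both |H (u k)|^2 and |L|^2 are at most 2 D, so |H (u k) - L|^2 <= 8 D. The weight (1 + |x|)^(2m)
   in D is integrable over S. *)
have ID : mu.-integrable setT (EFin \o (fun x => 8 * (\1_S x * D x))).
  have := integrableZl measurableT (8 * c ^+ 2 * fine (etah Sig))
    (weighted_integrable S_measurable S_finite).
  by apply: eq_integrable => // x _ /=; rewrite -EFinM; congr EFin; rewrite /D; ring.
have Hphi : inL2 mu phi.
  apply: (inL2_le _ ID); first exact: cmeasurable_crestrict.
  move=> x; rewrite sqr_normcE; have [Sx|Sx] := pselect (S x); last first.
    by rewrite /phi crestrict_out// indicE memNset// /cdot /= !mul0r addr0 mulr0.
  rewrite /phi crestrict_in// indicE mem_set// mul1r.
  by have := LD x; have := D0 x; lra.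
have SD k x : cdot (H (u k) x - L x) (H (u k) x - L x) <= 8 * D x.
  have := HD (u k) x; have := LD x.
  rewrite /cdot !ReImE; set p := complex.Re _; set q := complex.Im _.
  set p' := complex.Re _; set q' := complex.Im _ => h1 h2.
  have := sqr_ge0 (p + p'); have := sqr_ge0 (q + q'); nra.
pose dif k : fn := crestrict S (fun x => H (u k) x - L x).
have mdif k : cmeasurable (dif k).
  apply: cmeasurable_crestrict => //; have [h1 h2] := mH (u k); have [l1 l2] := mL.
  split.
    by under eq_fun do rewrite cReD cReN; exact: measurable_funB.
  by under eq_fun do rewrite cImD cImN; exact: measurable_funB.
have dif_le k x : cdot (dif k x) (dif k x) <= 8 * (\1_S x * D x).
  rewrite /dif; have [Sx|Sx] := pselect (S x); last first.
    by rewrite crestrict_out// indicE memNset// /cdot /= !mul0r addr0 mulr0.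
  by rewrite crestrict_in// indicE mem_set// mul1r.
have Hdif k : inL2 mu (dif k).
  by apply: (inL2_le (mdif k) ID) => x; rewrite sqr_normcE.
have cdif x : (fun k => cdot (dif k x) (dif k x)) @ \oo --> (0 : R).
  rewrite /dif; have [Sx|Sx] := pselect (S x); last first.
    under eq_fun do rewrite crestrict_out// /cdot /= mulr0 addr0.
    exact: cvg_cst.
  under eq_fun do rewrite crestrict_in// /cdot cReD cImD cReN cImN.
  have z1 : (fun k => complex.Re (H (u k) x) - complex.Re (L x)) @ \oo --> (0 : R).
    by rewrite -(subrr (complex.Re (L x))); apply: cvgB => //; exact: cvg_cst.
  have z2 : (fun k => complex.Im (H (u k) x) - complex.Im (L x)) @ \oo --> (0 : R).
    by rewrite -(subrr (complex.Im (L x))); apply: cvgB => //; exact: cvg_cst.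
  have := cvgD (cvgM z1 z1) (cvgM z2 z2); rewrite !mulr0 addr0.
  exact.
have dif0 (e : R) : 0 < e -> \forall k \near \oo, rip mu (dif k) (dif k) < e.
  move=> e0.
  pose F k x : \bar R := (cdot (dif k x) (dif k x))%:E.
  have m1 k : measurable_fun setT (F k).
    by apply/measurable_EFinP; exact: (measurable_cdot (mdif k) (mdif k)).
  have m2 : measurable_fun setT (cst 0%E : Om -> \bar R) by exact: measurable_cst.
  have a1 : {ae mu, forall x, setT x -> (fun k => F k x) @ \oo --> 0%E}.
    by apply: aeW => x _; apply: cvg_EFin; [by apply: nearW|exact: cdif].
  have a2 : {ae mu, forall x, forall k, setT x ->
      (`|F k x| <= (8 * (\1_S x * D x))%R%:E)%E}.
    by apply: aeW => x k _; rewrite /F /= lee_fin ger0_norm ?cdot_ge0.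
  have [_ _] := dominated_convergence measurableT m1 m2 a1 ID a2.
  rewrite integral0 => cI; have e0' : (0 < e%:E)%E by rewrite lte_fin.
  have nb : \forall k \near \oo, (\int[mu]_x F k x < e%:E)%E.
    exact: (cI (fun v => (v < e%:E)%E) (open_ereal_lt' e0')).
  apply: filterS nb => k; rewrite -sqnormL2E (inL2_sqnorm (Hdif k)).
  by rewrite lte_fin.
exists phi; split => // e e0.
(* Two applications of |p + q|^2 <= 2 |p|^2 + 2 |q|^2 below cost at most a factor 4 on the defects
   and on |dif|^2, each less than e / 16; the total is below e / 2. *)
have e8 : 0 < e / 16 by rewrite divr_gt0.
have small : \forall k \near \oo, k.+1%:R^-1 < e / 16.
  exact: (near_infty_natSinv_lt (PosNum e8)).
have [k [hk1 hk2]] := filter_ex (filterI (dif0 _ e8) small).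
exists (u k); have hd : defect_S (f (u k)) + defect_Sig (f (u k)) < e / 16.
  apply: lt_trans (f_defect (u k)) _; apply: le_lt_trans hk2.
  by rewrite lef_pV2 ?posrE// ler_nat ltnS.
have HfS := inL2_crestrict mSc (f_L2 (u k)).
have dS0 : 0 <= defect_S (f (u k)) by exact: rip_ge0.
have dSig0 : 0 <= defect_Sig (f (u k)).
  by apply: rip_ge0; apply: inL2_crestrict => //; exact: UL2.
split; last by lra.
have [h Hh Uh] := unitary_onto uU (g_L2 (u k)).
have hH : ae_equal mu h (H (u k)).
  apply: (dual_representation Q_density Qh_density mu_polar muh_polar a_gt0
    K_continuous K_bounded U_plancherel Sig_measurable Sig_finite (g_L2 (u k)) _ Hh Uh).
  by move=> xi; exact: crestrict_out.
have fh := defect_approximation (f_L2 (u k)) Hh Uh.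
pose b : fn := crestrict S ((-1) *: (h : fn) + f (u k)).
have Hb : inL2 mu b by apply: inL2_crestrict => //; exact: inL2_ZD.
have b_le : rip mu b b <= defect_Sig (f (u k)).
  by rewrite -fh; apply: rip_crestrict_le => //; exact: inL2_ZD.
(* With h = H (u k) a.e., f - phi is f off S, plus f - h on S, plus H (u k) - L on S: the first two
   are controlled by the two defects, the last by dominated convergence. *)
have E : ae_equal mu ((-1) *: phi + f (u k)) (crestrict (~` S) (f (u k)) + (b + dif k)).
  apply: filterS hH => x hx.
  rewrite -[LHS]/(((-1) *: phi) x + f (u k) x) scale_realE.
  rewrite -[RHS]/(crestrict (~` S) (f (u k)) x + (b x + dif k x)).
  rewrite /phi /b /dif; have [Sx|Sx] := pselect (S x).
    rewrite !(crestrict_in _ Sx) crestrict_out; last by move=> /(_ Sx).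
    rewrite -[((-1) *: (h : fn) + f (u k)) x]/(((-1) *: (h : fn)) x + f (u k) x) scale_realE hx.
    by apply: complex_ext; rewrite !ReImE /=; ring.
  by rewrite !(crestrict_out _ Sx) crestrict_in// mulr0 !addr0 add0r.
have Hl : inL2 mu ((-1) *: phi + f (u k)) by exact: inL2_ZD.
have addL2 (p q : fn) : inL2 mu p -> inL2 mu q -> inL2 mu (p + q).
  by move=> Hp Hq; have := inL2_ZD 1 Hp Hq; rewrite scale1r.
have Hbd := addL2 _ _ Hb (Hdif k).
have Hr := addL2 _ _ HfS Hbd.
rewrite (eq_rip Hl Hr Hl Hr E E).
have h1 := L2_sqrD_le HfS Hbd; have h2 := L2_sqrD_le Hb (Hdif k).
rewrite -/(defect_S _) in h1; apply: le_lt_trans h1 _.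
by rewrite /defect_S in dS0 hd *; lra.
Qed.

End unit_sequence_of_small_defect.

(** Otherwise [small_defect_limit] yields phi that is approximated by unit vectors of vanishing
    defect. Its own defects are then zero, so phi = 0 by [weak_annihilation], although unit vectors
    come arbitrarily close to it. *)
Lemma unit_defect_bound : exists2 e : R, 0 < e &
  forall f : fn, inL2 mu f -> rip mu f f = 1 -> e <= defect_S f + defect_Sig f.
Proof.
apply: contrapT => nb.
have /choice[f Hf] : forall n : nat, exists f : fn, [/\ inL2 mu f, rip mu f f = 1 &
    defect_S f + defect_Sig f < n.+1%:R^-1].
  move=> n; apply: contrapT => nf; apply: nb; exists n.+1%:R^-1; first by rewrite invr_gt0.
  by move=> f Hf f1; rewrite leNgt; apply/negP => lt; apply: nf; exists f.
have f_L2 n : inL2 mu (f n) by case: (Hf n).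
have f_unit n : rip mu (f n) (f n) = 1 by case: (Hf n).
have f_defect n : defect_S (f n) + defect_Sig (f n) < n.+1%:R^-1 by case: (Hf n).
have [phi [Hphi lim]] := small_defect_limit f_L2 f_unit f_defect.
have dS n : 0 <= defect_S (f n) by apply: rip_ge0; exact: inL2_crestrict.
have dSig n : 0 <= defect_Sig (f n).
  by apply: rip_ge0; apply: inL2_crestrict => //; exact: UL2.
have addL2 (p q : fn) : inL2 mu p -> inL2 mu q -> inL2 mu (p + q).
  by move=> Hp Hq; have := inL2_ZD 1 Hp Hq; rewrite scale1r.
(* The defect of the limit is bounded by that of an approximant and the distance to it; the measure
   is general because this serves for phi and for [U phi]. *)
have key (dT : measure_display) (T : measurableType dT) (nu : {measure set T -> \bar R})
    (p q : T -> Rcomplex R) A : measurable A -> inL2 nu p -> inL2 nu q ->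
    rip nu (crestrict A p) (crestrict A p) <=
    2 * rip nu (crestrict A q) (crestrict A q) + 2 * rip nu ((-1) *: p + q) ((-1) *: p + q).
  move=> mA Hp Hq; have Hd := inL2_ZD (-1) Hp Hq.
  have Hq' := inL2_crestrict mA Hq; have Hd' := inL2_crestrict mA Hd.
  have pE : crestrict A p = (-1) *: (crestrict A ((-1) *: p + q) : T -> Rcomplex R) + crestrict A q.
    rewrite -crestrictZD; congr crestrict; apply/funext => x.
    rewrite -[RHS]/(((-1) *: ((-1) *: p + q)) x + q x) scale_realE.
    rewrite -[((-1) *: p + q) x]/(((-1) *: p) x + q x) scale_realE.
    by apply: complex_ext; rewrite !ReImE /=; ring.
  have HN := inL2_ZD (-1) Hd' (inL2_0 nu); rewrite addr0 in HN.
  rewrite pE addrC; apply: le_trans (L2_sqrD_le Hq' HN) _; rewrite lerD2l.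
  rewrite ler_wpM2l// L2_innerZl// L2_innerZr//.
  by rewrite mulrA mulrNN !mul1r; exact: rip_crestrict_le.
have dphiS : defect_S phi = 0.
  apply/eqP; rewrite eq_le rip_ge0 ?andbT; last exact: inL2_crestrict.
  apply/ler_addgt0Pr => e e0; rewrite add0r.
  have e4 : 0 < e / 4 by rewrite divr_gt0.
  have [n [h1 h2]] := lim _ e4.
  have := key _ _ mu phi (f n) (~` S) mSc Hphi (f_L2 n).
  by have := dS n; have := dSig n; rewrite -/(defect_S _) -/(defect_S _); lra.
have dphiSig : defect_Sig phi = 0.
  apply/eqP; rewrite eq_le rip_ge0 ?andbT; last by apply: inL2_crestrict => //; exact: UL2.
  apply/ler_addgt0Pr => e e0; rewrite add0r.
  have e4 : 0 < e / 4 by rewrite divr_gt0.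
  have [n [h1 h2]] := lim _ e4.
  have := key _ _ muh (U phi) (U (f n)) (~` Sig) mSigc (UL2 Hphi) (UL2 (f_L2 n)).
  have HZ := inL2_ZD (-1) Hphi (f_L2 n).
  have HZ' := inL2_ZD (-1) (UL2 Hphi) (UL2 (f_L2 n)).
  have E := unitaryZD (-1) Hphi (f_L2 n).
  rewrite -(eq_rip (UL2 HZ) HZ' (UL2 HZ) HZ' E E) (unitary_rip U_plancherel HZ HZ).
  by have := dS n; have := dSig n; rewrite -/(defect_Sig _) -/(defect_Sig _); lra.
have phi0 := weak_annihilation (defect_eq_concentrated Hphi dphiS dphiSig).
have [n [h1 _]] := lim _ (@ltr01 R).
have HZ := inL2_ZD (-1) Hphi (f_L2 n).
have E : ae_equal mu ((-1) *: phi + f n) (f n).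
  apply: filterS phi0 => x px.
  by rewrite -[LHS]/(((-1) *: phi) x + f n x) scale_realE px mulr0 add0r.
by move: h1; rewrite (eq_rip HZ (f_L2 n) HZ (f_L2 n) E E) f_unit ltxx.
Qed.

Theorem strong_annihilation : exists C : R, forall f : Om -> R[i], inL2 mu f ->
  (sqnormL2 mu setT f <=
     C%:E * (sqnormL2 mu (~` S) f + sqnormL2 muh (~` Sig) (U f)))%E.
Proof.
have [e e0 He] := unit_defect_bound; exists e^-1 => f Hf.
rewrite inL2_sqnorm// (sqnormL2_crestrict mSc Hf) (sqnormL2_crestrict mSigc (UL2 Hf)).
rewrite -EFinD -EFinM lee_fin mulrC ler_pdivlMr//.
set r := rip mu f f; have r0 : 0 <= r by exact: rip_ge0.
have dS : 0 <= defect_S f by apply: rip_ge0; exact: inL2_crestrict.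
have dSig : 0 <= defect_Sig f.
  by apply: rip_ge0; apply: inL2_crestrict => //; exact: UL2.
have [rz|rn] := eqVneq r 0; first by rewrite rz mul0r addr_ge0.
have rp : 0 < r by rewrite lt_neqAle eq_sym rn.
pose s := (Num.sqrt r)^-1.
have ss : s * s * r = 1.
  have q : Num.sqrt r * Num.sqrt r = r by rewrite -expr2 sqr_sqrtr.
  have q0 : Num.sqrt r != 0 by rewrite gt_eqF// sqrtr_gt0.
  by rewrite /s -{3}q; field.
(* This is f divided by its norm, written as a combination to which [inL2_ZD] and [unitaryZD] apply
   directly. *)
pose F : fn := (s - 1) *: (f : fn) + f.
have FE : F = s *: (f : fn).
  apply/funext => x; rewrite -[LHS]/(((s - 1) *: (f : fn)) x + f x) !scale_realE.
  by apply: complex_ext; rewrite !ReImE /=; ring.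
have HF : inL2 mu F by exact: inL2_ZD.
have scaled dT (T : measurableType dT) (nu : {measure set T -> \bar R})
    (p : T -> Rcomplex R) : inL2 nu p -> rip nu (s *: p) (s *: p) = s * s * rip nu p p.
  move=> Hp; have HN := inL2_ZD s Hp (inL2_0 nu); rewrite addr0 in HN.
  by rewrite L2_innerZl// L2_innerZr// mulrA.
have crZ dT (T : measurableType dT) A (p : T -> Rcomplex R) :
    crestrict A (s *: p) = s *: (crestrict A p : T -> Rcomplex R) :> (T -> Rcomplex R).
  have := crestrictZD A s p 0; rewrite addr0 => ->.
  rewrite [X in _ + X](_ : _ = 0) ?addr0//; apply/funext => x.
  by rewrite /crestrict mulr0.
have F1 : rip mu F F = 1 by rewrite FE scaled.
have FS : defect_S F = s * s * defect_S f.
  by rewrite /defect_S FE crZ scaled//; exact: inL2_crestrict.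
have FSig : defect_Sig F = s * s * defect_Sig f.
  rewrite /defect_Sig -scaled; last by apply: inL2_crestrict => //; exact: UL2.
  rewrite -crZ.
  have UE : ae_equal muh (U F) (s *: (U f : hfn)).
    apply: filterS (unitaryZD (s - 1) Hf Hf) => xi ->.
    rewrite -[LHS]/(((s - 1) *: (U f : hfn)) xi + U f xi) !scale_realE.
    by apply: complex_ext; rewrite !ReImE /=; ring.
  have HsU : inL2 muh (s *: (U f : hfn)).
    by have := inL2_ZD s (UL2 Hf) (inL2_0 muh); rewrite addr0.
  have E : ae_equal muh (crestrict (~` Sig) (U F)) (crestrict (~` Sig) (s *: (U f : hfn))).
    by apply: filterS UE => xi h; rewrite /crestrict h.
  have H1 := inL2_crestrict mSigc (UL2 HF); have H2 := inL2_crestrict mSigc HsU.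
  exact: (eq_rip H1 H2 H1 H2 E E).
have := He F HF F1; rewrite FS FSig -mulrDr => le.
have := ler_wpM2r r0 le.
rewrite (_ : s * s * (defect_S f + defect_Sig f) * r = s * s * r * (defect_S f + defect_Sig f)); last by ring.
by rewrite ss mul1r mulrC.
Qed.

End strong_annihilation.

Theorem theoremB (R : realType) (d : nat) (Om Omh : convexCone R d)
  (mu : {measure set Om -> \bar R}) (muh : {measure set Omh -> \bar R})
  (a ah : R) (Q Qh : 'rV[R]_d -> R)
  (m mh : R) (K : Om -> Omh -> R[i]) (T : (Om -> R[i]) -> (Omh -> R[i]))
  (mu_abs_cont : pushforward mu (@cone_val R d Om) `<< lebesgue_rV d)
  (muh_abs_cont : pushforward muh (@cone_val R d Omh) `<< lebesgue_rV d)
  (Q_density : polar_density Q) (Qh_density : polar_density Qh)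
  (mu_polar : polar_decomposition mu a Q)
  (muh_polar : polar_decomposition muh ah Qh)
  (ah_eq_a : ah = a) (a_gt0 : 0 < a)
  (m_ge0 : 0 <= m) (mh_ge0 : 0 <= mh)
  (K_continuous : continuous_kernel K)
  (K_bounded : polynomially_bounded_kernel m mh K)
  (K_homogeneous : homogeneous_kernel K)
  (T_inversion : inversion_formula mu muh m mh K)
  (T_plancherel : plancherel mu muh K T)
  (S : set Om) (Sig : set Omh)
  (S_measurable : measurable S) (Sig_measurable : measurable Sig)
  (S_measure : (0 < weighted mu (2 * m) S < +oo)%E)
  (Sig_measure : (0 < weighted muh (2 * mh) Sig < +oo)%E) :
  exists C : R, forall f : Om -> R[i], inL2 mu f ->
    (sqnormL2 mu setT f <=
       C%:E * (sqnormL2 mu (~` S) f + sqnormL2 muh (~` Sig) (T f)))%E.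
Proof.
have muh_polar' : polar_decomposition muh a Qh by rewrite -ah_eq_a.
have /andP[_ S_finite] := S_measure.
have /andP[_ Sig_finite] := Sig_measure.
exact: (strong_annihilation Q_density Qh_density mu_polar muh_polar' a_gt0 m_ge0
  mh_ge0 K_continuous K_bounded K_homogeneous T_plancherel S_measurable
  Sig_measurable S_finite Sig_finite).
Qed.
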